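(* Let $\rho,\sigma,q$, the piecewise constant order $\alpha$ (with values $\alpha_0,\dots,\alpha_n$ on the subintervals of the partition $0=x_0<x_1<\dots<x_n<x_{n+1}=L$) and the polynomial excitation $g$ satisfy the assumptions listed in the context, and let $U$ be the solution of the initial boundary value problem (IBVP) described there. Then the Laplace transform $\widehat U(p,x)=\int_0^\infty e^{-pt}U(t,x)\,dt$ satisfies, as $p\to0^+$, $$\partial_x\widehat U(p,0)=\widehat g(p)\Big(C_0+\sum_{i=0}^n C_{i+1}p^{\alpha_i}+O\big(p^{\min\{2\alpha_i:\,0\le i\le n\}}\big)\Big),$$ $$\partial_x\widehat U(p,L)=\widehat g(p)\Big(\widetilde C_0+\sum_{i=0}^n \widetilde C_{i+1}p^{\alpha_i}+O\big(p^{\min\{2\alpha_i:\,0\le i\le n\}}\big)\Big),$$ where $C_0,\dots,C_{n+1}$ and $\widetilde C_0,\dots,\widetilde C_{n+1}$ are real numbers and, for $i=0,1,\dots,n$, $$C_{i+1}=-\frac{1}{\sigma(0)}\int_{x_i}^{x_{i+1}}u(x)^2\rho(x)\,dx,\qquad \widetilde C_{i+1}=\frac{1}{\sigma(L)}\int_{x_i}^{x_{i+1}}u(x)\overline u(x)\rho(x)\,dx.$$ Here $u$ and $\overline u$ are respectively the unique $C^{1,1}[0,L]$ solutions of $$-(\sigma u')'+qu=0\ \text{in }(0,L),\quad u(0)=1,\ u(L)=0,$$ $$-(\sigma \overline u')'+q\overline u=0\ \text{in }(0,L),\quad \overline u(0)=0,\ \overline u(L)=1.$$ The functions $u$ and $\overline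 u$ are strictly positive in $(0,L)$ and satisfy $$u'(0)=C_0,\qquad u'(L)=\widetilde C_0,\qquad \overline u'(0)=-\frac{\sigma(L)}{\sigma(0)}\widetilde C_0.$$
   Context: Coefficients: $L>0$; $\rho\in L^\infty(0,L)$ with $0<\rho_0\le\rho(x)\le\rho_M<\infty$ for a.e. $x$; $\sigma\in C^1[0,L]$ with $0<\sigma_0\le\sigma(x)\le\sigma_M<\infty$ on $[0,L]$; $q\in L^\infty(0,L)$ is nonnegative. Order: $\alpha:[0,L]\to(0,1)$ is piecewise constant, $\alpha=\alpha_0+\sum_{i=1}^n(\alpha_i-\alpha_0)\chi_{(x_i,x_{i+1})}$ for a partition $0=x_0<x_1<\dots<x_n<x_{n+1}=L$ ($n\ge0$), and $\max_{x\in(0,L)}\alpha(x)<2\min_{x\in(0,L)}\alpha(x)$. Excitation: $g(t)=\sum_{k=2}^N g_kt^k$ for some integer $N\ge2$ and real $g_2,\dots,g_N$ with $g_N\neq0$. Its Laplace transform is $\widehat g(p)=\int_0^\infty e^{-pt}g(t)\,dt$. IBVP: $\rho(x)\partial_t^{\alpha(x)}U(t,x)-\partial_x(\sigma(x)\partial_xU(t,x))+q(x)U(t,x)=0$ for $(t,x)\in(0,\infty)\times(0,L)$; $U(t,0)=g(t)$, $U(t,L)=0$ for $t>0$; $U(0,x)=0$ for $x\in(0,L)$. Here $\partial_t^{\alpha(x)}U(t,x)=\frac{1}{\Gamma(1-\alpha(x))}\int_0^t(t-s)^{-\alpha(x)}\partial_sU(s,x)\,ds$ is the Caputo derivative. A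 strong solution is $U\in C^1([0,\infty);L^2(0,L))\cap C([0,\infty);H^2(0,L))$ such that for every $t>0$ the equation holds in $L^2(0,L)$ (i.e. tested against every $\psi\in L^2(0,L)$), and $U(t,0)=g(t)$, $U(t,L)=0$ for all $t>0$, $U(0,\cdot)\equiv0$. ''The solution'' means the unique strong solution with sub-exponential growth in time, i.e. for every $\varepsilon>0$ there is $C$ with $\|U(t,\cdot)\|_{H^2(0,L)}\le Ce^{\varepsilon t}$ for all $t\geq 0$; so $\widehat U(p,\cdot)\in H^2(0,L)$ is defined for all $p>0$. $C^{1,1}[0,L]$ denotes continuously differentiable functions with Lipschitz derivative; the differential equations for $u,\overline u$ hold a.e. *)

(* Defs.v *)
From HB Require Import structures.
From mathcomp Require Import all_boot all_order all_algebra.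
From mathcomp Require Import all_classical all_reals all_analysis.

Set Implicit Arguments.
Unset Strict Implicit.
Unset Printing Implicit Defensive.
Import Order.TTheory GRing.Theory Num.Theory.
Import numFieldNormedType.Exports.

Local Open Scope classical_set_scope.
Local Open Scope ring_scope.

Section Definitions.
Context {R : realType}.
Local Notation mu := (@lebesgue_measure R).
Implicit Types (f g phi psi : R -> R) (L t x p : R).

(* Elements of L^2(0,L), H^1(0,L) and so on are represented by functions on R;
   their values outside of ]0, L[ are irrelevant. *)
Definition Linfty L : set (R -> R) :=
  [set f | f \_ `]0, L[ \in Lfun mu +oo%E].

Definition L2 L : set (R -> R) :=
  [set f | f \_ `]0, L[ \in Lfun mu 2%:E].

Definition L2norm L f : R := fine (Lnorm mu 2%:E (EFin \o (f \_ `]0, L[))).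

Definition L2dot L f g : R := \int[mu]_(x in `]0, L[) (f x * g x).

(* Weak derivatives are tested against C^1_c(0,L); by mollification this is the
   same as testing against smooth functions with compact support. *)
Definition test_function L phi : Prop :=
  [/\ forall x, derivable phi x 1,
      continuous (derive1 phi) &
      exists a b, [/\ 0 < a, b < L & forall x, x \notin `[a, b] -> phi x = 0]].

Definition is_weak_deriv L f g : Prop :=
  forall phi, test_function L phi -> L2dot L f (derive1 phi) = - L2dot L g phi.

Definition H1 L : set (R -> R) :=
  [set f | L2 L f /\ exists2 g, L2 L g & is_weak_deriv L f g].

(* A representative of the weak derivative, meaningful for f in H^1(0,L) and
   then unique up to a null set. *)
Definition weak_deriv L f : R -> R :=
  xget (cst 0) [set g | L2 L g /\ is_weak_deriv L f g].

Definition H2 L : set (R -> R) :=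
  [set f | H1 L f /\ H1 L (weak_deriv L f)].

Definition H2norm L f : R :=
  Num.sqrt (L2norm L f ^+ 2 + L2norm L (weak_deriv L f) ^+ 2
            + L2norm L (weak_deriv L (weak_deriv L f)) ^+ 2).

(* The derivative of a function on [0, L], one-sided at 0 and at L. *)
Definition is_deriv_on L f x (l : R) : Prop :=
  (f y - f x) / (y - x) @[y --> within `[0, L] x^'] --> l.

Definition C1_on L f : Prop :=
  exists2 df : R -> R, (forall x, x \in `[0, L] -> is_deriv_on L f x (df x)) &
                       {within `[0, L], continuous df}.

(* v is a C^{1,1}[0,L] solution of -(sigma v')' + q v = 0 a.e. in (0, L) with
   v(0) = a and v(L) = b. *)
Definition C11_solution L (sigma q : R -> R) (a b : R) (v : R -> R) : Prop :=
  exists dv : R -> R,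
    [/\ forall x, x \in `[0, L] -> is_deriv_on L v x (dv x),
        exists k : R, k.-lipschitz_`[0, L] dv,
        {ae mu, forall x, x \in `]0, L[ ->
           derivable (sigma \* dv) x 1 /\
           - derive1 (sigma \* dv) x + q x * v x = 0},
        v 0 = a & v L = b].

Definition continuous_in_time (N : (R -> R) -> R) (F : R -> R -> R) : Prop :=
  forall t, 0 <= t ->
    N (F s \- F t) @[s --> within `[0, +oo[ (nbhs t)] --> (0 : R).

(* The limit is taken in L^2(0,L); it is one-sided at time 0. *)
Definition is_time_deriv L (F dF : R -> R -> R) : Prop :=
  forall t, 0 <= t -> L2 L (dF t) /\
    L2norm L (fun x => (F s x - F t x) / (s - t) - dF t x)
      @[s --> within `[0, +oo[ t^'] --> (0 : R).

(* W is the integral over the time set I of the L^2(0,L)-valued function F.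
   The integral is characterized by duality; testing makes it independent of
   the choice, for each s, of a representative of F s. *)
Definition is_L2_integral L (I : set R) (F : R -> R -> R) (W : R -> R) : Prop :=
  L2 L W /\ forall psi, L2 L psi ->
    mu.-integrable I (EFin \o (fun s => L2dot L (F s) psi)) /\
    L2dot L W psi = \int[mu]_(s in I) L2dot L (F s) psi.

Definition Gamma (z : R) : R :=
  \int[mu]_(t in `]0, +oo[) (t `^ (z - 1) * expR (- t)).

(* dU is the time derivative of the function whose Caputo derivative is W. *)
Definition is_caputo L (alpha : R -> R) (dU : R -> R -> R) t (W : R -> R) :=
  is_L2_integral L `]0, t[
    (fun s x => (Gamma (1 - alpha x))^-1 * (t - s) `^ (- alpha x) * dU s x) W.

(* The continuity of U t selects the continuous representative of the class
   U(t,.) in H^2(0,L), the one to which boundary values and the pointwise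
   values of the Laplace transform refer. *)
Definition strong_solution L (rho sigma q alpha : R -> R) (g : R -> R)
    (U : R -> R -> R) : Prop :=
  exists dU : R -> R -> R,
  [/\ is_time_deriv L U dU /\ continuous_in_time (L2norm L) dU,
      (forall t, 0 <= t -> H2 L (U t) /\ {within `[0, L], continuous (U t)}) /\
      continuous_in_time (H2norm L) U,
      forall t, 0 < t -> exists2 W, is_caputo L alpha dU t W &
        forall psi, L2 L psi ->
          L2dot L (fun x => rho x * W x
            - weak_deriv L (sigma \* weak_deriv L (U t)) x + q x * U t x) psi
          = 0,
      forall t, 0 < t -> U t 0 = g t /\ U t L = 0 &
      forall x, x \in `]0, L[ -> U 0 x = 0].

Definition subexponential L (U : R -> R -> R) : Prop :=
  forall eps : R, 0 < eps -> exists C : R, forall t, 0 <= t ->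
    H2norm L (U t) <= C * expR (eps * t).

Definition laplace (f : R -> R) p : R :=
  \int[mu]_(t in `[0, +oo[) (expR (- (p * t)) * f t).

Definition piecewise_constant n (xs a : nat -> R) (x : R) : R :=
  a 0%N + \sum_(1 <= i < n.+1) (a i - a 0%N) * \1_`]xs i, xs i.+1[ x.

Definition min_order n (a : nat -> R) : R := \big[Num.min/a 0%N]_(i < n.+1) a i.
Definition max_order n (a : nat -> R) : R := \big[Num.max/a 0%N]_(i < n.+1) a i.

End Definitions.

(* Main.v *)
Require Import Defs.
From HB Require Import structures.
From mathcomp Require Import all_boot all_order all_algebra.
From mathcomp Require Import all_classical all_reals all_analysis.
From mathcomp Require Import measurable_realfun ess_sup_inf.
From mathcomp Require Import ring lra.

(** Write omega for the flux sigma ub' at 0, and V(p, x) for the Laplace transform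
    of U(t, x).  The fluxes of V at the two ends are read off from an integral
    equation for V in the space variable alone.

    For fixed t > 0, the function v = U(t, .) is continuous and in H^2, so that it
    solves a first-order system together with its flux sigma v' ([H2_sl_solution]).
    Pairing this system with u and ub gives Green's representation ([sl_green]): omega (u(x) U(t, 0)
    - U(t, x)) is the integral of rho W against the Green function, W being the Caputo
    derivative.  By its definition by duality, the pairing of W with a function that
    lives on a single piece of the partition is a scalar Caputo derivative of the
    single order a_i ([caputo_piece]), so that the space variable no longer interferes
    with the time variable.  Integrating in time replaces the derivative of U under
    the convolution by U, and the Laplace transform turns the kernel of order a_i into
    the factor p^a_i ([caputo_sum_laplace]).  The outcome is the resolvent equation
    ([resolvent_equation])

      omega (u(x) V(p, 0) - V(p, x))
        = int_0^L p^alpha(y) rho(y) V(p, y) G(x, y) dy,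

    where G(x, y) = u(max x y) ub(min x y).

    Let m be the least order.  The right hand side is at most a constant times
    p^m sup |V(p, .)|.  For small p this can be absorbed, which bounds V(p, .) by a
    multiple of |V(p, 0)| and then shows V(p, .) = V(p, 0) (u + O(p^m))
    ([resolvent_first_order]).  Differentiating the resolvent equation at an end point
    ([green_potential_deriv]) gives the flux of V there as V(p, 0) times u' plus an
    integral of p^alpha rho V against u or ub.  Inserting V = V(p, 0) (u + O(p^m))
    yields the terms C_(i+1) p^a_i, with an error of order p^m p^m
    ([resolvent_second_order]).  Since U(t, 0) = g(t), the factor V(p, 0) is the
    Laplace transform of g.  Dividing the error by V(p, 0) is legitimate even where
    this transform vanishes, because V(p, .) then vanishes as well.

    The functions u and ub come from monotone iteration of the initial value problem
    ([sl_initial_value], [sl_dirichlet_pair]); they are C^{1,1}, and unique in that class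
    because the flux of a C^{1,1} solution is Lipschitz and hence the integral of its
    almost everywhere derivative ([lipschitz_primitive], [C11_solution_eq]). *)

Set Implicit Arguments.
Unset Strict Implicit.
Unset Printing Implicit Defensive.
Import Order.TTheory GRing.Theory Num.Theory.
Import numFieldNormedType.Exports.

Local Open Scope classical_set_scope.
Local Open Scope ring_scope.

(** * Real-valued Lebesgue integrals *)

Section real_integrals.
Context {R : realType}.
Local Notation mu := (@lebesgue_measure R).
Local Notation TR := (measurableTypeR R).
Local Notation intble D f := (mu.-integrable D (EFin \o f)).
Implicit Types (D E : set TR) (f g : TR -> R).

Lemma intble_measurable D f : intble D f -> measurable_fun D f.
Proof. by move=> /(measurable_int mu) /measurable_EFinP. Qed.

Lemma le_intble D f g : measurable D -> measurable_fun D f ->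
  (forall x, D x -> `|f x| <= g x) -> intble D g -> intble D f.
Proof.
move=> mD mf fg; apply: le_integrable => //; first exact/measurable_EFinP.
move=> x Dx /=; rewrite lee_fin (le_trans (fg _ Dx))//; exact: ler_norm.
Qed.

Lemma intbleD D f g : measurable D -> intble D f -> intble D g ->
  intble D (fun x => f x + g x).
Proof. by move=> mD i1 i2; exact: (integrableD mD i1 i2). Qed.

Lemma intbleB D f g : measurable D -> intble D f -> intble D g ->
  intble D (fun x => f x - g x).
Proof. by move=> mD i1 i2; exact: (integrableB mD i1 i2). Qed.

Lemma intbleZ D f k : measurable D -> intble D f -> intble D (fun x => k * f x).
Proof. by move=> mD i1; exact: (integrableZl mD k i1). Qed.

Lemma intble_cst D k : measurable D -> (mu D < +oo)%E -> intble D (fun=> k).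
Proof.
move=> mD fD; apply: measurable_bounded_integrable => //.
exists `|k|; split; first exact: num_real.
by move=> x kx y Dy; exact: ltW.
Qed.

Lemma intble_bounded D f M : measurable D -> (mu D < +oo)%E ->
  measurable_fun D f -> (forall x, D x -> `|f x| <= M) -> intble D f.
Proof. move=> mD fD mf fM; apply: (le_intble mD mf fM); exact: intble_cst. Qed.

Lemma intbleM_bounded D f g M : measurable D -> intble D f ->
  measurable_fun D g -> (forall x, D x -> `|g x| <= M) ->
  intble D (fun x => f x * g x).
Proof.
move=> mD fi mg gM.
apply: (@le_intble _ _ (fun x => `|M| * `|f x|)) => //.
- by apply: measurable_funM => //; exact: intble_measurable.
- move=> x Dx; rewrite normrM mulrC ler_wpM2r// (le_trans (gM _ Dx))//.
  exact: ler_norm.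
- by apply: intbleZ => //; exact: integrable_norm.
Qed.

Lemma eq_intble D f g : measurable D -> (forall x, D x -> f x = g x) ->
  intble D f -> intble D g.
Proof.
move=> mD fg; apply: eq_integrable => // x xD /=; congr EFin; apply: fg; exact: set_mem.
Qed.

Lemma intbleS D E f : measurable D -> measurable E -> E `<=` D ->
  intble D f -> intble E f.
Proof. exact: integrableS. Qed.

Lemma intble_restrict D f : measurable D -> intble D f -> intble setT (f \_ D).
Proof.
move=> mD /(integrable_mkcond _ mD).
by apply: eq_integrable => // x _; rewrite /= restrict_EFin.
Qed.

Lemma aeS (P Q : R -> Prop) : (forall x, P x -> Q x) ->
  {ae mu, forall x, P x} -> {ae mu, forall x, Q x}.
Proof. by move=> PQ; apply: (@filterS _ _ (ae_filter_ringOfSetsType mu)). Qed.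

Lemma aeS2 (P1 P2 Q : R -> Prop) : (forall x, P1 x -> P2 x -> Q x) ->
  {ae mu, forall x, P1 x} -> {ae mu, forall x, P2 x} -> {ae mu, forall x, Q x}.
Proof. by move=> PQ; apply: (@filterS2 _ _ (ae_filter_ringOfSetsType mu)). Qed.

Lemma ae_eq_Rintegral D f g : measurable D ->
  measurable_fun D f -> measurable_fun D g ->
  {ae mu, forall x, D x -> f x = g x} ->
  \int[mu]_(x in D) f x = \int[mu]_(x in D) g x.
Proof.
move=> mD mf mg fg; congr fine; apply: ae_eq_integral => //.
- exact/measurable_EFinP.
- exact/measurable_EFinP.
- by apply: filterS fg => x fgx Dx; rewrite fgx.
Qed.

Lemma ae_integrable D (f g : TR -> \bar R) : measurable D -> measurable_fun D g ->
  {ae mu, forall x, D x -> g x = f x} -> mu.-integrable D f -> mu.-integrable D g.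
Proof.
move=> mD mg gf /integrableP[mf ffin]; apply/integrableP; split => //.
suff -> : (\int[mu]_(x in D) `|g x| = \int[mu]_(x in D) `|f x|)%E by [].
apply: ae_eq_integral => //; [exact: measurableT_comp|exact: measurableT_comp|].
by apply: filterS gf => x gx Dx /=; rewrite gx.
Qed.

Lemma Rintegral_le_norm D f g : measurable D -> measurable_fun D f -> intble D g ->
  (forall x, D x -> `|f x| <= g x) ->
  `|\int[mu]_(x in D) f x| <= \int[mu]_(x in D) g x.
Proof.
move=> mD mf ig fg; have fi := le_intble mD mf fg ig.
apply: (le_trans (le_normr_Rintegral mD fi)); apply: le_Rintegral => //.
exact: integrable_norm.
Qed.

Lemma itv_oo_fin (a b : R) : (mu `]a, b[ < +oo)%E.
Proof. by rewrite lebesgue_measure_itv/=; case: ifP; rewrite ?ltry. Qed.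

Lemma Rintegral_cst_itv (a b k : R) : a <= b -> \int[mu]_(_ in `]a, b[) k = k * (b - a).
Proof.
move=> ab; have E : fine (mu `]a, b[) = b - a.
  rewrite lebesgue_measure_itv/= lte_fin.
  by case: ltgtP ab => //= -> _; rewrite subrr.
by rewrite Rintegral_cst// -E.
Qed.

Lemma Rintegral_norm_bound (a b : R) f (M : R) : a <= b ->
  measurable_fun (`]a, b[ : set TR) f ->
  (forall x, x \in `]a, b[ -> `|f x| <= M) ->
  `|\int[mu]_(x in `]a, b[) f x| <= M * (b - a).
Proof.
move=> ab mf fM; rewrite -Rintegral_cst_itv//; apply: Rintegral_le_norm => //.
by apply: intble_cst => //; exact: itv_oo_fin.
Qed.

(** The image of Lebesgue measure under an affine bijection is a multiple of
    Lebesgue measure, because that holds on half-open intervals, which generate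
    the Borel sets. *)
Lemma lebesgue_affine (a b : R) (A : set TR) : a != 0 -> measurable A ->
  (`|a|%:E * mu ((fun x : R => (a * x + b)%R) @^-1` A) = mu A)%E.
Proof.
move=> a0 mA.
have mphi : measurable_fun setT (fun x : TR => a * x + b : TR).
  by apply: measurable_funD => //; exact: measurable_funM.
pose r : {nonneg R} := NngNum (normr_ge0 a).
pose nu := mscale r (measure_function_pushforward__canonical__measure_function_Measure mu mphi).
suff -> : mu A = nu A by [].
apply: (lebesgue_measure_unique (mu := nu)) mA => X /ocitvP[->|[[u v]/= uv ->]].
  by rewrite !measure0.
rewrite /nu /mscale/= /pushforward.
have -> : (fun x => a * x + b) @^-1` `]u, v] =
  if 0 < a then `](u - b) / a, (v - b) / a]%classic else `[(v - b) / a, (u - b) / a[%classic.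
  case: ifPn => [apos|]; last rewrite -leNgt le_eqVlt (negbTE a0)/= => aneg.
    apply/seteqP; split => x /=; rewrite !in_itv/= => /andP[h1 h2];
    by move: h1 h2; rewrite ltr_pdivrMr// ler_pdivlMr// ltrBlDr lerBrDr mulrC => -> ->.
  apply/seteqP; split => x /=; rewrite !in_itv/= => /andP[h1 h2];
  by move: h1 h2; rewrite ler_ndivrMr// ltr_ndivlMr// lerBrDr ltrBlDr mulrC => -> ->.
case: ifPn => [apos|]; last rewrite -leNgt le_eqVlt (negbTE a0)/= => aneg.
  rewrite !lebesgue_measure_itv/= !lte_fin ltr_pM2r ?invr_gt0// ltrD2r uv.
  rewrite -!EFinB -EFinM; congr EFin; rewrite gtr0_norm//; field; exact: a0.
rewrite !lebesgue_measure_itv/= !lte_fin ltr_nM2r ?invr_lt0// ltrD2r uv.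
rewrite -!EFinB -EFinM; congr EFin; rewrite ltr0_norm//; field; exact: a0.
Qed.

Lemma ge0_integral_affine (a b : R) (f : TR -> \bar R) : a != 0 ->
  measurable_fun setT f -> (forall x, 0 <= f x)%E ->
  (\int[mu]_x f x = `|a|%:E * \int[mu]_x f (a * x + b)%R)%E.
Proof.
move=> a0 mf f0.
have mphi : measurable_fun setT (fun x : TR => a * x + b : TR).
  by apply: measurable_funD => //; exact: measurable_funM.
have := @ge0_integral_pushforward _ _ _ _ R (fun x : measurableTypeR R => a * x + b : measurableTypeR R)
  mphi mu setT f measurableT mf (fun x _ => f0 x).
rewrite preimage_setT /= => <-.
pose r : {nonneg R} := NngNum (normr_ge0 a).
rewrite -[(`|a|%:E)]/(r%:num%:E) -ge0_integral_mscale//.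
apply: eq_measure_integral => A mA _; exact: (esym (lebesgue_affine b a0 mA)).
Qed.

Lemma intble_affine (a b : R) f : a != 0 -> intble setT f ->
  intble setT (fun x => f (a * x + b)).
Proof.
move=> a0 /integrableP[mf fi]; apply/integrableP; split.
  apply: (measurableT_comp mf).
  by apply: measurable_funD => //; exact: measurable_funM.
move: fi; rewrite (@ge0_integral_affine a b)//; last exact: measurableT_comp.
rewrite /comp; set I := integral _ _ _.
have : (0 <= I)%E by apply: integral_ge0.
by case: I => [r _ _|_|//]; [rewrite ltry|rewrite gt0_muley// lte_fin normr_gt0].
Qed.

Lemma Rintegral_affine (a b : R) f : a != 0 -> intble setT f ->
  \int[mu]_x f x = `|a| * \int[mu]_x f (a * x + b).
Proof.
move=> a0 fi; have mf := intble_measurable fi.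
have fi' := intble_affine b a0 fi.
have h (g : TR -> \bar R) : measurable_fun setT g -> (forall x, 0 <= g x)%E ->
  (\int[mu]_x g x = `|a|%:E * \int[mu]_x g (a * x + b)%R)%E.
  by move=> *; exact: ge0_integral_affine.
rewrite /Rintegral integralE (h ((EFin \o f)^\+)%E)//; last first.
  by apply: measurable_funepos; exact/measurable_EFinP.
rewrite (h ((EFin \o f)^\-)%E)//; last first.
  by apply: measurable_funeneg; exact/measurable_EFinP.
have K : (\int[mu]_x (EFin \o f)^\+ (a * x + b)%R - \int[mu]_x (EFin \o f)^\- (a * x + b)%R
  = \int[mu]_x (f (a * x + b)%R)%:E)%E.
  rewrite [RHS]integralE.
  rewrite (funepos_comp (EFin \o f) (fun x => a * x + b)).
  by rewrite (funeneg_comp (EFin \o f) (fun x => a * x + b)).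
rewrite -muleBr//; last first.
  have := integrable_add_def measurableT fi'.
  rewrite (funepos_comp (EFin \o f) (fun x => a * x + b)).
  by rewrite (funeneg_comp (EFin \o f) (fun x => a * x + b)).
rewrite K fineM//; exact: (integrable_fin_num measurableT fi').
Qed.

(** The sections are integrable only almost everywhere; elsewhere the real-valued
    inner integral is a default value, which the outer integral does not see. *)
Lemma Rfubini (f : TR * TR -> R) :
  (mu \x mu)%E.-integrable setT (EFin \o f) ->
  [/\ intble setT (fun x => \int[mu]_y f (x, y)),
      intble setT (fun y => \int[mu]_x f (x, y)) &
      \int[mu]_x \int[mu]_y f (x, y) = \int[mu]_y \int[mu]_x f (x, y)].
Proof.
move=> fi.
have a1 := ae_integrable1 fi; have a2 := ae_integrable2 fi.
have i1 := integrable_fubini_F fi.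
have m1 := measurable_int _ i1.
have m2 := measurable_fubini_G fi.
have i2 : mu.-integrable setT (fubini_G mu (EFin \o f)) .
  apply/integrableP; split => //.
  have mf := measurable_int _ fi.
  apply: le_lt_trans ((integrable21ltyP mu mu mf).1 fi).
  apply: ge0_le_integral => //.
  - exact: measurableT_comp.
  - apply: (measurable_fun_fubini_tonelli_G (m1 := mu) (abse \o (EFin \o f))) => //.
      exact: measurableT_comp.
    by move=> x; exact: abse_ge0.
  - move=> y _; apply: le_abse_integral => //.
    exact: (measurableT_comp mf (measurable_pair2 y)).
have mF : measurable_fun setT (fun x => \int[mu]_y f (x, y)).
  exact: (measurableT_comp (fine_measurable measurableT) m1).
have mG : measurable_fun setT (fun y => \int[mu]_x f (x, y)).
  exact: (measurableT_comp (fine_measurable measurableT) m2).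
have e1 : {ae mu, forall x, setT x -> (\int[mu]_y f (x, y))%:E = fubini_F mu (EFin \o f) x}.
  apply: filterS a1 => x ix _; rewrite /Rintegral fineK//.
  exact: integrable_fin_num ix.
have e2 : {ae mu, forall y, setT y -> (\int[mu]_x f (x, y))%:E = fubini_G mu (EFin \o f) y}.
  apply: filterS a2 => x ix _; rewrite /Rintegral fineK//.
  exact: integrable_fin_num ix.
have E1 : (\int[mu]_x (\int[mu]_y f (x, y))%:E = \int[mu]_x fubini_F mu (EFin \o f) x)%E.
  by apply: ae_eq_integral e1 => //; exact/measurable_EFinP.
have E2 : (\int[mu]_y (\int[mu]_x f (x, y))%:E = \int[mu]_y fubini_G mu (EFin \o f) y)%E.
  by apply: ae_eq_integral e2 => //; exact/measurable_EFinP.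
split.
- by apply: ae_integrable e1 i1 => //; exact/measurable_EFinP.
- by apply: ae_integrable e2 i2 => //; exact/measurable_EFinP.
- by rewrite {1}/Rintegral E1 [RHS]/Rintegral E2; congr fine; exact: Fubini.
Qed.

End real_integrals.

(** * Primitives of integrable functions *)

Section epsilon_delta.
Context {R : realType}.
Implicit Types (f g F : R -> R) (x y L : R).

Lemma within_continuousP (A : set R) f : {within A, continuous f} <->
  forall x, A x -> forall e : R, 0 < e -> exists2 d : R, 0 < d &
    forall y, A y -> `|y - x| < d -> `|f y - f x| <= e.
Proof.
split.
- move=> cf x Ax e e0; have := cf x.
  rewrite /continuous_at => cfx.
  have {}cfx : f y @[y --> within A (nbhs x)] --> f x.
    by apply: cvg_trans cfx; rewrite nbhs_subspace_in.
  move/cvgrPdist_le : cfx => /(_ e e0).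
  rewrite near_withinE => /nbhs_ballP[d/= d0 dH]; exists d => // y Ay yx.
  by rewrite distrC; apply: dH => //; rewrite /ball/= distrC.
- move=> H; rewrite continuous_subspace_in => x /set_mem Ax.
  suff : f y @[y --> within A (nbhs x)] --> f x.
    by apply: cvg_trans; rewrite nbhs_subspace_in.
  apply/cvgrPdist_le => e e0; have [d d0 dH] := H _ Ax _ e0.
  rewrite near_withinE; apply/nbhs_ballP; exists d => //= y.
  by rewrite /ball/= distrC => xy Ay; rewrite distrC; exact: dH.
Qed.

(** Without the quotient, the point y = x needs no exception. *)
Lemma is_deriv_onP L f x (l : R) : is_deriv_on L f x l <->
  forall e : R, 0 < e -> exists2 d : R, 0 < d &
    forall y, y \in `[0, L] -> `|y - x| < d ->
      `|f y - f x - l * (y - x)| <= e * `|y - x|.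
Proof.
split.
- move=> /cvgrPdist_le H e e0; have := H _ e0.
  rewrite near_withinE /dnbhs near_withinE => /nbhs_ballP[d/= d0 dH]; exists d => // y yL yx.
  have [->|xy] := eqVneq y x; first by rewrite !subrr mulr0 subr0 normr0 mulr0.
  have := dH y; rewrite /ball/= distrC => /(_ yx xy yL).
  rewrite distrC -[X in X <= _ -> _](@mulfK _ `|y - x|) ?normr_eq0 ?subr_eq0//.
  rewrite ler_pdivrMr ?normr_gt0 ?subr_eq0// -normrM mulrBl divfK ?subr_eq0//.
- move=> H; apply/cvgrPdist_le => e e0; have [d d0 dH] := H _ e0.
  rewrite near_withinE /dnbhs near_withinE; apply/nbhs_ballP; exists d => //= y.
  rewrite /ball/= distrC => yx xy yL.
  have := dH y yL yx; rewrite -ler_pdivrMr ?normr_gt0 ?subr_eq0//.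
  by rewrite -normf_div mulrBl mulfK ?subr_eq0// distrC.
Qed.

End epsilon_delta.

Section primitives.
Context {R : realType}.
Local Notation mu := (@lebesgue_measure R).
Local Notation TR := (measurableTypeR R).
Local Notation intble D f := (mu.-integrable D (EFin \o f)).

(** Absolute continuity on [0, L] with density f.  All differential equations
    below are written in this integrated form, which tolerates coefficients that are
    merely bounded and measurable. *)
Definition is_primitive (L : R) (F f : R -> R) : Prop :=
  intble `]0, L[ f /\
  forall x : R, x \in `[0, L] -> F x = F 0 + \int[mu]_(y in `]0, x[) f y.

Implicit Types (f g F G : R -> R) (x y L : R).

Lemma intble_sub L x y f : 0 <= x -> y <= L -> intble `]0, L[ f ->
  intble `]x, y[ f.
Proof.
move=> x0 yL; apply: intbleS => //.
by apply: subset_itv; rewrite bnd_simp.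
Qed.

Lemma Rintegral_itv_split L f x y : 0 <= x -> x <= y -> y <= L ->
  intble `]0, L[ f ->
  \int[mu]_(z in `]0, y[) f z =
  \int[mu]_(z in `]0, x[) f z + \int[mu]_(z in `]x, y[) f z.
Proof.
move=> x0; rewrite le_eqVlt => /predU1P[<- xL fi|xy yL fi].
  by rewrite set_itvoo0 Rintegral_set0 addr0.
have iy : intble `]0, y[ f by exact: intble_sub fi.
have := @Rintegral_itvB R f (BRight 0) (BLeft y) x iy; rewrite !bnd_simp => /(_ x0 xy) <-.
rewrite -(@Rintegral_itv_bndo_bndc _ (BRight 0) x); last first.
  by apply: intble_sub fi => //; rewrite (le_trans (ltW xy)).
by rewrite addrC subrK.
Qed.

Lemma primitive_incr L F f x y : is_primitive L F f -> 0 <= x -> x <= y -> y <= L ->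
  F y - F x = \int[mu]_(z in `]x, y[) f z.
Proof.
move=> [fi HF] x0 xy yL.
rewrite (HF y) ?in_itv/= ?(le_trans x0)// (HF x) ?in_itv/= ?x0 ?(le_trans xy)//.
rewrite (Rintegral_itv_split x0 xy yL fi); ring.
Qed.

(** The mean value inequality: derivatives and Lipschitz bounds of primitives both
    come from it. *)
Lemma primitive_incr_bound L F f (c e : R) x y : is_primitive L F f ->
  0 <= x -> x <= y -> y <= L ->
  (forall z, x < z < y -> `|f z - c| <= e) ->
  `|F y - F x - c * (y - x)| <= e * (y - x).
Proof.
move=> pF x0 xy yL fc.
rewrite (primitive_incr pF)//; have [fi _] := pF.
have fi' := intble_sub x0 yL fi.
rewrite -Rintegral_cst_itv// -RintegralB//; last by apply: intble_cst => //; exact: itv_oo_fin.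
apply: Rintegral_norm_bound => //.
by apply: measurable_funB => //; exact: intble_measurable fi'.
Qed.

Lemma primitive_deriv_on L F f x : is_primitive L F f -> x \in `[0, L] ->
  {within `[0, L], continuous f} -> is_deriv_on L F x (f x).
Proof.
move=> pF xL /within_continuousP cf; apply/is_deriv_onP => e e0.
have [d d0 dH] := cf _ xL _ e0; exists d => // y yL yx.
move: xL yL; rewrite !in_itv/= => /andP[x0 xL] /andP[y0 yL].
have B (z : R) : 0 <= z <= L -> `|z - x| < d -> `|f z - f x| <= e.
  by move=> z0 zx; apply: dH => //=; rewrite in_itv.
have [xy|/ltW xy] := leP x y.
  rewrite [in X in _ <= X]ger0_norm ?subr_ge0//.
  apply: (primitive_incr_bound pF) => // z /andP[xz zy]; apply: B; first by lra.
  by move: yx; rewrite !ger0_norm; lra.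
rewrite -normrN [in X in _ <= X]distrC [in X in _ <= X]ger0_norm ?subr_ge0//.
rewrite (_ : - (F y - F x - f x * (y - x)) = F x - F y - f x * (x - y)); last by ring.
apply: (primitive_incr_bound pF) => // z /andP[xz zy]; apply: B; first by lra.
by move: yx; rewrite !ler0_norm; lra.
Qed.

Lemma primitive_continuous L F f : is_primitive L F f ->
  {within `[0, L], continuous F}.
Proof.
move=> [fi HF]; have [L0|L0] := leP 0 L; last first.
  by rewrite set_itv_ge ?bnd_simp -?ltNge//; exact: continuous_subspace0.
pose fz := f \_ `]0, L[.
have fzi : intble setT fz by exact: intble_restrict.
have fzi' : intble `[0, L] fz by apply: intbleS fzi.
have := parameterized_integral_continuous L0 fzi' => /within_continuousP C.
apply/within_continuousP => x xL e e0; have [d d0 dH] := C _ xL _ e0.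
exists d => // y yL yx; rewrite HF// (HF x)//.
have E z : z \in `[0, L] -> \int[mu]_(t in `]0, z[) f t = parameterized_integral mu 0 z fz.
  rewrite in_itv/= => /andP[z0 zL].
  rewrite /parameterized_integral -Rintegral_itv_obnd_cbnd; last exact: intbleS fzi.
  rewrite -Rintegral_itv_bndo_bndc; last exact: intbleS fzi.
  apply: eq_Rintegral => t; rewrite inE/= in_itv/= => /andP[t0 tz].
  by rewrite /fz patchE mem_set//= in_itv/= t0 (lt_le_trans tz).
by rewrite !E// (_ : _ + _ - _ = parameterized_integral mu 0 y fz - parameterized_integral mu 0 x fz); [exact: dH|ring].
Qed.

Lemma continuous_itv_measurable (a b : R) f : {within `[a, b], continuous f} ->
  measurable_fun (`[a, b] : set TR) f.
Proof. by move=> cf; exact: subspace_continuous_measurable_fun. Qed.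

Lemma continuous_itv_oo_measurable (a b : R) f : {within `[a, b], continuous f} ->
  measurable_fun (`]a, b[ : set TR) f.
Proof.
move=> cf; apply: measurable_funS (continuous_itv_measurable cf) => //.
by apply: subset_itv; rewrite bnd_simp.
Qed.

Lemma continuous_itv_bounded (a b : R) f : {within `[a, b], continuous f} ->
  exists2 M, 0 <= M & forall x, x \in `[a, b] -> `|f x| <= M.
Proof.
move=> cf; have [M [_ HM]] := compact_bounded (continuous_compact cf (@segment_compact _ a b)).
exists (`|M| + 1); first by rewrite addr_ge0.
move=> x xab; apply: (HM (`|M| + 1)); first by rewrite (le_lt_trans (ler_norm M))// ltrDl.
by exists x.
Qed.

Lemma continuous_intble (a b : R) f : {within `[a, b], continuous f} ->
  intble `]a, b[ f.
Proof.
move=> cf; have [M M0 HM] := continuous_itv_bounded cf.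
apply: (@intble_bounded _ _ _ M) => //; first exact: itv_oo_fin.
  exact: continuous_itv_oo_measurable.
by move=> x /= xab; apply: HM; exact: subset_itv_oo_cc.
Qed.

Lemma intbleM_continuous L f g : intble `]0, L[ f ->
  {within `[0, L], continuous g} -> intble `]0, L[ (fun x => f x * g x).
Proof.
move=> fi cg; have [M M0 HM] := continuous_itv_bounded cg.
apply: (@intbleM_bounded _ _ _ _ M) => //; first exact: continuous_itv_oo_measurable.
by move=> x /= xab; apply: HM; exact: subset_itv_oo_cc.
Qed.

Lemma eq_primitive L F G f g : (forall x, x \in `[0, L] -> F x = G x) ->
  (forall x, x \in `]0, L[ -> f x = g x) ->
  is_primitive L F f -> is_primitive L G g.
Proof.
move=> FG fg [fi HF]; split; first by apply: eq_intble fi => // x /= /fg.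
move=> x xL; have /andP[x0 x1] : 0 <= x <= L by move: xL; rewrite in_itv.
rewrite -!FG ?in_itv/= ?lexx ?(le_trans x0)// HF//; congr (_ + _).
apply: eq_Rintegral => y; rewrite inE/= in_itv/= => /andP[y0 yx].
by apply: fg; rewrite in_itv/= y0 (lt_le_trans yx).
Qed.

Lemma primitive_ae L F f g : is_primitive L F f ->
  measurable_fun (`]0, L[ : set TR) g ->
  {ae mu, forall x, x \in `]0, L[ -> g x = f x} -> is_primitive L F g.
Proof.
move=> [fi HF] mg gf; split.
  apply: ae_integrable fi => //; first exact/measurable_EFinP.
  by apply: aeS gf => x H xL /=; rewrite H.
move=> x xL; rewrite HF//; congr (_ + _).
have /andP[x0 x1] : 0 <= x <= L by move: xL; rewrite in_itv.
have sub : `]0, x[ `<=` (`]0, L[ : set R) by apply: subset_itvl; rewrite bnd_simp.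
apply: ae_eq_Rintegral => //.
- by apply: intble_measurable; exact: intble_sub fi.
- exact: measurable_funS mg.
- by apply: aeS gf => y gfy /= /sub yL; rewrite gfy.
Qed.

Lemma primitiveD L F G f g : is_primitive L F f -> is_primitive L G g ->
  is_primitive L (fun x => F x + G x) (fun x => f x + g x).
Proof.
move=> [fi HF] [gi HG]; split; first exact: intbleD.
move=> x xL; have /andP[x0 x1] : 0 <= x <= L by move: xL; rewrite in_itv.
by rewrite RintegralD//; [rewrite HF// HG//; ring| exact: intble_sub fi|exact: intble_sub gi].
Qed.

Lemma primitiveZ L F f (c : R) : is_primitive L F f ->
  is_primitive L (fun x => c * F x) (fun x => c * f x).
Proof.
move=> [fi HF]; split; first exact: intbleZ.
move=> x xL; have /andP[x0 x1] : 0 <= x <= L by move: xL; rewrite in_itv.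
by rewrite RintegralZl//; [rewrite HF//; ring| exact: intble_sub fi].
Qed.

Lemma primitiveB L F G f g : is_primitive L F f -> is_primitive L G g ->
  is_primitive L (fun x => F x - G x) (fun x => f x - g x).
Proof.
move=> pF /(primitiveZ (-1)) pG; apply: eq_primitive (primitiveD pF pG) => x _; ring.
Qed.

Lemma primitive_cst L (c : R) : is_primitive L (fun=> c) (fun=> 0).
Proof.
split; first by apply: intble_cst => //; exact: itv_oo_fin.
by move=> x _; rewrite Rintegral_cst// mul0r addr0.
Qed.

Lemma primitive_integral L f (c : R) : intble `]0, L[ f ->
  is_primitive L (fun x => c + \int[mu]_(y in `]0, x[) f y) f.
Proof.
move=> fi; split=> // x _.
by rewrite set_itvoo0 Rintegral_set0 addr0.
Qed.

End primitives.

(** * Integration by parts and differentiation of primitives *)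

Section product_rule.
Context {R : realType}.
Local Notation mu := (@lebesgue_measure R).
Local Notation TR := (measurableTypeR R).
Local Notation intble D f := (mu.-integrable D (EFin \o f)).
Implicit Types (f g : TR -> R).

Lemma mem_itvE (i : interval R) (r : R) : (r \in [set` i]) = (r \in i).
Proof. by apply/idP/idP => [/set_mem//|H]; exact/mem_set. Qed.

Lemma patch_itv_oo (f : R -> R) (a b r : R) :
  (f \_ `]a, b[) r = if a < r < b then f r else 0.
Proof.
by rewrite patchE mem_itvE in_itv.
Qed.

Lemma integrable_prodM f g : intble setT f -> intble setT g ->
  (mu \x mu)%E.-integrable setT (EFin \o (fun z : TR * TR => f z.1 * g z.2)).
Proof.
move=> fi gi; have mf := intble_measurable fi; have mg := intble_measurable gi.
apply/integrable12ltyP.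
  apply/measurable_EFinP; apply: measurable_funM.
    exact: (measurableT_comp mf measurable_fst).
  exact: (measurableT_comp mg measurable_snd).
have [_ gfin] := integrableP _ _ _ gi; have [_ ffin] := integrableP _ _ _ fi.
set G := (\int[mu]_y `|(EFin \o g) y|)%E in gfin.
have G0 : (0 <= G)%E by exact: integral_ge0.
have Gf : G \is a fin_num by rewrite ge0_fin_numE.
rewrite (_ : (\int[mu]_x _)%E = (\int[mu]_x (`|(f x)%:E| * G))%E); last first.
  apply: eq_integral => x _; rewrite -ge0_integralZl//.
  - by apply: eq_integral => y _; rewrite /= normrM EFinM.
  - by apply: measurableT_comp => //; exact/measurable_EFinP.
rewrite -(fineK Gf) ge0_integralZr//; last 2 first.
- by apply: measurableT_comp => //; exact/measurable_EFinP.
- by rewrite lee_fin fine_ge0.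
apply: lte_mul_pinfty; [exact: integral_ge0| |exact: ltry].
by rewrite ge0_fin_numE//; exact: integral_ge0.
Qed.

Lemma integrable_prod_mask (h : TR * TR -> R) (b : TR * TR -> bool) :
  (mu \x mu)%E.-integrable setT (EFin \o h) -> measurable_fun setT b ->
  (mu \x mu)%E.-integrable setT (EFin \o (fun z => if b z then h z else 0)).
Proof.
move=> hi mb; have mh := measurable_int _ hi; apply: le_integrable hi => //.
  apply/measurable_EFinP; apply: measurable_fun_ifT => //.
  exact/measurable_EFinP.
by move=> z _; rewrite /= lee_fin; case: ifP => //; rewrite normr0.
Qed.

Lemma intble_mask f (b : TR -> bool) :
  intble setT f -> measurable_fun setT b ->
  intble setT (fun z => if b z then f z else 0).
Proof.
move=> fi mb; have mf := intble_measurable fi.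
apply: (@le_intble _ _ _ (fun z => `|f z|)) => //.
- by apply: measurable_fun_ifT.
- by move=> x _; case: ifP => //; rewrite normr0.
- exact: integrable_norm.
Qed.

(** Integration by parts for two indefinite integrals: both sides are the
    integral of f (s) g (r) over the square, cut along its diagonal. *)
Lemma Rintegral_by_parts (f g : R -> R) (x : R) :
  intble `]0, x[ f -> intble `]0, x[ g ->
  (\int[mu]_(s in `]0, x[) f s) * (\int[mu]_(r in `]0, x[) g r) =
  \int[mu]_(s in `]0, x[) (f s * \int[mu]_(r in `]0, s[) g r) +
  \int[mu]_(r in `]0, x[) (g r * \int[mu]_(s in `]0, r[) f s).
Proof.
move=> fi gi.
pose fz := f \_ `]0, x[; pose gz := g \_ `]0, x[.
have fzi : intble setT fz by exact: intble_restrict.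
have gzi : intble setT gz by exact: intble_restrict.
have mlt : measurable_fun setT (fun z : TR * TR => z.2 < z.1).
  by apply: measurable_fun_ltr; [exact: measurable_snd|exact: measurable_fst].
have mle : measurable_fun setT (fun z : TR * TR => z.1 <= z.2).
  by apply: measurable_fun_ler; [exact: measurable_fst|exact: measurable_snd].
have Pi := integrable_prodM fzi gzi.
have A1i := integrable_prod_mask Pi mlt.
have A2i := integrable_prod_mask Pi mle.
have [i1 _ _] := Rfubini A1i; have [i2 _ E2] := Rfubini A2i.
have ltm (s : R) : measurable_fun setT (fun r : TR => r < s).
  exact: (@measurable_fun_ltr _ TR R setT id (cst s)).
have lem (s : R) : measurable_fun setT (fun r : TR => s <= r).
  exact: (@measurable_fun_ler _ TR R setT (cst s) id).
have lem' (s : R) : measurable_fun setT (fun r : TR => r <= s).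
  exact: (@measurable_fun_ler _ TR R setT id (cst s)).
have gzm s (b : TR -> bool) : measurable_fun setT b ->
    intble setT (fun r => if b r then fz s * gz r else 0).
  by move=> mb; apply: intble_mask mb; exact: intbleZ gzi.
transitivity (\int[mu]_s \int[mu]_r (fz s * gz r)).
  under [RHS]eq_Rintegral do rewrite (RintegralZl _ measurableT gzi).
  by rewrite (RintegralZr _ measurableT fzi) /fz /gz -!Rintegral_mkcond.
transitivity (\int[mu]_s (\int[mu]_r (if r < s then fz s * gz r else 0)) +
              \int[mu]_s (\int[mu]_r (if s <= r then fz s * gz r else 0))).
  rewrite -(RintegralD measurableT i1 i2); apply: eq_Rintegral => s _.
  rewrite -(RintegralD measurableT (gzm s _ (ltm s)) (gzm s _ (lem s))).
  by apply: eq_Rintegral => r _; case: ltP => _; rewrite ?addr0 ?add0r.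
rewrite /= in E2; rewrite E2; congr (_ + _).
- rewrite [RHS]Rintegral_mkcond; apply: eq_Rintegral => s _.
  rewrite patch_itv_oo; case: ifPn => [/andP[s0 sx]|sN]; last first.
    rewrite (_ : (fun r => _) = cst 0) ?Rintegral_cst ?mul0r//.
    by apply/funext => r /=; rewrite /fz patch_itv_oo (negbTE sN) mul0r if_same.
  have gs : intble setT (g \_ `]0, s[).
    apply: intble_restrict => //; apply: intbleS gi => //.
    by apply: subset_itvl; rewrite bnd_simp ltW.
  rewrite [in RHS]Rintegral_mkcond -(RintegralZl _ measurableT gs).
  apply: eq_Rintegral => r _; rewrite /fz /gz !patch_itv_oo s0 sx/=.
  have [rs|rs] := ltP r s; last by rewrite andbF mulr0.
  by rewrite andbT (lt_trans rs sx) andbT.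
- rewrite [RHS]Rintegral_mkcond; apply: eq_Rintegral => s _.
  rewrite patch_itv_oo; case: ifPn => [/andP[s0 sx]|sN]; last first.
    rewrite (_ : (fun r => _) = cst 0) ?Rintegral_cst ?mul0r//.
    by apply/funext => r /=; rewrite /gz patch_itv_oo (negbTE sN) mulr0 if_same.
  have fs : intble `]0, s[ f.
    by apply: intbleS fi => //; apply: subset_itvl; rewrite bnd_simp ltW.
  have fs' : intble setT (f \_ `]0, s]).
    apply: intble_restrict => //; apply: intbleS fi => //.
    by apply: subset_itvl; rewrite bnd_simp.
  rewrite (Rintegral_itv_bndo_bndc fs) [in RHS]Rintegral_mkcond.
  rewrite -(RintegralZl _ measurableT fs').
  apply: eq_Rintegral => r _; rewrite /fz /gz !patch_itv_oo s0 sx/=.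
  rewrite patchE mem_itvE in_itv/=.
  have [rs|rs] := leP r s; last by rewrite andbF mulr0.
  rewrite (le_lt_trans rs sx) andbT; case: ifP => r0; first by rewrite mulrC.
  by rewrite mul0r mulr0.
Qed.

Lemma primitiveM (L : R) (F G f g : R -> R) :
  is_primitive L F f -> is_primitive L G g ->
  is_primitive L (fun x => F x * G x) (fun x => f x * G x + F x * g x).
Proof.
move=> pF pG; have cF := primitive_continuous pF; have cG := primitive_continuous pG.
have [fi HF] := pF; have [gi HG] := pG.
have fGi := intbleM_continuous fi cG.
have Fgi : intble `]0, L[ (fun x => F x * g x).
  by apply: eq_intble (intbleM_continuous gi cF) => // x _; rewrite mulrC.
split; first exact: intbleD.
move=> x xL; have /andP[x0 x1] : 0 <= x <= L by move: xL; rewrite in_itv.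
have sub (h : R -> R) : intble `]0, L[ h -> intble `]0, x[ h by exact: intble_sub.
have mx : measurable (`]0, x[ : set TR) by [].
rewrite (RintegralD mx (sub _ fGi) (sub _ Fgi)).
pose If s := \int[mu]_(r in `]0, s[) f r; pose Ig s := \int[mu]_(r in `]0, s[) g r.
have pIf : is_primitive L If f.
  by apply: eq_primitive (primitive_integral 0 fi) => y _; rewrite ?add0r.
have pIg : is_primitive L Ig g.
  by apply: eq_primitive (primitive_integral 0 gi) => y _; rewrite ?add0r.
have fIg := sub _ (intbleM_continuous fi (primitive_continuous pIg)).
have gIf := sub _ (intbleM_continuous gi (primitive_continuous pIf)).
have E1 : \int[mu]_(y in `]0, x[) (f y * G y) = G 0 * If x + \int[mu]_(y in `]0, x[) (f y * Ig y).
  rewrite -(RintegralZl _ mx (sub _ fi)) -(RintegralD mx (intbleZ _ mx (sub _ fi)) fIg).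
  apply: eq_Rintegral => y; rewrite inE/= in_itv/= => /andP[y0 yx].
  by rewrite (HG y) ?in_itv/= ?(ltW y0) ?(le_trans (ltW yx))// /Ig; ring.
have E2 : \int[mu]_(y in `]0, x[) (F y * g y) = F 0 * Ig x + \int[mu]_(y in `]0, x[) (g y * If y).
  rewrite -(RintegralZl _ mx (sub _ gi)) -(RintegralD mx (intbleZ _ mx (sub _ gi)) gIf).
  apply: eq_Rintegral => y; rewrite inE/= in_itv/= => /andP[y0 yx].
  by rewrite (HF y) ?in_itv/= ?(ltW y0) ?(le_trans (ltW yx))// /If; ring.
have := Rintegral_by_parts (sub _ fi) (sub _ gi); rewrite -/(If x) -/(Ig x) => E3.
rewrite E1 E2 (HF x)// (HG x)// -/(If x) -/(Ig x).
transitivity (F 0 * G 0 + (G 0 * If x + F 0 * Ig x + If x * Ig x)); first ring.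
rewrite E3 /Ig /If; ring.
Qed.

End product_rule.

Section derivatives_and_primitives.
Context {R : realType}.
Local Notation mu := (@lebesgue_measure R).
Local Notation TR := (measurableTypeR R).
Local Notation intble D f := (mu.-integrable D (EFin \o f)).
Implicit Types (f g F G : R -> R) (x y L : R).

Lemma deriv_on_is_derive L F x l : 0 < x < L -> is_deriv_on L F x l ->
  derivable F x 1 /\ derive1 F x = l.
Proof.
move=> /andP[x0 xL] /is_deriv_onP H.
have C : h^-1 *: (F (h + x) - F x) @[h --> 0^'] --> l.
  apply/cvgrPdist_le => e e0; have [d d0 dH] := H _ e0.
  rewrite near_withinE; apply/nbhs_ballP.
  exists (Num.min d (Num.min x (L - x))); first by rewrite /= !lt_min d0 x0 subr_gt0.
  move=> h /=; rewrite /ball/= sub0r normrN !lt_min => /and3P[hd hx hL] h0.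
  have := dH (h + x); rewrite addrK => /(_ _ hd) H'.
  have -> : l - h^-1 *: (F (h + x) - F x) = - ((F (h + x) - F x - l * h) / h).
    by rewrite -[_ *: _]/(_ * _); field.
  rewrite normrN normf_div ler_pdivrMr ?normr_gt0//; apply: H'.
  have : `|h| <= `|h| := lexx _; rewrite ler_norml => /andP[? ?].
  by rewrite in_itv/=; apply/andP; split; lra.
split.
  by apply/cvg_ex; exists l; rewrite /=; under eq_fun do rewrite scaler1; exact: C.
by rewrite derive1E /derive; apply/cvg_lim => //=; under eq_fun do rewrite scaler1; exact: C.
Qed.

Lemma deriv_on_continuous L F f : (forall x, x \in `[0, L] -> is_deriv_on L F x (f x)) ->
  {within `[0, L], continuous F}.
Proof.
move=> dF; apply/within_continuousP => x xL e e0.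
have /is_deriv_onP/(_ 1 ltr01)[d d0 dH] := dF _ xL.
have k0 : 0 < 1 + `|f x| by rewrite ltr_pwDl.
exists (Num.min d (e / (1 + `|f x|))); first by rewrite lt_min d0 divr_gt0.
move=> y yL; rewrite lt_min ltr_pdivlMr// => /andP[yd ye].
have := dH y yL yd; rewrite mul1r => H.
apply: le_trans (ltW ye); rewrite mulrDr mulr1 [`|y - x| * `|f x|]mulrC -normrM.
by rewrite -[F y - F x](subrK (f x * (y - x))) (le_trans (ler_normD _ _))// lerD2r.
Qed.

Lemma deriv_on_primitive L F f : 0 < L ->
  (forall x, x \in `[0, L] -> is_deriv_on L F x (f x)) ->
  {within `[0, L], continuous f} -> is_primitive L F f.
Proof.
move=> L0 dF cf; have cF := deriv_on_continuous dF.
have fi := continuous_intble cf; split => // x.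
rewrite in_itv/= le_eqVlt => /andP[/predU1P[<- _|x0 xL]].
  by rewrite set_itvoo0 Rintegral_set0 addr0.
have sub : `[0, x] `<=` `[0, L] by apply: subset_itvl; rewrite bnd_simp.
have cfx := continuous_subspaceW sub cf; have cFx := continuous_subspaceW sub cF.
have := continuous_FTC2 x0 cfx.
have [cF1 cF2 cF3] := (continuous_within_itvP F x0).1 cFx.
have dFx : {in `]0, x[, forall y, derivable F y 1 /\ derive1 F y = f y}.
  move=> y; rewrite in_itv/= => /andP[y0 yx]; apply: (@deriv_on_is_derive L).
    by rewrite y0 (lt_le_trans yx).
  by apply: dF; rewrite in_itv/= (ltW y0) (le_trans (ltW yx)).
move=> /(_ F) FTC.
have : derivable_oo_LRcontinuous F 0 x by split => // y /dFx[].
move=> /FTC /(_ (fun y yx => (dFx y yx).2)) E.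
have ix : intble `]0, x[ f by exact: intble_sub fi.
have ic : intble `[0, x] f.
  by apply: continuous_compact_integrable => //; exact: segment_compact.
have io : intble `]0, x] f.
  by apply: intbleS ic => //; apply: subset_itvr; rewrite bnd_simp.
rewrite (Rintegral_itv_bndo_bndc ix) (Rintegral_itv_obnd_cbnd io).
by rewrite /Rintegral E -EFinB/=; ring.
Qed.

Lemma near_shift_derivable F G c x : derivable G x 1 ->
  (\forall y \near x, G y + c = F y) -> derivable F x 1 /\ derive1 F x = derive1 G x.
Proof.
move=> dG GF; have dc : derivable (fun _ : R => c) x 1 by exact: derivable_cst.
split; first by apply: near_eq_derivable GF (derivableD dG dc).
by rewrite !derive1E -(near_eq_derive _ GF) (deriveD dG dc) derive_cst addr0.
Qed.

(** Lebesgue's differentiation theorem, transported from the half-line integrals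
    of the zero extension of f. *)
Lemma primitive_ae_derivable L F f : is_primitive L F f ->
  {ae mu, forall x, x \in `]0, L[ -> derivable F x 1 /\ derive1 F x = f x}.
Proof.
move=> [fi HF]; pose fz := f \_ `]0, L[.
have fzi : intble setT fz by exact: intble_restrict.
have loc : locally_integrable setT fz by apply: integrable_locally.
have := @FTC1 R fz (BRight 0) (fun y => intbleS measurableT (measurable_itv _) (@subsetT _ _) fzi) loc.
apply: aeS => x H; rewrite in_itv/= => /andP[x0 xL].
have [dG G'] := H x0.
have FG : \forall y \near x, \int[mu]_(t in `]0, y]) fz t + F 0 = F y.
  have : x \in `]0, L[ by rewrite in_itv/= x0.
  move=> /near_in_itvoo; apply: filterS => y; rewrite in_itv/= => /andP[y0 yL].
  rewrite (HF y) ?in_itv/= ?(ltW y0) ?(ltW yL)// addrC; congr (_ + _).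
  rewrite -Rintegral_itv_bndo_bndc; last exact: intbleS fzi.
  apply: eq_Rintegral => t; rewrite inE/= in_itv/= => /andP[t0 ty].
  by rewrite /fz patch_itv_oo t0 (lt_trans ty).
have [? E] := near_shift_derivable dG FG; split => //.
by rewrite E G' /fz patch_itv_oo x0 xL.
Qed.

End derivatives_and_primitives.

(** * Lipschitz functions are primitives *)

Section lipschitz_primitives.
Context {R : realType}.
Local Notation mu := (@lebesgue_measure R).
Local Notation TR := (measurableTypeR R).
Local Notation intble D f := (mu.-integrable D (EFin \o f)).
Implicit Types (f g F G : R -> R) (x y L : R).

Lemma Rdominated_convergence (D : set TR) (f_ : nat -> TR -> R) (f g : TR -> R) :
  measurable D -> (forall n, measurable_fun D (f_ n)) -> measurable_fun D f ->
  {ae mu, forall x, D x -> f_ n x @[n --> \oo] --> f x} ->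
  intble D g -> (forall n x, D x -> `|f_ n x| <= g x) ->
  intble D f /\ \int[mu]_(x in D) f_ n x @[n --> \oo] --> \int[mu]_(x in D) f x.
Proof.
move=> mD mf_ mf cf ig fg.
have [] := @dominated_convergence _ _ R mu D mD (fun n => EFin \o f_ n) (EFin \o f) (EFin \o g).
- by move=> n; exact/measurable_EFinP.
- exact/measurable_EFinP.
- by apply: aeS cf => x H Dx; apply/fine_cvgP; split; [exact: nearW|exact: H].
- exact: ig.
- by apply: aeW => x Dx n; rewrite /= lee_fin; exact: fg.
move=> fi _ C; split=> //; move: C.
rewrite -(fineK (integrable_fin_num mD fi)).
by move/fine_cvgP => [_].
Qed.

(** A Lipschitz function is recovered from its almost everywhere derivative:
    the difference quotients with step h are dominated, and the integral of such a
    quotient telescopes to the difference of two averages of the function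
    over intervals of length h. *)
Lemma lipschitz_primitive L (K : R) F f : 0 < L -> 0 <= K ->
  (forall x y, x \in `[0, L] -> y \in `[0, L] -> `|F x - F y| <= K * `|x - y|) ->
  measurable_fun (`]0, L[ : set TR) f ->
  {ae mu, forall x, x \in `]0, L[ -> derivable F x 1 /\ derive1 F x = f x} ->
  is_primitive L F f.
Proof.
move=> L0 K0 lipF mf dF.
pose cl (x : R) := Num.max 0 (Num.min x L).
have cl_in x : cl x \in `[0, L].
  by rewrite in_itv/= /cl le_max lexx/= ge_max (ltW L0) ge_min lexx orbT.
have cl_lip x y : `|cl x - cl y| <= `|x - y|.
  have n0 := normr_ge0 (x - y).
  have : `|x - y| <= `|x - y| := lexx _; rewrite ler_norml => /andP[na nb].
  rewrite ler_norml /cl /Num.max /Num.min.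
  case: (ltP x L) => ?; case: (ltP y L) => ?;
  case: (ltP 0 x) => ?; case: (ltP 0 y) => ?; rewrite ?L0;
  by apply/andP; split; lra.
have cl_id x : x \in `[0, L] -> cl x = x.
  rewrite in_itv/= => /andP[x0 xL]; rewrite /cl.
  by rewrite (min_idPl xL) (max_idPr x0).
pose G x := F (cl x).
have lipG x y : `|G x - G y| <= K * `|x - y|.
  by apply: (le_trans (lipF _ _ (cl_in x) (cl_in y))); rewrite ler_wpM2l.
have GF x : x \in `[0, L] -> G x = F x by move=> xL; rewrite /G cl_id.
have cG : continuous G.
  move=> x; apply/cvgrPdist_le => e e0; apply/nbhs_ballP.
  have K1 : 0 < K + 1 by rewrite ltr_wpDl.
  exists (e / (K + 1)); first by rewrite /= divr_gt0.
  move=> y; rewrite /ball/= ltr_pdivlMr// => xy.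
  apply: (le_trans (lipG _ _)); apply: le_trans (ltW xy); rewrite mulrC.
  by rewrite ler_wpM2l// lerDl.
have mG : measurable_fun setT (G : TR -> R) by exact: continuous_measurable_fun.
pose h (n : nat) : R := n.+1%:R^-1.
have h0 n : 0 < h n by rewrite invr_gt0.
have h1 n : h n <= 1 by rewrite invf_le1// ler1n.
pose D n x := (G (x + h n) - G x) / h n.
have mshift n : measurable_fun setT (fun x : TR => G (x + h n)).
  apply: continuous_measurable_fun => x; apply: continuous_comp; last exact: cG.
  by apply: continuousD => //; exact: cst_continuous.
have mD n : measurable_fun setT (D n : TR -> R).
  by apply: measurable_funM => //; exact: measurable_funB.
have bD n x : `|D n x| <= K.
  rewrite normf_div ler_pdivrMr ?normr_gt0 ?gt_eqF//.
  by apply: (le_trans (lipG _ _)); rewrite addrAC subrr add0r.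
have hcvg : h n @[n --> \oo] --> 0 by exact: cvg_harmonic.
have cvD : {ae mu, forall x, x \in `]0, L[ -> D n x @[n --> \oo] --> f x}.
  apply: aeS dF => x /[swap] xL /(_ xL)[dFx <-].
  have C : (F (e + x) - F x) / e @[e --> 0^'] --> derive1 F x.
    rewrite derive1E; move: dFx => /cvg_ex[l Hl]; have Hl' := Hl.
    rewrite /derive (cvg_lim _ Hl)//; move: Hl'.
    by under eq_fun do rewrite scaler1 -[_ *: _]/(_ * _) mulrC.
  apply/cvgrPdist_le => e e0; move/cvgrPdist_le : C => /(_ e e0).
  rewrite near_withinE => /nbhs_ballP[d/= d0 dH].
  move: xL; rewrite in_itv/= => /andP[x0 xL].
  have LX : 0 < L - x by rewrite subr_gt0.
  move/cvgrPdist_lt : (hcvg) => /(_ _ d0); move/cvgrPdist_lt : (hcvg) => /(_ _ LX).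
  apply: filterS2 => n; rewrite sub0r normrN gtr0_norm// => hL hd.
  rewrite /D !GF ?in_itv/= ?(ltW x0) ?(ltW xL) ?addr_ge0 ?(ltW x0) ?(ltW (h0 n))//=; last by lra.
  rewrite [x + _]addrC; apply: dH; last by rewrite gt_eqF.
  by rewrite /ball/= sub0r normrN gtr0_norm.
have fin x : 0 <= x <= L -> intble `]0, x[ f /\
    \int[mu]_(y in `]0, x[) D n y @[n --> \oo] --> \int[mu]_(y in `]0, x[) f y.
  move=> /andP[x0 xL].
  have sub : `]0, x[ `<=` (`]0, L[ : set R) by apply: subset_itvl; rewrite bnd_simp.
  apply: (@Rdominated_convergence _ D f (cst K)) => //.
  - by move=> n; exact: measurable_funTS.
  - exact: measurable_funS mf.
  - by apply: aeS cvD => y H /sub; exact: H.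
  - by apply: intble_cst => //; exact: itv_oo_fin.
split; first by have [] := fin L; rewrite ?lexx ?ltW.
move=> x xL; have /fin[fi C] : 0 <= x <= L by move: xL; rewrite in_itv.
apply/eqP; rewrite addrC -subr_eq; apply/eqP.
suff : \int[mu]_(y in `]0, x[) D n y @[n --> \oo] --> F x - F 0.
  by move=> C'; exact: (cvg_unique _ C' C).
have /andP[x0 x1] : 0 <= x <= L by move: xL; rewrite in_itv.
pose P y := \int[mu]_(t in `]0, y[) G t.
have cG' A : {within A, continuous G} by exact: continuous_subspaceT.
have pP : is_primitive (L + 1) P G.
  apply: eq_primitive (primitive_integral 0 (continuous_intble (cG' _))) => y _ //.
  by rewrite add0r.
have P0 : P 0 = 0 by rewrite /P set_itvoo0 Rintegral_set0.
have iG a b : intble `]a, b[ G by exact: continuous_intble (cG' _).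
have iGs n a b : intble `]a, b[ (fun x => G (x + h n)).
  apply: continuous_intble; apply: continuous_subspaceT => z; apply: continuous_comp; last exact: cG.
  by apply: continuousD => //; exact: cst_continuous.
have ID n : \int[mu]_(y in `]0, x[) D n y = (P (x + h n) - P x - P (h n)) / h n.
  have mx : measurable (`]0, x[ : set TR) by [].
  rewrite /D (RintegralZr _ mx); last exact: (intbleB mx (iGs n 0 x) (iG 0 x)).
  rewrite (RintegralB mx (iGs n 0 x) (iG 0 x)) -/(P x); congr (_ / _).
  rewrite addrAC; congr (_ - _); apply/eqP; rewrite eq_sym subr_eq; apply/eqP.
  rewrite /P (@Rintegral_itv_split _ (L + 1) _ (h n) (x + h n)) ?(ltW (h0 n))//; last 2 first.
  - by rewrite lerDr.
  - by rewrite lerD.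
  rewrite addrC; congr (_ + _).
  rewrite Rintegral_mkcond (@Rintegral_affine _ 1 (h n)) ?oner_eq0//; last first.
    exact: (intble_restrict (measurable_itv _) (iG _ _)).
  rewrite normr1 mul1r [RHS]Rintegral_mkcond; apply: eq_Rintegral => y _.
  by rewrite !patch_itv_oo mul1r ltrDr ltrD2r.
have est y n : 0 <= y <= L -> `|(P (y + h n) - P y) / h n - G y| <= K * h n.
  move=> /andP[y0 yL].
  have hn := h0 n; have hn1 := h1 n.
  have H : `|P (y + h n) - P y - G y * (y + h n - y)| <= K * h n * (y + h n - y).
    apply: (primitive_incr_bound pP) => //; [by lra|by lra|].
    move=> z /andP[yz zy]; apply: (le_trans (lipG _ _)); rewrite ler_wpM2l//.
    by rewrite gtr0_norm ?subr_gt0//; lra.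
  have -> : (P (y + h n) - P y) / h n - G y = (P (y + h n) - P y - G y * (y + h n - y)) / h n.
    by field; rewrite gt_eqF.
  rewrite normf_div [X in _ / X]gtr0_norm// ler_pdivrMr//; apply: le_trans H _.
  by rewrite addrAC subrr add0r.
have E0 : F x - F 0 = G x - G 0 by rewrite !GF// in_itv/= lexx ltW.
have c2 : 2 * K * h n @[n --> \oo] --> 0.
  by rewrite -[X in _ --> X](mulr0 (2 * K)); apply: cvgM => //; exact: cvg_cst.
have : \int[mu]_(y in `]0, x[) D n y - (F x - F 0) @[n --> \oo] --> 0.
  apply: (@squeeze_cvgr _ _ _ _ (fun n => - (2 * K * h n)) (fun n => 2 * K * h n)).
  - apply: nearW => n; rewrite -ler_norml ID E0.
    have := est x n; rewrite x0 x1 => /(_ isT) H1.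
    have := est 0 n; rewrite lexx (ltW L0) add0r P0 subr0 => /(_ isT) H2.
    rewrite (_ : _ - _ = ((P (x + h n) - P x) / h n - G x) - (P (h n) / h n - G 0)).
      by apply: (le_trans (ler_normB _ _)); rewrite -mulrA mulr_natl mulr2n lerD.
    by field; rewrite gt_eqF.
  - by rewrite -oppr0; exact: cvgN.
  - exact: c2.
by move=> /subr_cvg0.
Qed.

End lipschitz_primitives.

(** * The Sturm-Liouville problem *)

Section sturm_liouville.
Context {R : realType}.
Local Notation mu := (@lebesgue_measure R).
Local Notation TR := (measurableTypeR R).
Local Notation intble D f := (mu.-integrable D (EFin \o f)).

(** The first-order form of (sigma v')' = q v + F, with flux S = sigma v'.
    With the flux as a second unknown, the product sigma v' is never differentiated. *)
Definition sl_solution (L : R) (sigma q F v S : R -> R) : Prop :=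
  is_primitive L v (fun x => S x / sigma x) /\
  is_primitive L S (fun x => q x * v x + F x).

Lemma derivable_deriv_on L (F : R -> R) x l : is_derive x (1 : R) F l -> is_deriv_on L F x l.
Proof.
move=> dF; apply/is_deriv_onP => e e0.
have C : h^-1 *: (F (h + x) - F x) @[h --> 0^'] --> l.
  have := @ex_derive _ _ _ _ _ _ _ dF; rewrite /derivable => /cvg_ex[l' Hl].
  have := @derive_val _ _ _ _ _ _ _ dF; rewrite /derive (cvg_lim _ Hl)// => <-.
  by move: Hl; under eq_fun do rewrite scaler1.
move/cvgrPdist_le : C => /(_ e e0); rewrite near_withinE => /nbhs_ballP[d/= d0 dH].
exists d => // y _ yx; have [->|xy] := eqVneq y x.
  by rewrite !subrr mulr0 subr0 normr0 mulr0.
have xy0 : y - x != 0 by rewrite subr_eq0.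
have := dH (y - x); rewrite /ball/= sub0r normrN => /(_ yx xy0).
rewrite subrK => H; rewrite -ler_pdivrMr ?normr_gt0// -normf_div.
apply: le_trans H; rewrite -[_ *: _]/(_ * _) distrC.
by rewrite le_eqVlt; apply/orP; left; apply/eqP; congr `|_|; field.
Qed.

Section fixed_coefficients.
Variables (L : R) (sigma q : R -> R) (s0 Q : R).
Hypotheses (L0 : 0 < L) (csigma : {within `[0, L], continuous sigma}) (s0_gt0 : 0 < s0)
  (sigma_ge : forall x, x \in `[0, L] -> s0 <= sigma x)
  (mq : measurable_fun (`]0, L[ : set TR) q)
  (q_bounds : forall x, x \in `]0, L[ -> 0 <= q x <= Q).

Let sigma_gt0 x : x \in `[0, L] -> 0 < sigma x.
Proof. by move=> /sigma_ge; exact: lt_le_trans. Qed.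

Lemma continuous_within_div_sigma (S : R -> R) : {within `[0, L], continuous S} ->
  {within `[0, L], continuous (fun x => S x / sigma x)}.
Proof.
move=> cS; rewrite continuous_subspace_in => x /set_mem xL.
apply: cvgM; first exact: cS.
by apply: cvgV; [rewrite gt_eqF// sigma_gt0|exact: csigma].
Qed.

Let Q_ge0 : 0 <= Q.
Proof.
have h : L / 2 \in `]0, L[ by rewrite in_itv/= divr_gt0//= ltr_pdivrMr// ltr_pMr// ltr1n.
by have /andP[q0 qQ] := q_bounds h; exact: le_trans qQ.
Qed.

Section initial_value_problem.
Variables (c0 c1 : R).
Hypotheses (c0_ge0 : 0 <= c0) (c1_ge0 : 0 <= c1).

(* Y is a supersolution: its rate k exceeds the bound Q L / s0 for the integral
   operator, so that T maps functions below Y to functions below Y. *)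
Let k : R := Q * L / s0 + 1.
Let C : R := c0 + c1 * L / s0.
Let Y (x : R) : R := C * expR (k * x).
Let flux (y : R -> R) (s : R) : R := c1 + \int[mu]_(r in `]0, s[) (q r * y r).
Let T (y : R -> R) (x : R) : R := c0 + \int[mu]_(s in `]0, x[) (flux y s / sigma s).
Let admissible (y : R -> R) : Prop :=
  measurable_fun (`]0, L[ : set TR) y /\ forall x, x \in `[0, L] -> 0 <= y x <= Y x.

Let C_ge0 : 0 <= C.
Proof. by rewrite addr_ge0// divr_ge0 ?mulr_ge0 ?(ltW L0) ?(ltW s0_gt0). Qed.

Let k_gt0 : 0 < k.
Proof. by rewrite ltr_wpDl// divr_ge0 ?mulr_ge0 ?(ltW L0) ?(ltW s0_gt0). Qed.

Let Y_mono x y : x <= y -> Y x <= Y y.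
Proof. by move=> xy; rewrite ler_wpM2l// ler_expR ler_wpM2l// ltW. Qed.

Let sub_oo (x : R) : x \in `]0, L[ -> x \in `[0, L].
Proof. exact: subset_itv_oo_cc. Qed.

Let qy_intble y : admissible y -> intble `]0, L[ (fun r => q r * y r).
Proof.
move=> [my by_]; apply: (@intble_bounded _ _ _ (Q * Y L)) => //; first exact: itv_oo_fin.
  exact: measurable_funM.
move=> x /= xL; have /andP[q0 qQ] := q_bounds xL; have /andP[y0 yY] := by_ _ (sub_oo xL).
rewrite ger0_norm ?mulr_ge0// ler_pM//; apply: le_trans yY _; apply: Y_mono.
by move: xL; rewrite in_itv/= => /andP[_ /ltW].
Qed.

Let flux_primitive y : admissible y -> is_primitive L (flux y) (fun r => q r * y r).
Proof. by move=> /qy_intble iy; exact: primitive_integral. Qed.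

Let T_primitive y : admissible y -> is_primitive L (T y) (fun s => flux y s / sigma s).
Proof.
move=> /flux_primitive pf; apply: primitive_integral; apply: continuous_intble.
by apply: continuous_within_div_sigma; exact: primitive_continuous pf.
Qed.

Let flux_ge y s : admissible y -> s \in `[0, L] -> c1 <= flux y s.
Proof.
move=> [_ y0]; rewrite in_itv/= => /andP[_ sL]; rewrite lerDl; apply: Rintegral_ge0 => r /=.
rewrite in_itv/= => /andP[r0 rs]; have rL : r \in `]0, L[ by rewrite in_itv/= r0 (lt_le_trans rs).
by have /andP[q0 _] := q_bounds rL; have /andP[? _] := y0 _ (sub_oo rL); rewrite mulr_ge0.
Qed.

Let flux_le y s : admissible y -> s \in `[0, L] -> flux y s <= c1 + Q * L * Y s.
Proof.
move=> ay; rewrite in_itv/= => /andP[ss sL]; rewrite lerD2l.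
have [my y0] := ay.
have iy := intble_sub (lexx 0) sL (qy_intble ay).
apply: (le_trans (ler_norm _)).
apply: (@le_trans _ _ (Q * Y s * (s - 0))).
  apply: Rintegral_norm_bound => //; first exact: intble_measurable iy.
  move=> r; rewrite in_itv/= => /andP[r0 rs].
  have rL : r \in `]0, L[ by rewrite in_itv/= r0 (lt_le_trans rs).
  have /andP[q0 qQ] := q_bounds rL; have /andP[yr0 yY] := y0 _ (sub_oo rL).
  rewrite ger0_norm ?mulr_ge0// ler_pM//; apply: le_trans yY _.
  by apply: Y_mono; exact: ltW.
rewrite subr0 mulrAC ler_wpM2r//; last by rewrite ler_wpM2l.
by rewrite mulr_ge0// expR_ge0.
Qed.

Let Y_primitive : is_primitive L (fun x => c1 / s0 * x + Y x) (fun x => c1 / s0 + k * Y x).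
Proof.
apply: deriv_on_primitive => //.
  move=> x xL; apply: derivable_deriv_on; rewrite /Y.
  by apply: is_derive_eq; rewrite -![_ *: _]/(_ * _); ring.
apply: continuous_subspaceT => x; apply: cvgD; first exact: cvg_cst.
apply: cvgM; first exact: cvg_cst.
apply: cvgM; first exact: cvg_cst.
apply: continuous_comp; last exact: continuous_expR.
by apply: cvgM; [exact: cvg_cst|exact: cvg_id].
Qed.

Let T_admissible y : admissible y -> admissible (T y).
Proof.
move=> ay; have pT := T_primitive ay.
split; first exact: continuous_itv_oo_measurable (primitive_continuous pT).
move=> x xL; have /andP[x0 x1] : 0 <= x <= L by move: xL; rewrite in_itv.
have xin s : `]0, x[%classic s -> s \in `[0, L].
  by rewrite /= !in_itv/= => /andP[/ltW -> /ltW sx]; rewrite (le_trans sx).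
apply/andP; split.
  rewrite addr_ge0//; apply: Rintegral_ge0 => s /xin sL.
  by rewrite divr_ge0 ?(ltW (sigma_gt0 sL))// (le_trans c1_ge0)// flux_ge.
have [iT _] := pT; have [iY HY] := Y_primitive.
have : \int[mu]_(s in `]0, x[) (flux y s / sigma s) <=
       \int[mu]_(s in `]0, x[) (c1 / s0 + k * Y s).
  apply: le_Rintegral => //; [exact: intble_sub iT|exact: intble_sub iY|].
  move=> s /xin sL.
  apply: (@le_trans _ _ ((c1 + Q * L * Y s) / s0)).
    rewrite ler_pM ?flux_le// ?invr_ge0 ?(ltW (sigma_gt0 sL))//.
      by rewrite (le_trans c1_ge0)// flux_ge.
    by rewrite lef_pV2 ?sigma_ge// posrE sigma_gt0.
  rewrite mulrDl lerD2l mulrAC ler_wpM2r//; first by rewrite mulr_ge0// expR_ge0.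
  by rewrite lerDl.
have := HY x xL; rewrite mulr0 add0r.
have -> : Y 0 = C by rewrite /Y mulr0 expR0 mulr1.
rewrite /T; set I := \int[mu]_(s in _) _; set J := \int[mu]_(s in _) _ => HJ HI.
have : c1 / s0 * x <= c1 * L / s0.
  by rewrite mulrAC ler_wpM2r ?invr_ge0 ?(ltW s0_gt0)// ler_wpM2l.
by move: HJ HI; rewrite /C; lra.
Qed.

Let T_mono y z : admissible y -> admissible z -> (forall x, x \in `[0, L] -> y x <= z x) ->
  forall x, x \in `[0, L] -> T y x <= T z x.
Proof.
move=> ay az yz x xL; have /andP[x0 x1] : 0 <= x <= L by move: xL; rewrite in_itv.
have [iy _] := T_primitive ay; have [iz _] := T_primitive az.
rewrite lerD2l; apply: le_Rintegral => //; [exact: intble_sub iy|exact: intble_sub iz|].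
move=> s /=; rewrite in_itv/= => /andP[s0' sx].
have sL : s \in `[0, L] by rewrite in_itv/= (ltW s0') (le_trans (ltW sx)).
rewrite ler_wpM2r ?invr_ge0 ?(ltW (sigma_gt0 sL))// lerD2l.
have s1 : s <= L by exact: (le_trans (ltW sx)).
apply: le_Rintegral => //.
- exact: (intble_sub (lexx 0) s1 (qy_intble ay)).
- exact: (intble_sub (lexx 0) s1 (qy_intble az)).
move=> r /=; rewrite in_itv/= => /andP[r0 rs].
have rL : r \in `]0, L[ by rewrite in_itv/= r0 (lt_le_trans rs).
by have /andP[q0 _] := q_bounds rL; rewrite ler_wpM2l// yz// sub_oo.
Qed.

Let y_ (n : nat) : R -> R := iter n T (fun=> 0).

Let y_adm n : admissible (y_ n).
Proof.
elim: n => [|n IH]; last exact: T_admissible.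
split=> [|x xL]; first exact: measurable_cst.
by apply/andP; split; [exact: lexx|rewrite mulr_ge0// expR_ge0].
Qed.

Let y_mono n x : x \in `[0, L] -> y_ n x <= y_ n.+1 x.
Proof.
elim: n x => [|n IH] x xL; last exact: (T_mono (y_adm n) (y_adm n.+1) IH xL).
by have [_ /(_ x xL)/andP[]] := y_adm 1.
Qed.

Let ylim (x : R) : R := limn (y_ ^~ x).

Let y_cvg x : x \in `[0, L] -> y_ n x @[n --> \oo] --> ylim x.
Proof.
move=> xL; apply: nondecreasing_is_cvgn.
  by apply/nondecreasing_seqP => n; exact: y_mono.
exists (Y x) => _ [n _ <-].
by have [_ /(_ x xL)/andP[]] := y_adm n.
Qed.

Let ylim_adm : admissible ylim.
Proof.
split.
  apply: (@measurable_fun_cvg _ _ _ _ y_).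
  - by move=> n; have [] := y_adm n.
  - by move=> x xL; apply: y_cvg; exact: sub_oo.
move=> x xL; apply/andP; split.
  apply: limr_ge; first by apply/cvg_ex; exists (ylim x); exact: y_cvg.
  by apply: nearW => n; have [_ /(_ x xL)/andP[]] := y_adm n.
apply: limr_le; first by apply/cvg_ex; exists (ylim x); exact: y_cvg.
by apply: nearW => n; have [_ /(_ x xL)/andP[]] := y_adm n.
Qed.

Let flux_cvg s : s \in `[0, L] -> flux (y_ n) s @[n --> \oo] --> flux ylim s.
Proof.
rewrite in_itv/= => /andP[s_ge0 sL]; apply: cvgD; first exact: cvg_cst.
have sin r : `]0, s[%classic r -> r \in `]0, L[.
  by rewrite /= !in_itv/= => /andP[-> rs]; rewrite (lt_le_trans rs).
apply: (@Rdominated_convergence _ _ _ _ (cst (Q * Y L)) _ _ _ _ _ _).2 => //.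
- move=> n; apply: intble_measurable.
  exact: (intble_sub (lexx 0) sL (qy_intble (y_adm n))).
- apply: intble_measurable.
  exact: (intble_sub (lexx 0) sL (qy_intble ylim_adm)).
- apply: aeW => r /sin rL; apply: cvgM; first exact: cvg_cst.
  by apply: y_cvg; exact: sub_oo.
- by apply: intble_cst => //; exact: itv_oo_fin.
- move=> n x /sin xL; have /andP[q0 qQ] := q_bounds xL.
  have [_ /(_ x (sub_oo xL))/andP[y0 yY]] := y_adm n.
  rewrite ger0_norm ?mulr_ge0// ler_pM//; apply: le_trans yY _; apply: Y_mono.
  by move: xL; rewrite in_itv/= => /andP[_ /ltW].
Qed.

Let ylim_fixed x : x \in `[0, L] -> ylim x = T ylim x.
Proof.
move=> xL; have /andP[x0 x1] : 0 <= x <= L by move: xL; rewrite in_itv.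
have C1 : y_ n.+1 x @[n --> \oo] --> ylim x.
  by have := y_cvg xL; rewrite -(@cvg_shiftS _ (y_ ^~ x)).
suff C2 : y_ n.+1 x @[n --> \oo] --> T ylim x by exact: (cvg_unique _ C1 C2).
apply: cvgD; first exact: cvg_cst.
have xin s : `]0, x[%classic s -> s \in `[0, L].
  by rewrite /= !in_itv/= => /andP[/ltW -> /ltW sx]; rewrite (le_trans sx).
apply: (@Rdominated_convergence _ _ _ _ (cst ((c1 + Q * L * Y L) / s0)) _ _ _ _ _ _).2 => //.
- move=> n; apply: intble_measurable.
  exact: (intble_sub (lexx 0) x1 (T_primitive (y_adm n)).1).
- apply: intble_measurable.
  exact: (intble_sub (lexx 0) x1 (T_primitive ylim_adm).1).
- apply: aeW => r /xin rL; apply: cvgM; last exact: cvg_cst.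
  exact: flux_cvg.
- by apply: intble_cst => //; exact: itv_oo_fin.
- move=> n s /xin sL; have fl := flux_le (y_adm n) sL; have fg := flux_ge (y_adm n) sL.
  have f0 : 0 <= flux (y_ n) s by exact: le_trans fg.
  rewrite ger0_norm ?divr_ge0 ?(ltW (sigma_gt0 sL))//.
  rewrite ler_pM// ?invr_ge0 ?(ltW (sigma_gt0 sL))//.
    apply: (le_trans fl); rewrite lerD2l ler_wpM2l ?mulr_ge0// ?(ltW L0)//.
    by apply: Y_mono; move: sL; rewrite in_itv/= => /andP[].
  by rewrite lef_pV2 ?sigma_ge// posrE sigma_gt0.
Qed.

(** Monotone iteration of the integral equation from 0, kept below the exponential
    supersolution Y, solves the initial value problem; it yields at once that the
    solution and its flux do not fall below their initial values. *)
Lemma sl_initial_value : exists y S : R -> R,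
  [/\ sl_solution L sigma q (fun=> 0) y S, y 0 = c0, S 0 = c1,
      (forall x, x \in `[0, L] -> c0 <= y x) & (forall x, x \in `[0, L] -> c1 <= S x)].
Proof.
have z_in : 0 \in `[0, L] by rewrite in_itv/= lexx ltW.
exists ylim, (flux ylim); split.
- split.
    apply: eq_primitive (T_primitive ylim_adm) => // x xL.
    by rewrite ylim_fixed.
  by apply: eq_primitive (flux_primitive ylim_adm) => // x xL; rewrite addr0.
- by rewrite ylim_fixed// /T set_itvoo0 Rintegral_set0 addr0.
- by rewrite /flux set_itvoo0 Rintegral_set0 addr0.
- move=> x xL; rewrite ylim_fixed// lerDl; apply: Rintegral_ge0 => s /=.
  rewrite in_itv/= => /andP[sp sx].
  have sL : s \in `[0, L].
    by move: xL; rewrite !in_itv/= (ltW sp) => /andP[_]; exact: le_trans (ltW sx).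
  by rewrite divr_ge0 ?(ltW (sigma_gt0 sL))// (le_trans c1_ge0)// flux_ge.
- by move=> x xL; exact: flux_ge ylim_adm xL.
Qed.

End initial_value_problem.

Lemma sl_solution_lincomb (a b : R) (v1 S1 v2 S2 : R -> R) :
  sl_solution L sigma q (fun=> 0) v1 S1 -> sl_solution L sigma q (fun=> 0) v2 S2 ->
  sl_solution L sigma q (fun=> 0) (fun x => a * v1 x + b * v2 x) (fun x => a * S1 x + b * S2 x).
Proof.
move=> [p1 p2] [p3 p4]; split.
  by apply: eq_primitive (primitiveD (primitiveZ a p1) (primitiveZ b p3)) => x _ //; ring.
by apply: eq_primitive (primitiveD (primitiveZ a p2) (primitiveZ b p4)) => x _ //; ring.
Qed.

(** Lagrange's identity: both solutions share the potential q, which cancels. *)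
Lemma sl_wronskian (v S w Sw F : R -> R) :
  sl_solution L sigma q F v S -> sl_solution L sigma q (fun=> 0) w Sw ->
  is_primitive L (fun x => S x * w x - v x * Sw x) (fun x => F x * w x).
Proof.
move=> [pv pS] [pw pSw].
apply: eq_primitive (primitiveB (primitiveM pS pw) (primitiveM pv pSw)) => x _ //; ring.
Qed.

Lemma sl_wronskian_const (v S w Sw : R -> R) :
  sl_solution L sigma q (fun=> 0) v S -> sl_solution L sigma q (fun=> 0) w Sw ->
  forall x, x \in `[0, L] -> S x * w x - v x * Sw x = S 0 * w 0 - v 0 * Sw 0.
Proof.
move=> sv sw x xL; have [_ ->//] := sl_wronskian sv sw.
rewrite (_ : Rintegral _ _ _ = \int[mu]_(y in `]0, x[) (0 : R)).
  by rewrite Rintegral_cst// mul0r addr0.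
by apply: eq_Rintegral => y _; rewrite mul0r.
Qed.

(** The two homogeneous solutions with boundary values (1, 0) and (0, 1): ub
    is obtained by shooting from 0, and u by subtracting a multiple of ub from
    another solution.  The quotient u / ub has derivative
    - omega / (sigma ub^2) < 0, so that u is positive before its zero L. *)
Lemma sl_dirichlet_pair : exists u Su ub Sb : R -> R,
  [/\ sl_solution L sigma q (fun=> 0) u Su, sl_solution L sigma q (fun=> 0) ub Sb,
      [/\ u 0 = 1, u L = 0, ub 0 = 0 & ub L = 1], 0 < Sb 0 &
      forall x, x \in `]0, L[ -> 0 < u x /\ 0 < ub x].
Proof.
have z_in : 0 \in `[0, L] by rewrite in_itv/= lexx ltW.
have L_in : L \in `[0, L] by rewrite in_itv/= lexx ltW.
have [y [S [sy y0 S0 _ S_ge]]] := sl_initial_value (lexx 0) (@ler01 R).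
have [z [T [sz z0 T0 _ _]]] := sl_initial_value (@ler01 R) (lexx 0).
have [M M0 sM] := continuous_itv_bounded csigma.
have M_gt0 : 0 < M.
  by apply: lt_le_trans (sM _ z_in); rewrite normr_gt0 gt_eqF// sigma_gt0.
(* The flux stays above 1, so y grows at least like x / M. *)
have y_gt0 x : x \in `[0, L] -> 0 < x -> 0 < y x.
  move=> xL x_gt0; have [[iy Hy] _] := sy.
  have /andP[x0 x1] : 0 <= x <= L by move: xL; rewrite in_itv.
  rewrite Hy// y0 add0r; apply: (@lt_le_trans _ _ (\int[mu]_(s in `]0, x[) M^-1)).
    by rewrite Rintegral_cst_itv// subr0 mulr_gt0// invr_gt0.
  apply: le_Rintegral => //.
  - by apply: intble_cst => //; exact: itv_oo_fin.
  - exact: intble_sub iy.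
  move=> s /=; rewrite in_itv/= => /andP[s_gt0 sx].
  have sL : s \in `[0, L] by rewrite in_itv/= (ltW s_gt0) (le_trans (ltW sx)).
  rewrite -[leLHS]mul1r ler_pM ?invr_ge0 ?S_ge// lef_pV2 ?posrE ?sigma_gt0//.
  by apply: le_trans (sM _ sL); exact: ler_norm.
have yL_gt0 : 0 < y L by exact: y_gt0.
pose c := (y L)^-1; have c_gt0 : 0 < c by rewrite invr_gt0.
pose ub x := c * y x + 0 * z x; pose Sb x := c * S x + 0 * T x.
have sub : sl_solution L sigma q (fun=> 0) ub Sb by exact: sl_solution_lincomb.
pose u x := 1 * z x + (- z L) * ub x; pose Su x := 1 * T x + (- z L) * Sb x.
have su : sl_solution L sigma q (fun=> 0) u Su by exact: sl_solution_lincomb.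
have ub0 : ub 0 = 0 by rewrite /ub y0 mulr0 mul0r addr0.
have ubL : ub L = 1 by rewrite /ub mul0r addr0 mulVf// gt_eqF.
have u0 : u 0 = 1 by rewrite /u ub0 z0; ring.
have uL : u L = 0 by rewrite /u ubL; ring.
have Sb0 : Sb 0 = c by rewrite /Sb S0; ring.
have ub_gt0 x : x \in `[0, L] -> 0 < x -> 0 < ub x.
  by move=> xL x_gt0; rewrite /ub mul0r addr0 mulr_gt0// y_gt0.
exists u, Su, ub, Sb; split => //; first by rewrite Sb0.
move=> x xL; have /andP[x0 x1] : 0 < x < L by move: xL; rewrite in_itv.
have xL' : x \in `[0, L] by exact: subset_itv_oo_cc.
split; last exact: ub_gt0.
pose phi t := u t / ub t.
have W t : t \in `[0, L] -> Su t * ub t - u t * Sb t = - c.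
  by move=> tL; rewrite (sl_wronskian_const su sub)// ub0 u0 Sb0; ring.
have [pu pSu] := su; have [pub pSb] := sub.
have cu := primitive_continuous pu; have cub := primitive_continuous pub.
have xin t : t \in `[x, L] -> t \in `[0, L] /\ 0 < t.
  by rewrite !in_itv/= => /andP[xt ->]; rewrite (le_trans (ltW x0) xt) (lt_le_trans x0 xt).
have xLs : `[x, L] `<=` `[0, L] by move=> t /= /xin[].
have cphi : {within `[x, L], continuous phi}.
  rewrite continuous_subspace_in => t /set_mem tL; have [t1 t2] := xin _ tL.
  apply: cvgM; first exact: (continuous_subspaceW xLs cu).
  by apply: cvgV; [rewrite gt_eqF// ub_gt0|exact: (continuous_subspaceW xLs cub)].
have dphi t : t \in `]x, L[ -> is_derive t 1 phi (- c / (sigma t * ub t ^+ 2)).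
  rewrite in_itv/= => /andP[xt tL].
  have tin : t \in `[0, L] by rewrite in_itv/= (ltW (lt_trans x0 xt)) ltW.
  have t0L : 0 < t < L by rewrite (lt_trans x0 xt).
  have ubt := ub_gt0 _ tin (lt_trans x0 xt).
  have ubt0 : ub t != 0 by rewrite gt_eqF.
  have sgt0 : sigma t != 0 by rewrite gt_eqF// sigma_gt0.
  have du := primitive_deriv_on pu tin (continuous_within_div_sigma (primitive_continuous pSu)).
  have dub := primitive_deriv_on pub tin (continuous_within_div_sigma (primitive_continuous pSb)).
  have [d1 e1] := deriv_on_is_derive t0L du; have [d2 e2] := deriv_on_is_derive t0L dub.
  rewrite derive1E in e1; rewrite derive1E in e2.
  have D1 : is_derive t 1 u (Su t / sigma t) by apply: DeriveDef.
  have D2 : is_derive t 1 ub (Sb t / sigma t) by apply: DeriveDef.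
  have D3 := is_deriveV ubt0 D2.
  rewrite (_ : - c / _ = u t *: (- ub t ^- 2 *: (Sb t / sigma t)) + (ub t)^-1 *: (Su t / sigma t)).
    exact: (is_deriveM D1 D3).
  rewrite -![_ *: _]/(_ * _) -(W _ tin); field.
  by rewrite ?sgt0 ?ubt0.
have [t txL] := MVT x1 dphi cphi.
have [t1 t2] := xin _ (subset_itv_oo_cc txL).
rewrite /phi uL mul0r => E.
have : - (u x / ub x) < 0.
  rewrite -sub0r E mulNr mulNr oppr_lt0 mulr_gt0 ?subr_gt0//.
  by rewrite divr_gt0// mulr_gt0 ?sigma_gt0// exprn_gt0// ub_gt0.
by rewrite oppr_lt0 pmulr_lgt0// invr_gt0 ub_gt0.
Qed.

End fixed_coefficients.
(** Green's representation: pairing the equation with ub on (0, x) and with u on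
    (x, L), the Wronskian identities combine to give v at x. *)
Lemma sl_green (L : R) (sigma q F u Su ub Sb v S : R -> R) :
  sl_solution L sigma q (fun=> 0) u Su -> sl_solution L sigma q (fun=> 0) ub Sb ->
  u 0 = 1 -> u L = 0 -> ub 0 = 0 -> ub L = 1 ->
  sl_solution L sigma q F v S ->
  forall x, x \in `[0, L] ->
  Sb 0 * v x = ub x * (Sb 0 * v L - \int[mu]_(y in `]x, L[) (F y * u y))
             + u x * (Sb 0 * v 0 - \int[mu]_(y in `]0, x[) (F y * ub y)).
Proof.
move=> su sub u0 uL ub0 ubL sv x xL.
have /andP[x0 x1] : 0 <= x <= L by move: xL; rewrite in_itv.
have L_in : L \in `[0, L] by rewrite in_itv/= lexx (le_trans x0).
have [iP HP] := sl_wronskian sv sub.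
have := primitive_incr (sl_wronskian sv su) x0 x1 (lexx L) => /esym E1.
have E2 : \int[mu]_(y in `]0, x[) (F y * ub y) =
    S x * ub x - v x * Sb x - (S 0 * ub 0 - v 0 * Sb 0).
  by rewrite (HP _ xL); ring.
have W t : t \in `[0, L] -> Su t * ub t - u t * Sb t = - Sb 0.
  by move=> tL; rewrite (sl_wronskian_const su sub)// ub0 u0; ring.
have WL := W _ L_in; have Wx := W _ xL.
rewrite uL ubL mul0r subr0 mulr1 in WL.
rewrite E1 E2 uL ub0 WL.
have -> : Sb 0 = u x * Sb x - Su x * ub x by rewrite -[LHS]opprK -Wx; ring.
ring.
Qed.

End sturm_liouville.

(** * Square integrable functions *)

Section square_integrable.
Context {R : realType}.
Local Notation mu := (@lebesgue_measure R).
Local Notation TR := (measurableTypeR R).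
Local Notation intble D f := (mu.-integrable D (EFin \o f)).

Lemma intble_unrestrict (D : set TR) (f : TR -> R) : measurable D ->
  intble setT (f \_ D) -> intble D f.
Proof.
move=> mD H; apply/(integrable_mkcond _ mD); apply: eq_integrable H => // x _.
by rewrite /= restrict_EFin.
Qed.

Variable L : R.
Implicit Types f g : R -> R.

Lemma restrictM f g (D : set R) : (f \_ D) \* (g \_ D) = (fun x => f x * g x) \_ D.
Proof. by apply/funext => x /=; rewrite !patchE; case: ifP => // _; rewrite mul0r. Qed.

Lemma L2P f : L2 L f <->
  measurable_fun (`]0, L[ : set TR) f /\ intble `]0, L[ (fun x => f x ^+ 2).
Proof.
have sq : (fun x => (f \_ `]0, L[) x ^+ 2) = (fun x => f x ^+ 2) \_ `]0, L[.
  apply/funext => x; rewrite expr2 -[_ * _]/(((f \_ `]0, L[) \* (f \_ `]0, L[)) x) restrictM.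
  by rewrite !patchE; case: ifP => //; rewrite expr2.
split => [Lf|[mf fi]].
- split; last first.
    have := Lfun2_integrable_sqr Lf; rewrite sq => H.
    exact: (intble_unrestrict (measurable_itv _) H).
  have /andP[/set_mem/= mf _] : f \_ `]0, L[ \in Lfun mu 2%:E by [].
  have := (measurable_restrict f (measurable_itv `]0, L[) measurableT).2 mf.
  by rewrite setTI.
- rewrite /L2/= inE; apply/andP; split; rewrite inE/=.
    by apply/(measurable_restrict f (measurable_itv `]0, L[) measurableT); rewrite setTI.
  rewrite /finite_norm unlock; apply: poweR_lty.
  have := intble_restrict (measurable_itv `]0, L[) fi => /integrableP[_].
  apply: le_lt_trans; rewrite le_eqVlt; apply/orP; left; apply/eqP.
  apply: eq_integral => x _ /=; rewrite -sq/= normrX powR_mulrn//.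
Qed.

Lemma L2_measurable f : L2 L f -> measurable_fun (`]0, L[ : set TR) f.
Proof. by move=> /L2P[]. Qed.

Lemma hoelder_L2 f g : L2 L f -> L2 L g ->
  intble `]0, L[ (fun x => f x * g x) /\
  \int[mu]_(x in `]0, L[) `|f x * g x| <= L2norm L f * L2norm L g.
Proof.
move=> Lf Lg; have fg := Lfun2_mul_Lfun1 Lf Lg; rewrite restrictM in fg.
have fgi := (Lfun1_integrable _ _).1 fg.
have fgi' := intble_unrestrict (measurable_itv `]0, L[) fgi.
split=> //.
have /andP[/set_mem/= mf /set_mem/= ff] : f \_ `]0, L[ \in Lfun mu 2%:E by [].
have /andP[/set_mem/= mg /set_mem/= gf] : g \_ `]0, L[ \in Lfun mu 2%:E by [].
have half : 2^-1 + 2^-1 = 1 :> R by rewrite [RHS]splitr !div1r.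
have := hoelder mu mf mg (ltr0n R 2) (ltr0n R 2) half.
rewrite restrictM Lnorm1 => H.
rewrite -lee_fin EFinM /L2norm !fineK ?ge0_fin_numE//.
- apply: le_trans H; rewrite le_eqVlt; apply/orP; left; apply/eqP.
  rewrite integral_mkcond; apply: eq_integral => x _ /=.
  by rewrite !patchE; case: ifP => // _; rewrite normr0.
- exact: Lnorm_ge0.
- exact: Lnorm_ge0.
- by have /integrableP[_] := fgi'.
- exact: integral_ge0.
Qed.

Lemma L2_intble f : L2 L f -> intble `]0, L[ f.
Proof.
move=> /L2P[mf fi].
apply: (@le_intble _ _ _ (fun x => 1 + f x ^+ 2)) => //.
- move=> x _; rewrite -real_normK ?num_real//; have := normr_ge0 (f x).
  by have := sqr_ge0 (`|f x| - 1); nra.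
- by apply: intbleD => //; apply: intble_cst => //; exact: itv_oo_fin.
Qed.

Lemma L2_bounded f M : measurable_fun (`]0, L[ : set TR) f ->
  (forall x, x \in `]0, L[ -> `|f x| <= M) -> L2 L f.
Proof.
move=> mf fM; apply/L2P; split => //.
apply: (@intble_bounded _ _ _ (M ^+ 2)) => //; first exact: itv_oo_fin.
  exact: measurable_funX.
move=> x xL; rewrite normrX lerXn2r ?nnegrE ?fM//.
by apply: le_trans (fM _ xL).
Qed.

Lemma L2M_bounded f g M : L2 L f -> measurable_fun (`]0, L[ : set TR) g ->
  (forall x, x \in `]0, L[ -> `|g x| <= M) -> L2 L (fun x => f x * g x).
Proof.
move=> /L2P[mf fi] mg gM; apply/L2P; split; first exact: measurable_funM.
apply: (@le_intble _ _ _ (fun x => f x ^+ 2 * M ^+ 2)) => //.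
- by apply: measurable_funX; exact: measurable_funM.
- move=> x xL; rewrite exprMn normrM ger0_norm ?sqr_ge0// ler_wpM2l ?sqr_ge0//.
  rewrite normrX lerXn2r ?nnegrE ?gM//.
  by apply: le_trans (gM _ xL).
- by apply: eq_intble (intbleZ (M ^+ 2) _ fi) => // x _; rewrite mulrC.
Qed.

Lemma L2Z k f : L2 L f -> L2 L (fun x => k * f x).
Proof.
move=> /L2P[mf fi]; apply/L2P; split; first exact: measurable_funM.
by apply: eq_intble (intbleZ (k ^+ 2) _ fi) => // x _; rewrite exprMn.
Qed.

Lemma L2D f g : L2 L f -> L2 L g -> L2 L (fun x => f x + g x).
Proof.
move=> /L2P[mf fi] /L2P[mg gi]; apply/L2P; split; first exact: measurable_funD.
apply: (@le_intble _ _ _ (fun x => 2 * (f x ^+ 2 + g x ^+ 2))) => //.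
- by apply: measurable_funX; exact: measurable_funD.
- by move=> x _; rewrite ger0_norm ?sqr_ge0//; have := sqr_ge0 (f x - g x); nra.
- by apply: intbleZ => //; exact: intbleD.
Qed.

Lemma L2B f g : L2 L f -> L2 L g -> L2 L (fun x => f x - g x).
Proof.
by move=> Lf /(L2Z (-1)) /(L2D Lf); under eq_fun do rewrite mulN1r.
Qed.

Lemma L2norm_ge0 f : 0 <= L2norm L f.
Proof. by rewrite /L2norm fine_ge0//; exact: Lnorm_ge0. Qed.

Lemma L2dot_intble f g : L2 L f -> L2 L g -> intble `]0, L[ (fun x => f x * g x).
Proof. by move=> Lf Lg; exact: (hoelder_L2 Lf Lg).1. Qed.

Lemma cauchy_schwarz_L2 f g : L2 L f -> L2 L g ->
  `|L2dot L f g| <= L2norm L f * L2norm L g.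
Proof.
move=> Lf Lg; have [fgi H] := hoelder_L2 Lf Lg.
by apply: le_trans H; exact: le_normr_Rintegral.
Qed.

Lemma L2_cst k : L2 L (fun=> k).
Proof. by apply: (@L2_bounded _ `|k|) => //; exact: measurable_cst. Qed.

Lemma Rintegral_norm_le_L2norm f : L2 L f ->
  \int[mu]_(x in `]0, L[) `|f x| <= L2norm L (fun=> 1) * L2norm L f.
Proof.
move=> Lf; have [_] := hoelder_L2 (L2_cst 1) Lf.
by under [in X in X <= _ -> _]eq_Rintegral do rewrite mul1r.
Qed.

Lemma L2dotBl f1 f2 g : L2 L f1 -> L2 L f2 -> L2 L g ->
  L2dot L (fun x => f1 x - f2 x) g = L2dot L f1 g - L2dot L f2 g.
Proof.
move=> L1 L2' Lg.
rewrite /L2dot -(RintegralB _ (L2dot_intble L1 Lg) (L2dot_intble L2' Lg))//.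
by apply: eq_Rintegral => x _; rewrite mulrBl.
Qed.

Lemma L2dotZl k f g : L2 L f -> L2 L g ->
  L2dot L (fun x => k * f x) g = k * L2dot L f g.
Proof.
move=> Lf Lg; rewrite /L2dot -(RintegralZl _ _ (L2dot_intble Lf Lg))//.
by apply: eq_Rintegral => x _; rewrite mulrA.
Qed.

End square_integrable.

(** * Weak derivatives *)

(** Measurability of intervals for the type that carries the Borel sets. *)
Lemma mitv {R : realType} (i : interval R) : measurable ([set` i] : set (measurableTypeR R)).
Proof. exact: measurable_itv. Qed.

Section spline_bumps.
Context {R : realType}.
Local Notation mu := (@lebesgue_measure R).
Local Notation TR := (measurableTypeR R).
Local Notation intble D f := (mu.-integrable D (EFin \o f)).

Let pos (x : R) : R := Num.max 0 x.

Let pos_id x : 0 <= x -> pos x = x.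
Proof. by move=> x0; rewrite /pos; exact/max_idPr. Qed.

Let pos_0 x : x <= 0 -> pos x = 0.
Proof. by move=> x0; rewrite /pos; exact/max_idPl. Qed.

Let pos_continuous : continuous pos.
Proof. by move=> x; apply: continuous_max; [exact: cst_continuous|exact: cvg_id]. Qed.

Let is_derive_pos2 (x : R) : is_derive x 1 (fun y => pos y ^+ 2) (2 * pos x).
Proof.
have C : h^-1 *: (pos (h + x) ^+ 2 - pos x ^+ 2) @[h --> 0^'] --> 2 * pos x.
  apply/cvgrPdist_le => e e0; rewrite near_withinE; apply/nbhs_ballP; exists e => //= h.
  rewrite /ball/= sub0r normrN => he h0; rewrite -[_ *: _]/(_ * _).
  have E : 2 * pos x - h^-1 * (pos (h + x) ^+ 2 - pos x ^+ 2) =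
           (2 * pos x * h - (pos (h + x) ^+ 2 - pos x ^+ 2)) / h by field.
  rewrite E normf_div ler_pdivrMr ?normr_gt0//.
  apply: (@le_trans _ _ (`|h| * `|h|)); last by rewrite ler_wpM2r// ltW.
  rewrite -normrM -expr2 ger0_norm ?sqr_ge0//.
  have [hx|hx] := leP 0 (h + x); have [x0|x0] := leP 0 x; rewrite ler_norml;
    rewrite ?(pos_id hx) ?(pos_id x0) ?(pos_0 (ltW hx)) ?(pos_0 (ltW x0));
    by apply/andP; split; nra.
apply: DeriveDef.
  by apply/cvg_ex; exists (2 * pos x); rewrite /=; under eq_fun do rewrite scaler1; exact: C.
by rewrite /derive; apply/cvg_lim => //=; under eq_fun do rewrite scaler1; exact: C.
Qed.

Let spline (x : R) : R := pos x ^+ 2 - 2 * pos (x - 1) ^+ 2 + pos (x - 2) ^+ 2.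
Let hat (x : R) : R := 2 * pos x - 2 * (2 * pos (x - 1)) + 2 * pos (x - 2).

Let hat_continuous : continuous hat.
Proof.
have shift c : continuous (fun x : R => pos (x - c)).
  move=> x; apply: (@continuous_comp _ _ _ (fun x : R => x - c) pos); last exact: pos_continuous.
  by apply: cvgB; [exact: cvg_id|exact: cvg_cst].
have mul (c : R) (f : R -> R) : continuous f -> continuous (fun x => c * f x).
  by move=> cf x; apply: cvgM; [exact: cvg_cst|exact: cf].
move=> x; apply: cvgD; last exact: (mul 2 _ (shift 2) x).
apply: cvgB; first exact: (mul 2 _ pos_continuous x).
by apply: (mul 2 _ _ x); exact: (mul 2 _ (shift 1)).
Qed.

Let spline_l x : x <= 0 -> spline x = 0.
Proof.
move=> x0; have x1 : x - 1 <= 0 by lra.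
have x2 : x - 2 <= 0 by lra.
by rewrite /spline !pos_0//; ring.
Qed.

Let spline_r x : 2 <= x -> spline x = 2.
Proof.
move=> x2; have x0 : 0 <= x by lra.
have x1 : 0 <= x - 1 by lra.
have x2' : 0 <= x - 2 by lra.
by rewrite /spline !pos_id//; ring.
Qed.

Let hat_l x : x <= 0 -> hat x = 0.
Proof.
move=> x0; have x1 : x - 1 <= 0 by lra.
have x2 : x - 2 <= 0 by lra.
by rewrite /hat !pos_0//; ring.
Qed.

Let hat_r x : 2 <= x -> hat x = 0.
Proof.
move=> x2; have x0 : 0 <= x by lra.
have x1 : 0 <= x - 1 by lra.
have x2' : 0 <= x - 2 by lra.
by rewrite /hat !pos_id//; ring.
Qed.

Let hat_bound x : `|hat x| <= 2.
Proof.
have [x0|x0] := leP x 0; first by rewrite hat_l// normr0.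
have [x2|x2] := leP 2 x; first by rewrite hat_r// normr0.
have x2' : x - 2 <= 0 by lra.
have [x1|x1] := leP x 1.
  have x1' : x - 1 <= 0 by lra.
  by rewrite /hat (pos_id (ltW x0)) (pos_0 x1') (pos_0 x2') ler_norml; apply/andP; split; lra.
have x1' : 0 <= x - 1 by lra.
by rewrite /hat (pos_id (ltW x0)) (pos_id x1') (pos_0 x2') ler_norml; apply/andP; split; lra.
Qed.

(** A quadratic C^1 spline that rises from 0 to 2 on (a - h, a + h). *)
Definition step (a h x : R) : R := spline ((x - a) / h + 1).
Definition bump (a h x : R) : R := hat ((x - a) / h + 1) / h.

Lemma is_derive_step a h (x : R) : h != 0 -> is_derive x 1 (step a h) (bump a h x).
Proof.
move=> h0.
have dl (c : R) : is_derive x 1 (fun x : R => (x - a) / h + 1 - c) (h^-1).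
  by apply: is_derive_eq; rewrite -![_ *: _]/(_ * _); ring.
have dp (c : R) : is_derive x 1 (fun x => pos ((x - a) / h + 1 - c) ^+ 2)
    (2 * pos ((x - a) / h + 1 - c) * h^-1).
  have := @is_derive1_comp R (fun y => pos y ^+ 2) (fun x : R => (x - a) / h + 1 - c) x _ _ (is_derive_pos2 ((x - a) / h + 1 - c)) (dl c).
  by [].
have := dp 0; rewrite subr0; under eq_fun do rewrite subr0; move=> dp0.
have d1 := is_deriveZ 2 (dp 1).
have := is_deriveD (is_deriveB dp0 d1) (dp 2).
rewrite (_ : bump a h x = 2 * pos ((x - a) / h + 1) * h^-1 -
   2 *: (2 * pos ((x - a) / h + 1 - 1) * h^-1) + 2 * pos ((x - a) / h + 1 - 2) * h^-1); last first.
  by rewrite -[_ *: _]/(_ * _) /bump /hat; ring.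
by [].
Qed.

Lemma step_l a h x : 0 < h -> x <= a - h -> step a h x = 0.
Proof.
move=> h0 xa; apply: spline_l.
have : (x - a) / h <= -1 by rewrite ler_pdivrMr//; lra.
by lra.
Qed.

Lemma step_r a h x : 0 < h -> a + h <= x -> step a h x = 2.
Proof.
move=> h0 xa; apply: spline_r.
have : 1 <= (x - a) / h by rewrite ler_pdivlMr//; lra.
by lra.
Qed.

Lemma bump_out a h x : 0 < h -> h <= `|x - a| -> bump a h x = 0.
Proof.
move=> h0; rewrite /bump; have [xa|xa] := leP 0 (x - a).
  rewrite ger0_norm// => xh; rewrite hat_r ?mul0r//.
  have : 1 <= (x - a) / h by rewrite ler_pdivlMr//; lra.
  by lra.
rewrite ltr0_norm// => xh; rewrite hat_l ?mul0r//.
have : (x - a) / h <= -1 by rewrite ler_pdivrMr//; lra.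
by lra.
Qed.

Lemma bump_bound a h x : 0 < h -> `|bump a h x| <= 2 / h.
Proof.
by move=> h0; rewrite /bump normf_div (gtr0_norm h0) ler_wpM2r ?invr_ge0 ?(ltW h0).
Qed.

Lemma bump_continuous a h : continuous (bump a h).
Proof.
move=> x; apply: cvgM; last exact: cvg_cst.
apply: (@continuous_comp _ _ _ (fun x : R => (x - a) / h + 1) hat); last exact: hat_continuous.
apply: cvgD; last exact: cvg_cst.
apply: cvgM; last exact: cvg_cst.
by apply: cvgB; [exact: cvg_id|exact: cvg_cst].
Qed.

End spline_bumps.

Section weak_derivatives.
Context {R : realType}.
Local Notation mu := (@lebesgue_measure R).
Local Notation TR := (measurableTypeR R).
Local Notation intble D f := (mu.-integrable D (EFin \o f)).
Variable L : R.
Hypothesis L0 : 0 < L.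
Implicit Types f g F : R -> R.

Lemma is_derive_derive1 F (x l : R) : is_derive x 1 F l -> derivable F x 1 /\ derive1 F x = l.
Proof. by move=> dF; split; [exact: ex_derive|rewrite derive1E derive_val]. Qed.

Lemma test_function_step (a b h : R) : 0 < h -> a < b -> 0 < a - h -> b + h < L ->
  let phi := fun x => step a h x - step b h x in
  test_function L phi /\ derive1 phi = (fun x => bump a h x - bump b h x).
Proof.
move=> h0 ab ah bh phi; have hn : h != 0 by rewrite gt_eqF.
have d x := is_derive_derive1 (is_deriveB (is_derive_step a x hn) (is_derive_step b x hn)).
have E : derive1 phi = (fun x => bump a h x - bump b h x).
  by apply/funext => x; exact: (d x).2.
split=> //; split.
- by move=> x; exact: (d x).1.
- rewrite E => x; apply: cvgB; exact: bump_continuous.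
- exists (a - h), (b + h); split => //.
  move=> x; rewrite in_itv/= negb_and -!ltNge => /orP[xa|xb]; rewrite /phi.
    by rewrite !step_l ?subrr//; lra.
  by rewrite !step_r ?subrr//; lra.
Qed.

Lemma lebesgue_pt_mean f x : locally_integrable setT f -> lebesgue_pt f x ->
  forall e : R, 0 < e -> exists2 d : R, 0 < d & forall r : R, 0 < r < d ->
    \int[mu]_(y in ball x r) `|f y - f x| <= e * r.
Proof.
move=> lf lx e e0.
have e2 : 0 < e / 2 by rewrite divr_gt0.
have [mf _ lfK] := lf.
have := lx; rewrite /lebesgue_pt => /fine_cvgP[].
rewrite near_withinE => /nbhs_ballP[d1/= d10 H1].
move=> /cvgrPdist_le /(_ _ e2); rewrite near_withinE => /nbhs_ballP[d2/= d20 H2].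
exists (Num.min d1 d2); first by rewrite lt_min d10.
move=> r /andP[r0]; rewrite lt_min => /andP[rd1 rd2].
have b1 : ball 0 d1 r by rewrite /ball/= sub0r normrN gtr0_norm.
have b2 : ball 0 d2 r by rewrite /ball/= sub0r normrN gtr0_norm.
have := H1 _ b1 r0; have := H2 _ b2 r0.
rewrite sub0r normrN /= /davg /iavg (lebesgue_measure_ball _ (ltW r0)).
set I := (\int[mu]_(y in _) _)%E => H3.
have I0 : (0 <= I)%E by exact: integral_ge0.
have r2 : 0 < r *+ 2 by rewrite mulrn_wgt0.
rewrite inver gt_eqF// => Ifin.
have {}Ifin : I \is a fin_num.
  rewrite ge0_fin_numE//; move: Ifin I0; case: I {H3} => [s _ _|H _|//]; first exact: ltry.
  by move: H; rewrite gt0_muley ?lte_fin ?invr_gt0.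
have -> : \int[mu]_(y in ball x r) `|f y - f x| = fine I by [].
move: H3; rewrite inver gt_eqF// -(fineK Ifin) -EFinM/= ger0_norm ?mulr_ge0 ?invr_ge0 ?fine_ge0 ?(ltW r2)//.
by rewrite mulrC ler_pdivrMr// -mulr_natr => H3; lra.
Qed.

(** A bump has mass 2 and height of order 1 / h on an interval of length 2 h, so it
    averages f near a; at a Lebesgue point such averages converge. *)
Lemma bump_mean f (a : R) : intble `]0, L[ f -> 0 < a < L -> lebesgue_pt (f \_ `]0, L[) a ->
  forall e : R, 0 < e -> exists2 d : R, 0 < d & forall h : R, 0 < h < d ->
    `|\int[mu]_(x in `]0, L[) (f x * bump a h x) - 2 * f a| <= e.
Proof.
move=> fi /andP[a0 aL] lf e e0.
pose fz := f \_ `]0, L[.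
have fzi : intble setT fz by exact: intble_restrict.
have loc : locally_integrable setT fz by apply: integrable_locally.
have [d d0 H] := lebesgue_pt_mean loc lf (divr_gt0 e0 (ltr0n R 2)).
exists (Num.min d (Num.min a (L - a))); first by rewrite !lt_min d0 a0 subr_gt0.
move=> h /andP[h0]; rewrite !lt_min => /and3P[hd ha hL].
have hn : h != 0 by rewrite gt_eqF.
have mb : measurable_fun (`]0, L[ : set TR) (bump a h).
  by apply: measurable_funTS; apply: continuous_measurable_fun; exact: bump_continuous.
have bb x : `]0, L[%classic x -> `|bump a h x| <= 2 / h by move=> _; exact: bump_bound.
have i1 := intbleM_bounded (mitv _) fi mb bb.
have ib : intble `]0, L[ (bump a h).
  by apply: (@intble_bounded _ _ _ (2 / h)) => //; exact: itv_oo_fin.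
have -> : 2 * f a = \int[mu]_(x in `]0, L[) (f a * bump a h x).
  rewrite (RintegralZl _ (mitv _) ib) mulrC; congr (_ * _).
  have P : is_primitive L (step a h) (bump a h).
    apply: deriv_on_primitive => //.
    - by move=> x _; apply: derivable_deriv_on; exact: is_derive_step.
    - by apply: continuous_subspaceT; exact: bump_continuous.
  have [_ /(_ L)] := P; rewrite in_itv/= lexx ltW// => /(_ isT).
  rewrite (step_r h0) ?(step_l h0) ?add0r//; first by lra.
  by lra.
rewrite -(RintegralB (mitv _) i1 (intbleZ (f a) (mitv _) ib)).
have ballm : measurable (ball a h : set TR) by exact: measurable_ball.
have fini : intble (ball a h) (fun y => fz y - fz a).
  apply: intbleB => //; first exact: intbleS fzi.
  by apply: intble_cst => //; rewrite (lebesgue_measure_ball _ (ltW h0)) ltry.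
have Hh : \int[mu]_(y in ball a h) `|fz y - fz a| <= e / 2 * h by apply: H; rewrite h0.
apply: (@le_trans _ _ (\int[mu]_(y in `]0, L[) ((2 / h) * ((fun y => `|fz y - fz a|) \_ (ball a h)) y))).
  apply: Rintegral_le_norm => //.
  - apply: measurable_funB; first exact: intble_measurable i1.
    by apply: measurable_funM => //; exact: measurable_cst.
  - apply: intbleZ => //; apply: (@intbleS _ setT) => //; apply: intble_restrict => //.
    exact: integrable_norm.
  - move=> x xL; rewrite -mulrBl normrM mulrC patchE; case: ifPn => [xb|xb].
      rewrite /fz !patch_itv_oo; move: xL; rewrite /= in_itv/= => ->; rewrite a0 aL/=.
      by rewrite ler_wpM2r// bump_bound.
    rewrite bump_out ?normr0 ?mul0r ?mulr0//.
    by rewrite leNgt; apply: contra xb => xb; apply/mem_set; rewrite /ball/= distrC.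
have i3 : intble setT ((fun y => `|fz y - fz a|) \_ (ball a h)).
  by apply: intble_restrict => //; exact: integrable_norm.
rewrite (RintegralZl _ (mitv _) (intbleS measurableT (mitv `]0, L[) (@subsetT _ _) i3)).
rewrite -Rintegral_mkcondr (_ : _ `&` _ = ball a h); last first.
  apply/seteqP; split => [x []//|x xb]; split => //=.
  move: xb; rewrite /ball/= in_itv/= ltr_norml => /andP[xb1 xb2].
  by apply/andP; split; lra.
apply: (@le_trans _ _ (2 / h * (e / 2 * h))).
  by rewrite ler_wpM2l// divr_ge0// ltW.
by rewrite le_eqVlt; apply/orP; left; apply/eqP; field.
Qed.

(** du Bois-Reymond: two Lebesgue points are compared by the test function
    rising at the first and falling at the second one. *)
Lemma du_bois_reymond f : intble `]0, L[ f ->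
  (forall phi, test_function L phi -> L2dot L f (derive1 phi) = 0) ->
  exists c, {ae mu, forall x, x \in `]0, L[ -> f x = c}.
Proof.
move=> fi ff; pose fz := f \_ `]0, L[.
have fzi : intble setT fz by exact: intble_restrict.
have loc : locally_integrable setT fz by apply: integrable_locally.
have leb := lebesgue_differentiation loc.
have key (a b : R) : lebesgue_pt fz a -> lebesgue_pt fz b -> 0 < a -> a < b -> b < L -> f a = f b.
  move=> la lb a0 ab bL; apply/eqP; rewrite -subr_eq0 -normr_le0; apply/ler_addgt0Pl => e e0.
  rewrite addr0.
  have aL : 0 < a < L by rewrite a0 (lt_trans ab).
  have b0L : 0 < b < L by rewrite (lt_trans a0).
  have [d1 d10 H1] := bump_mean fi aL la e0; have [d2 d20 H2] := bump_mean fi b0L lb e0.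
  have [h /and5P[h0 h1 h2 h3 h4]] : exists h : R, [&& 0 < h, h < d1, h < d2, h < a & h < L - b].
    exists (Num.min d1 (Num.min d2 (Num.min a (L - b))) / 2).
    have m0 : 0 < Num.min d1 (Num.min d2 (Num.min a (L - b))).
      by rewrite !lt_min d10 d20 a0 subr_gt0.
    have : Num.min d1 (Num.min d2 (Num.min a (L - b))) / 2 < Num.min d1 (Num.min d2 (Num.min a (L - b))).
      by rewrite ltr_pdivrMr// ltr_pMr// ltr1n.
    by rewrite divr_gt0//= !lt_min => /and4P[-> -> -> ->].
  have H1' := H1 h ltac:(by rewrite h0); have H2' := H2 h ltac:(by rewrite h0).
  have mb (c : R) : measurable_fun (`]0, L[ : set TR) (bump c h).
    by apply: measurable_funTS; apply: continuous_measurable_fun; exact: bump_continuous.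
  have bb (c x : R) : `]0, L[%classic x -> `|bump c h x| <= 2 / h by move=> _; exact: bump_bound.
  have ah : 0 < a - h by rewrite subr_gt0.
  have bh : b + h < L by rewrite addrC -ltrBrDr.
  have [tphi E] := test_function_step h0 ab ah bh.
  have := ff _ tphi; rewrite E /L2dot.
  under eq_Rintegral do rewrite mulrBr.
  rewrite (RintegralB (mitv _) (intbleM_bounded (mitv _) fi (mb a) (bb a))
    (intbleM_bounded (mitv _) fi (mb b) (bb b))).
  move: H1' H2'; set A := Rintegral _ _ _; set B := Rintegral _ _ _.
  rewrite !ler_norml => /andP[? ?] /andP[? ?] AB.
  by apply/andP; split; lra.
have [[a [a0L la]]|no] := pselect (exists a : R, 0 < a < L /\ lebesgue_pt fz a).
  exists (f a); apply: aeS leb => x lx; rewrite in_itv/= => /andP[x0 xL].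
  have /andP[a0 aL] := a0L.
  have [xa|xa|-> //] := ltgtP x a; first exact: key.
  by apply/esym; exact: key.
exists 0; apply: aeS leb => x lx; rewrite in_itv/= => xL.
by exfalso; apply: no; exists x.
Qed.

Lemma test_function_primitive phi : test_function L phi ->
  [/\ is_primitive L phi (derive1 phi), {within `[0, L], continuous (derive1 phi)},
      phi 0 = 0 & phi L = 0].
Proof.
move=> [dphi cphi [a [b [a0 bL H]]]].
have c' : {within `[0, L], continuous (derive1 phi)} by exact: continuous_subspaceT.
split => //.
- apply: deriv_on_primitive => // x _; apply: derivable_deriv_on.
  by rewrite derive1E; exact: derivableP.
- by apply: H; rewrite in_itv/= leNgt a0.
- by apply: H; rewrite in_itv/= negb_and -!ltNge bL orbT.
Qed.

Lemma primitive_test F f phi : is_primitive L F f -> test_function L phi ->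
  L2dot L F (derive1 phi) = - L2dot L f phi.
Proof.
move=> pF tphi; have [pphi cphi phi0 phiL] := test_function_primitive tphi.
have [_ /(_ L)] := primitiveM pF pphi; rewrite in_itv/= lexx ltW// => /(_ isT).
have i1 : intble `]0, L[ (fun x => f x * phi x).
  by apply: intbleM_continuous pF.1 _; exact: primitive_continuous pphi.
have i2 : intble `]0, L[ (fun x => F x * derive1 phi x).
  have := intbleM_continuous pphi.1 (primitive_continuous pF).
  by apply: eq_intble => // x _; rewrite mulrC.
rewrite phi0 phiL !mulr0 add0r (RintegralD (mitv _) i1 i2) /L2dot.
by move=> /esym/eqP; rewrite addrC addr_eq0 => /eqP.
Qed.

(** Functions in H^1 are, up to a null set, the primitives of their weak
    derivatives, because the difference has weak derivative 0. *)
Lemma weak_deriv_primitive f g : L2 L f -> L2 L g -> is_weak_deriv L f g ->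
  exists F, is_primitive L F g /\ {ae mu, forall x, x \in `]0, L[ -> f x = F x}.
Proof.
move=> Lf Lg wf; have fi := L2_intble Lf; have gi := L2_intble Lg.
pose G x := 0 + \int[mu]_(y in `]0, x[) g y.
have pG : is_primitive L G g by exact: primitive_integral.
have cG := primitive_continuous pG.
have Gi := continuous_intble cG.
have [|c Hc] := @du_bois_reymond (fun x => f x - G x) (intbleB (mitv _) fi Gi).
  move=> phi tphi; have [pphi cphi phi0 phiL] := test_function_primitive tphi.
  have i1 := intbleM_continuous fi cphi; have i2 := intbleM_continuous Gi cphi.
  rewrite /L2dot; under eq_Rintegral do rewrite mulrBl.
  rewrite (RintegralB (mitv _) i1 i2).
  have := wf _ tphi; have := primitive_test pG tphi; rewrite /L2dot => -> ->.
  by rewrite subrr.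
exists (fun x => G x + c); split.
  apply: eq_primitive (primitiveD pG (primitive_cst L c)) => x _ //.
  by rewrite addr0.
by apply: aeS Hc => x H xL; rewrite -(H xL); ring.
Qed.

Lemma primitive_weak_deriv f F g : L2 L f -> is_primitive L F g ->
  {ae mu, forall x, x \in `]0, L[ -> f x = F x} -> is_weak_deriv L f g.
Proof.
move=> Lf pF fF phi tphi; have [pphi cphi phi0 phiL] := test_function_primitive tphi.
rewrite -(primitive_test pF tphi); apply: ae_eq_Rintegral => //.
- apply: measurable_funM; first exact: L2_measurable.
  exact: continuous_itv_oo_measurable.
- apply: measurable_funM; last exact: continuous_itv_oo_measurable.
  exact: continuous_itv_oo_measurable (primitive_continuous pF).
- by apply: aeS fF => x H xL; rewrite H.
Qed.

Lemma weak_derivP f : H1 L f -> L2 L (weak_deriv L f) /\ is_weak_deriv L f (weak_deriv L f).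
Proof.
move=> [_ [g Lg wg]]; rewrite /weak_deriv.
exact: (@xgetPex _ (cst 0) [set g | L2 L g /\ is_weak_deriv L f g] (ex_intro _ g (conj Lg wg))).
Qed.

(** No interval is a null set, so every point is a limit of points where the two
    functions agree. *)
Lemma continuous_ae_eq f g : {within `[0, L], continuous f} -> {within `[0, L], continuous g} ->
  {ae mu, forall x, x \in `]0, L[ -> f x = g x} -> forall x, x \in `[0, L] -> f x = g x.
Proof.
move=> /within_continuousP cf /within_continuousP cg [N [mN N0 fgN]] x xL.
apply/eqP; rewrite -subr_eq0 -normr_le0; apply/ler_addgt0Pl => e e0; rewrite addr0.
have e2 : 0 < e / 2 by rewrite divr_gt0.
have [d1 d10 H1] := cf _ xL _ e2; have [d2 d20 H2] := cg _ xL _ e2.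
have /andP[x0 x1] : 0 <= x <= L by move: xL; rewrite in_itv.
pose lo := Num.max 0 (x - Num.min d1 d2); pose hi := Num.min L (x + Num.min d1 d2).
have m0 : 0 < Num.min d1 d2 by rewrite lt_min d10.
have lohi : lo < hi.
  by rewrite /lo /hi lt_min !gt_max L0/=; apply/andP; split; [lra|apply/andP; split; lra].
have [y [yin yN]] : exists y, (y \in `]lo, hi[) /\ ~ N y.
  apply: contrapT => H.
  have sub : `]lo, hi[ `<=` N.
    by move=> y ylh; apply: contrapT => yN; apply: H; exists y.
  have := le_measure mu (mem_set (mitv _)) (mem_set mN) sub.
  have E1 : mu `]lo, hi[ = (hi - lo)%:E by rewrite lebesgue_measure_itv/= lte_fin lohi.
  by rewrite [X in (_ <= X)%E]N0 [X in (X <= _)%E]E1 lee_fin leNgt subr_gt0 lohi.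
move: yin; rewrite in_itv/= /lo /hi gt_max lt_min => /andP[/andP[y0 yx] /andP[yL xy]].
have yd : `|y - x| < Num.min d1 d2 by rewrite ltr_norml; apply/andP; split; lra.
have yL' : y \in `[0, L] by rewrite in_itv/= !ltW.
have fgy : f y = g y.
  by apply: contrapT => H; apply: yN; apply: fgN => /= /(_ _)/H; apply; rewrite in_itv/= y0.
move: yd; rewrite lt_min => /andP[yd1 yd2].
have := H1 y yL' yd1; have := H2 y yL' yd2; rewrite fgy !ler_norml => /andP[? ?] /andP[? ?].
by apply/andP; split; lra.
Qed.

Lemma H1_primitive v : H1 L v -> {within `[0, L], continuous v} ->
  is_primitive L v (weak_deriv L v).
Proof.
move=> H1v cv; have [Ldv wv] := weak_derivP H1v.
have [F [pF vF]] := weak_deriv_primitive H1v.1 Ldv wv.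
have vF' := continuous_ae_eq cv (primitive_continuous pF) vF.
by apply: eq_primitive pF => // x xL; exact/esym/vF'.
Qed.

(** Sobolev embedding, by averaging |v (x)| <= |v (y)| + int |v'| over y. *)
Lemma sobolev v : H1 L v -> {within `[0, L], continuous v} ->
  forall x, x \in `[0, L] ->
  L * `|v x| <= L2norm L (fun=> 1) * (L2norm L v + L * L2norm L (weak_deriv L v)).
Proof.
move=> H1v cv x xL; have pv := H1_primitive H1v cv; have [Ldv wv] := weak_derivP H1v.
have /andP[x0 x1] : 0 <= x <= L by move: xL; rewrite in_itv.
pose J := \int[mu]_(y in `]0, L[) `|weak_deriv L v y|.
have dvi := L2_intble Ldv.
have incr (a b : R) : 0 <= a -> a <= b -> b <= L -> `|v b - v a| <= J.
  move=> a0 ab bL; rewrite (primitive_incr pv a0 ab bL).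
  have iab := intble_sub a0 bL dvi.
  apply: (le_trans (le_normr_Rintegral (mitv _) iab)).
  have jL : intble `]0, L[ (fun y => `|weak_deriv L v y|) by exact: integrable_norm.
  rewrite /J Rintegral_mkcond [leRHS]Rintegral_mkcond; apply: le_Rintegral => //.
  - by apply: intble_restrict => //; exact: integrable_norm.
  - exact: intble_restrict.
  - move=> y _; rewrite !patch_itv_oo; case: ifPn => [/andP[ay yb]|_].
      by rewrite (le_lt_trans a0 ay) (lt_le_trans yb bL).
    by case: ifP.
have vi : intble `]0, L[ v by exact: continuous_intble.
have H : \int[mu]_(y in `]0, L[) `|v x| <= \int[mu]_(y in `]0, L[) (`|v y| + J).
  have ini : intble `]0, L[ (fun y => `|v y|) by exact: integrable_norm.
  have ic (k : R) : intble `]0, L[ (fun=> k) by apply: intble_cst => //; exact: itv_oo_fin.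
  apply: le_Rintegral => //; first exact: (intbleD (mitv _) ini (ic J)).
  move=> y; rewrite /= in_itv/= => /andP[y0 yL].
  rewrite -[v x](subrK (v y)) addrC (le_trans (ler_normD _ _))// lerD2l.
  have [xy|xy] := leP x y; last exact: (incr _ _ (ltW y0) (ltW xy) x1).
  by rewrite distrC; exact: (incr _ _ x0 xy (ltW yL)).
move: H; rewrite (Rintegral_cst_itv _ (ltW L0)) subr0 mulrC => H; apply: (le_trans H).
have ini : intble `]0, L[ (fun y => `|v y|) by exact: integrable_norm.
have ic (k : R) : intble `]0, L[ (fun=> k) by apply: intble_cst => //; exact: itv_oo_fin.
rewrite (RintegralD (mitv _) ini (ic J)) (Rintegral_cst_itv _ (ltW L0)) subr0 mulrDr.
apply: lerD; first by apply: Rintegral_norm_le_L2norm; exact: H1v.1.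
by rewrite mulrCA [J * L]mulrC ler_wpM2l ?(ltW L0)//; exact: Rintegral_norm_le_L2norm.
Qed.

Lemma H1B v w : H1 L v -> H1 L w -> H1 L (fun x => v x - w x).
Proof.
move=> [Lv [dv Ldv wv]] [Lw [dw Ldw ww]]; split; first exact: L2B.
exists (fun x => dv x - dw x); first exact: L2B.
move=> phi tphi; have [pphi cphi _ _] := test_function_primitive tphi.
have cp := primitive_continuous pphi.
have L2c (h : R -> R) : {within `[0, L], continuous h} -> L2 L h.
  move=> ch; have [M M0 HM] := continuous_itv_bounded ch.
  apply: (@L2_bounded _ _ _ M); first exact: continuous_itv_oo_measurable.
  by move=> x xL; apply: HM; exact: subset_itv_oo_cc.
have Lp := L2c _ cp; have Lp' := L2c _ cphi.
by rewrite !L2dotBl// wv// ww// opprB addrC opprK.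
Qed.

(** A continuous H^2 function solving the equation weakly solves the first-order
    system: its flux is the continuous representative of sigma v', and testing
    with indicators of intervals identifies the density of the flux. *)
Lemma H2_sl_solution (sigma dsigma q rho v W : R -> R) (Q : R) :
  is_primitive L sigma dsigma -> {within `[0, L], continuous dsigma} ->
  (forall x, x \in `[0, L] -> 0 < sigma x) ->
  measurable_fun (`]0, L[ : set TR) q -> (forall x, x \in `]0, L[ -> `|q x| <= Q) ->
  measurable_fun (`]0, L[ : set TR) rho -> (forall x, x \in `]0, L[ -> `|rho x| <= Q) ->
  H2 L v -> {within `[0, L], continuous v} -> L2 L W ->
  (forall psi, L2 L psi ->
     L2dot L (fun x => rho x * W x - weak_deriv L (sigma \* weak_deriv L v) x + q x * v x) psi = 0) ->
  exists S, sl_solution L sigma q (fun x => rho x * W x) v S.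
Proof.
move=> psig cds sig0 mq bq mr br [H1v H1dv] cv LW eqn.
have pv := H1_primitive H1v cv; have [Ldv _] := weak_derivP H1v.
have [Lddv wddv] := weak_derivP H1dv.
have [m [pm dvm]] := weak_deriv_primitive Ldv Lddv wddv.
have csig := primitive_continuous psig.
have [M1 _ HM1] := continuous_itv_bounded csig.
have [M2 _ HM2] := continuous_itv_bounded cds.
have [M3 _ HM3] := continuous_itv_bounded (primitive_continuous pm).
have oc (x : R) : x \in `]0, L[ -> x \in `[0, L] by exact: subset_itv_oo_cc.
have ms := continuous_itv_oo_measurable csig.
have mds := continuous_itv_oo_measurable cds.
have mm := continuous_itv_oo_measurable (primitive_continuous pm).
have Lm : L2 L m by apply: (L2_bounded mm) => x /oc; exact: HM3.
have psm := primitiveM psig pm.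
pose h x := dsigma x * m x + sigma x * weak_deriv L (weak_deriv L v) x.
have Lh : L2 L h.
  apply: L2D.
    have := L2M_bounded Lm mds (fun x xL => HM2 x (oc x xL)).
    by under eq_fun do rewrite mulrC.
  have := L2M_bounded Lddv ms (fun x xL => HM1 x (oc x xL)).
  by under eq_fun do rewrite mulrC.
have Lsdv : L2 L (sigma \* weak_deriv L v).
  have := L2M_bounded Ldv ms (fun x xL => HM1 x (oc x xL)).
  by under eq_fun do rewrite mulrC.
have sdvm : {ae mu, forall x, x \in `]0, L[ -> (sigma \* weak_deriv L v) x = sigma x * m x}.
  by apply: aeS dvm => x H xL; rewrite /= H.
have wsdv := primitive_weak_deriv Lsdv psm sdvm.
have H1s : H1 L (sigma \* weak_deriv L v) by split => //; exists h.
have [Lz wz] := weak_derivP H1s.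
set z := weak_deriv L (sigma \* weak_deriv L v) in Lz wz eqn.
have [S [pS sS]] := weak_deriv_primitive Lsdv Lz wz.
exists S; split.
  apply: (primitive_ae pv).
    apply: measurable_funM; first exact: continuous_itv_oo_measurable (primitive_continuous pS).
    apply: continuous_itv_oo_measurable; rewrite continuous_subspace_in => x /set_mem xL.
    by apply: cvgV; [rewrite gt_eqF// sig0|exact: csig].
  apply: aeS sS => x H xL; rewrite -(H xL) /= mulrAC mulfV ?mul1r//.
  by rewrite gt_eqF// sig0// oc.
have mv := continuous_itv_oo_measurable cv.
have [M4 _ HM4] := continuous_itv_bounded cv.
have Lv : L2 L v by apply: (L2_bounded mv) => x /oc; exact: HM4.
have LrW : L2 L (fun x => rho x * W x).
  by have := L2M_bounded LW mr br; under eq_fun do rewrite mulrC.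
have Lqv : L2 L (fun x => q x * v x).
  by have := L2M_bounded Lv mq bq; under eq_fun do rewrite mulrC.
have iF : intble `]0, L[ (fun x => q x * v x + rho x * W x).
  exact: (intbleD (mitv _) (L2_intble Lqv) (L2_intble LrW)).
have iz := L2_intble Lz.
split=> // x xL; have [_ ->//] := pS; congr (_ + _).
have /andP[x0 x1] : 0 <= x <= L by move: xL; rewrite in_itv.
have Lpsi : L2 L (\1_`]0, x[ : R -> R).
  apply: (@L2_bounded _ _ _ 1); first exact: measurable_indic.
  by move=> y _; rewrite indicE; case: (_ \in _); rewrite ?normr1 ?normr0.
have := eqn _ Lpsi; rewrite /L2dot => E.
apply/eqP; rewrite -subr_eq0 -(RintegralB (mitv _) (intble_sub (lexx 0) x1 iz) (intble_sub (lexx 0) x1 iF)).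
rewrite -oppr_eq0 -mulN1r -(RintegralZl _ (mitv _)); last first.
  by apply: (intble_sub (lexx 0) x1); exact: (intbleB (mitv _) iz iF).
apply/eqP; rewrite -[RHS]E Rintegral_mkcond [RHS]Rintegral_mkcond; apply: eq_Rintegral => y _.
rewrite !patch_itv_oo indicE mem_itvE in_itv/=.
case: ifP => [/andP[y0 yx]|yN]; last by rewrite mulr0 if_same.
by rewrite y0 (lt_le_trans yx x1)/= mulr1; ring.
Qed.

End weak_derivatives.

(** * Convolution *)

Section convolution.
Context {R : realType}.
Local Notation mu := (@lebesgue_measure R).
Local Notation TR := (measurableTypeR R).
Local Notation intble D f := (mu.-integrable D (EFin \o f)).
Implicit Types (k f g : TR -> R).

Lemma ifM0 (b : bool) (x y : R) : (if b then x * y else 0) = (if b then x else 0) * y.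
Proof. by case: b => //; rewrite mul0r. Qed.

Lemma Rintegral_zero (D : set TR) : \int[mu]_(x in D) (0 : R) = 0.
Proof. by rewrite /Rintegral integral0. Qed.

Let sub_lt (s r t : R) : 0 < r -> s < t -> s - r < t.
Proof. by move=> ? ?; lra. Qed.

Let lt_of_sub (x r t : R) : 0 < r -> x < t - r -> x < t.
Proof. by move=> ? ?; lra. Qed.

Let reflect_itv (r t : R) : (0 < t - r < t) = (0 < r < t).
Proof. by apply/idP/idP => /andP[? ?]; apply/andP; split; lra. Qed.

Let reflect_lt (s x t : R) : (s < - x + t) = (x < t - s).
Proof. by apply/idP/idP => ?; lra. Qed.

Let reflectK (x t : R) : t - (- x + t) = x.
Proof. ring. Qed.

(** Tonelli: by translation invariance the inner integral of |k (x - y)| does not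
    depend on y. *)
Lemma convolution_integrable k f : intble setT k -> intble setT f ->
  (mu \x mu)%E.-integrable setT (EFin \o (fun z : TR * TR => k (z.1 - z.2) * f z.2)).
Proof.
move=> ki fi; have mk := intble_measurable ki; have mf := intble_measurable fi.
have msub : measurable_fun setT (fun z : TR * TR => z.1 - z.2 : TR).
  by apply: measurable_funB; [exact: measurable_fst|exact: measurable_snd].
have mz : measurable_fun setT (fun z : TR * TR => k (z.1 - z.2) * f z.2).
  apply: measurable_funM; first exact: (measurableT_comp mk msub).
  exact: (measurableT_comp mf measurable_snd).
apply/integrable21ltyP; first exact/measurable_EFinP.
have [_ kfin] := integrableP _ _ _ ki; have [_ ffin] := integrableP _ _ _ fi.
have inner (y : R) : (\int[mu]_x `|(k (x - y) * f y)%:E| =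
    (\int[mu]_x `|(k x)%:E|) * `|(f y)%:E|)%E.
  transitivity (\int[mu]_x (`|(k (x - y)%R)%:E| * `|f y|%:E))%E.
    by apply: eq_integral => x _; rewrite /= normrM EFinM.
  have mky : measurable_fun setT (fun x : TR => k (x - y)).
    by apply: (measurableT_comp mk); apply: measurable_funB.
  rewrite ge0_integralZr//; last first.
    by do 2 apply: measurableT_comp => //.
  congr (_ * _)%E; rewrite [RHS](@ge0_integral_affine _ 1 (- y))//; last first.
    by do 2 apply: measurableT_comp => //.
  by rewrite normr1 mul1e; apply: eq_integral => x _; rewrite mul1r.
rewrite /=; under eq_integral do rewrite inner.
have K0 : (0 <= \int[mu]_x `|(k x)%:E|)%E by exact: integral_ge0.
rewrite ge0_integralZl//; last by do 2 apply: measurableT_comp => //.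
by apply: lte_mul_pinfty => //; rewrite ge0_fin_numE.
Qed.

Lemma Rintegral_convolution k f : intble setT k -> intble setT f ->
  intble setT (fun t => \int[mu]_s (k (t - s) * f s)) /\
  \int[mu]_t \int[mu]_s (k (t - s) * f s) = (\int[mu]_t k t) * \int[mu]_t f t.
Proof.
move=> ki fi; have [i1 _ E] := Rfubini (convolution_integrable ki fi).
split=> //; rewrite /= in E; rewrite E mulrC.
have ky (y : R) : intble setT (fun x : TR => k (x - y)).
  apply: eq_intble (intble_affine (- y) (oner_neq0 _) ki) => // x _.
  by rewrite mul1r.
rewrite -(RintegralZr _ measurableT fi); apply: eq_Rintegral => y _.
rewrite (RintegralZr _ measurableT (ky y)) mulrC; congr (_ * _).
rewrite [RHS](Rintegral_affine (- y) (oner_neq0 _) ki) normr1 mul1r.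
by apply: eq_Rintegral => x _; rewrite mul1r.
Qed.

(** Associativity of convolution with the constant 1 on a finite horizon: both
    sides are the integral of f against the primitive of the kernel. *)
Lemma volterra_commute k f (t : R) : 0 < t ->
  intble `]0, t[ k -> intble `]0, t[ f ->
  intble `]0, t[ (fun s => \int[mu]_(r in `]0, s[) (k (s - r) * f r)) /\
  \int[mu]_(s in `]0, t[) \int[mu]_(r in `]0, s[) (k (s - r) * f r) =
  \int[mu]_(r in `]0, t[) (k (t - r) * \int[mu]_(s in `]0, r[) f s).
Proof.
move=> t0 ki fi; pose kz := k \_ `]0, t[; pose fz := f \_ `]0, t[.
have kzi : intble setT kz by exact: (intble_restrict (mitv _)).
have fzi : intble setT fz by exact: (intble_restrict (mitv _)).
pose kappa (x : R) := \int[mu]_(s in `]0, x[) k s.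
have mlt : measurable_fun setT (fun z : TR * TR => z.1 < t).
  by apply: measurable_fun_ltr; [exact: measurable_fst|exact: measurable_cst].
have mlt2 : measurable_fun setT (fun z : TR * TR => z.2 < z.1).
  by apply: measurable_fun_ltr; [exact: measurable_snd|exact: measurable_fst].
have A1 := integrable_prod_mask (convolution_integrable kzi fzi) mlt.
have [i1 _ E1] := Rfubini A1.
have n1 : -1 != 0 :> R by rewrite oppr_eq0 oner_neq0.
have krefl : intble setT (fun r : TR => kz (t - r)).
  apply: eq_intble (intble_affine t n1 kzi) => // r _.
  by rewrite mulN1r addrC.
have A2 := integrable_prod_mask (integrable_prodM krefl fzi) mlt2.
have [_ _ E2] := Rfubini A2.
have kshift (y : R) : intble setT (fun x : TR => kz (x - y)).
  apply: eq_intble (intble_affine (- y) (oner_neq0 _) kzi) => // x _.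
  by rewrite mul1r.
have W (s : R) : \int[mu]_r (if s < t then kz (s - r) * fz r else 0) =
    ((fun s => \int[mu]_(r in `]0, s[) (k (s - r) * f r)) \_ `]0, t[) s.
  rewrite patch_itv_oo; case: ifPn => [/andP[s0 st]|sN].
    rewrite st [RHS]Rintegral_mkcond; apply: eq_Rintegral => r _.
    rewrite /kz /fz !patch_itv_oo subr_gt0; case: (ltP 0 r) => r0 /=; last by rewrite mulr0.
    case: (ltP r s) => rs /=; last by rewrite mul0r.
    by rewrite (lt_trans rs st) (sub_lt r0 st).
  transitivity (\int[mu]_(x in [set: TR]) (0 : R)); last exact: Rintegral_zero.
  congr Rintegral.
    apply/funext => r; case: ltP => st; last by [].
    rewrite /kz /fz !patch_itv_oo.
    have s0 : s <= 0 by move: sN; rewrite st andbT -leNgt.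
    case: (ltP 0 r) => r0 /=; last by rewrite mulr0.
    by rewrite subr_gt0 ltNge (le_trans s0 (ltW r0))/= mul0r.
have i1' : intble setT ((fun s => \int[mu]_(r in `]0, s[) (k (s - r) * f r)) \_ `]0, t[).
  by apply: eq_intble i1 => // s _; rewrite -W.
split; first exact: (intble_unrestrict (mitv _) i1').
transitivity (\int[mu]_r (kappa (t - r) * fz r)).
  rewrite Rintegral_mkcond; rewrite /= in E1.
  under eq_Rintegral do rewrite -W.
  rewrite E1; apply: eq_Rintegral => r _.
  under eq_Rintegral do rewrite ifM0.
  have im : intble setT (fun x : TR => if x < t then kz (x - r) else 0).
    apply: intble_mask (kshift r) _.
    exact: (@measurable_fun_ltr _ TR R setT id (cst t)).
  rewrite (RintegralZr _ measurableT im).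
  rewrite /fz patch_itv_oo; case: ifP => [/andP[r0 rt]|_]; last by rewrite !mulr0.
  congr (_ * _); rewrite (Rintegral_affine r (oner_neq0 _) im) normr1 mul1r.
  rewrite /kappa [RHS]Rintegral_mkcond; apply: eq_Rintegral => x _.
  rewrite mul1r addrK /kz !patch_itv_oo -ltrBrDr.
  case: (ltP x (t - r)) => xt /=; last by rewrite andbF.
  by rewrite andbT (lt_of_sub _ xt) ?andbT.
transitivity (\int[mu]_r \int[mu]_s (if s < r then kz (t - r) * fz s else 0)); last first.
  rewrite [RHS]Rintegral_mkcond; apply: eq_Rintegral => r _; rewrite patch_itv_oo.
  case: ifPn => [/andP[r0 rt]|rN]; last first.
    rewrite -[RHS](Rintegral_zero setT); congr Rintegral.
    apply/funext => s; rewrite /kz patch_itv_oo.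
    by rewrite reflect_itv (negbTE rN) mul0r if_same.
  have fr : intble setT (f \_ `]0, r[).
    have sub : `]0, r[ `<=` (`]0, t[ : set R) by apply: subset_itvl; rewrite bnd_simp ltW.
    exact: (intble_restrict (mitv _) (intbleS (mitv _) (mitv _) sub fi)).
  rewrite [in RHS]Rintegral_mkcond -(RintegralZl _ measurableT fr).
  apply: eq_Rintegral => s _; rewrite /kz /fz !patch_itv_oo.
  rewrite reflect_itv r0 rt.
  case: (ltP s r) => sr; last by rewrite andbF mulr0.
  by rewrite andbT (lt_trans sr rt) andbT.
rewrite /= in E2; rewrite E2; apply: eq_Rintegral => s _.
under [RHS]eq_Rintegral do rewrite ifM0.
have im : intble setT (fun r : TR => if s < r then kz (t - r) else 0).
  apply: intble_mask krefl _.
  exact: (@measurable_fun_ltr _ TR R setT (cst s) id).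
rewrite (RintegralZr _ measurableT im).
rewrite /fz patch_itv_oo; case: ifP => [/andP[s0 st]|_]; last by rewrite !mulr0.
congr (_ * _); rewrite [RHS](Rintegral_affine t n1 im) normrN1 mul1r.
rewrite /kappa Rintegral_mkcond; apply: eq_Rintegral => x _.
rewrite mulN1r /kz !patch_itv_oo reflect_lt reflectK.
case: (ltP x (t - s)) => xt /=; last by rewrite andbF.
by rewrite andbT (lt_of_sub _ xt) ?andbT.
Qed.

End convolution.

(** * Laplace transforms of exponentials, powers and convolutions *)

Section laplace_transform.
Context {R : realType}.
Local Notation mu := (@lebesgue_measure R).
Local Notation TR := (measurableTypeR R).
Local Notation intble D f := (mu.-integrable D (EFin \o f)).

Lemma derivable_continuous (f : R -> R) (x l : R) : is_derive x 1 f l -> {for x, continuous f}.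
Proof. by move=> df; apply/differentiable_continuous; apply/derivable1_diffP; exact: ex_derive. Qed.

Lemma laplace_one (p : R) : 0 < p ->
  intble `]0, +oo[ (fun t => expR (- (p * t))) /\
  \int[mu]_(t in `]0, +oo[) expR (- (p * t)) = p^-1.
Proof.
move=> p0; pose F (t : R) := - p^-1 * expR (- (p * t)).
have dF (t : R) : is_derive t 1 F (expR (- (p * t))).
  by apply: is_derive_eq; rewrite -![_ *: _]/(_ * _); field; rewrite gt_eqF.
have de (t : R) : {for t, continuous (fun t : R => expR (- (p * t)))}.
  apply: continuous_comp; last exact: continuous_expR.
  by apply: cvgN; apply: cvgM; [exact: cvg_cst|exact: cvg_id].
have cF (t : R) : {for t, continuous F} by exact: derivable_continuous (dF t).
have lim : F x @[x --> +oo] --> 0.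
  rewrite -[X in _ --> X](mulr0 (- p^-1)); apply: cvgM; first exact: cvg_cst.
  apply/cvgrPdist_le => e e0; exists ((p * e)^-1); split; first exact: num_real.
  move=> t te; have t0 : 0 < t by apply: lt_trans te; rewrite invr_gt0 mulr_gt0.
  rewrite sub0r normrN gtr0_norm ?expR_gt0// expRN -[leRHS]invrK lef_pV2 ?posrE ?expR_gt0 ?invr_gt0//.
  apply: le_trans (expR_ge1Dx _); move: te; rewrite invfM => te.
  have : e^-1 < p * t by rewrite mulrC -ltr_pdivrMr// mulrC.
  by move=> /ltW /le_trans; apply; rewrite lerDr.
have H := @ge0_continuous_FTC2y R (fun t => expR (- (p * t))) F 0 0.
have {}H := H (fun t _ => expR_ge0 _).
have {}H := H (continuous_subspaceT de) lim (fun x _ => @ex_derive _ _ _ _ _ _ _ (dF x)).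
have {}H : (\int[mu]_(x in `[0%R, +oo[) (expR (- (p * x)))%:E = 0%:E - (F 0)%:E)%E.
  apply: H; first exact: cvg_at_right_filter (cF 0).
  by move=> x _; rewrite derive1E; exact: derive_val.
have I : intble `[0, +oo[ (fun t => expR (- (p * t))).
  apply/integrableP; split.
    by apply/measurable_EFinP; apply: measurable_funTS; exact: continuous_measurable_fun.
  under eq_integral do rewrite /= ger0_norm ?expR_ge0//.
  by rewrite H -EFinB ltry.
have I0 : intble `]0, +oo[ (fun t => expR (- (p * t))).
  by apply: (intbleS (mitv _) (mitv _) _ I) => //; apply: subset_itvr; rewrite bnd_simp.
split=> //; rewrite Rintegral_itv_obnd_cbnd// /Rintegral H -EFinB/= /F mulr0 oppr0 expR0.
by rewrite mulr1 sub0r opprK.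
Qed.

(** Monotone convergence along [1/n, 1], where the integral is bounded by means of
    the primitive t^(1 - a) / (1 - a). *)
Lemma powRN_intble (a : R) : 0 <= a < 1 -> intble `]0, 1] (fun t => t `^ (- a)).
Proof.
move=> /andP[a0 a1]; have b0 : 0 < 1 - a by rewrite subr_gt0.
pose F (t : R) := (1 - a)^-1 * t `^ (1 - a).
have dF (t : R) : 0 < t -> is_derive t 1 F (t `^ (- a)).
  move=> t0; have d := is_derive1_powR (1 - a) t0.
  have E : t `^ (- a) = (1 - a)^-1 *: ((1 - a) * t `^ (1 - a - 1)).
    by rewrite -[_ *: _]/(_ * _) mulrA mulVf ?gt_eqF// mul1r; congr (_ `^ _); ring.
  by rewrite E; exact: (is_deriveZ (1 - a)^-1 d).
have cf (t : R) : 0 < t -> {for t, continuous (fun t : R => t `^ (- a))}.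
  by move=> t0; exact: derivable_continuous (is_derive1_powR (- a) t0).
have mf : measurable_fun setT (fun t : TR => t `^ (- a)) by exact: measurable_powR.
pose s (n : nat) : R := n.+2%:R^-1.
have s0 n : 0 < s n by rewrite invr_gt0.
have s1 n : s n < 1 by rewrite invf_lt1// ltr1n.
pose A (n : nat) : set TR := [set` `[s n, 1]].
have IA n : (\int[mu]_(t in A n) (t `^ (- a))%:E <= ((1 - a)^-1)%:E)%E.
  have cw : {within `[s n, 1], continuous (fun t => t `^ (- a))}.
    apply: continuous_in_subspaceT => t /set_mem/=; rewrite in_itv/= => /andP[st _].
    exact: cf (lt_le_trans (s0 n) st).
  have cwF : {within `[s n, 1], continuous F}.
    apply: continuous_in_subspaceT => t /set_mem/=; rewrite in_itv/= => /andP[st _].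
    exact: derivable_continuous (dF _ (lt_le_trans (s0 n) st)).
  have [_ cF2 cF3] := (continuous_within_itvP F (s1 n)).1 cwF.
  rewrite (continuous_FTC2 (s1 n) cw (F := F)).
  - rewrite -EFinB lee_fin /F powR1 mulr1 gerBl mulr_ge0 ?invr_ge0 ?(ltW b0)//.
    exact: powR_ge0.
  - split => // t; rewrite in_itv/= => /andP[st _].
    exact: (@ex_derive _ _ _ _ _ _ _ (dF _ (lt_trans (s0 n) st))).
  - move=> t; rewrite in_itv/= => /andP[st _].
    by rewrite derive1E; exact: (@derive_val _ _ _ _ _ _ _ (dF _ (lt_trans (s0 n) st))).
have UA : \bigcup_n A n = `]0, 1]%classic.
  apply/seteqP; split => t /=.
    by move=> [n _]; rewrite /A/= !in_itv/= => /andP[st ->]; rewrite (lt_le_trans (s0 n) st).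
  rewrite in_itv/= => /andP[t0 t1].
  have [n Hn] : exists n, s n <= t.
    have := archi_boundP (ltW (_ : 0 < t^-1)); rewrite invr_gt0 => /(_ t0) H.
    exists (Num.bound t^-1); rewrite /s -[leRHS]invrK lef_pV2 ?posrE ?invr_gt0//.
    by apply: (le_trans (ltW H)); rewrite ler_nat; exact: leqW (leqnSn _).
  by exists n => //; rewrite /A/= in_itv/= Hn.
apply/integrableP; split; first by apply/measurable_EFinP; exact: measurable_funTS.
under eq_integral do rewrite /= ger0_norm ?powR_ge0//.
apply: (@le_lt_trans _ _ ((1 - a)^-1)%:E); last exact: ltry.
have C := @ge0_nondecreasing_set_cvg_integral _ TR R A (fun t => (t `^ (- a))%:E) mu.
have h1 : {homo A : n m / (n <= m)%N >-> (n <= m)%O}.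
  apply/nondecreasing_seqP => n; rewrite subsetEset => t; rewrite /A/= !in_itv/= => /andP[st ->].
  by rewrite andbT; apply: le_trans st; rewrite lef_pV2 ?posrE// ler_nat.
have h2 n : measurable (A n) by exact: mitv.
have h3 n : measurable_fun (A n) (fun t : TR => (t `^ (- a))%:E).
  by apply/measurable_EFinP; exact: measurable_funTS.
have {}C := C h1 h2 h3 (fun n t _ => powR_ge0 t (- a)).
rewrite UA in C; rewrite -(cvg_lim _ C)//; apply: lime_le; last exact: nearW IA.
by apply/cvg_ex; eexists; exact: C.
Qed.

Lemma gamma_intble (a : R) : 0 <= a < 1 ->
  intble `]0, +oo[ (fun t => t `^ (- a) * expR (- t)).
Proof.
move=> a01; have /andP[a0 a1] := a01.
have mf : measurable_fun setT (fun t : TR => t `^ (- a) * expR (- t)).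
  apply: measurable_funM; first exact: measurable_powR.
  apply: (measurableT_comp (f := expR)) => //.
have i1 := powRN_intble a01.
have i2 : intble `]0, +oo[ (fun t => expR (- t)).
  by apply: eq_intble (laplace_one (@ltr01 R)).1 => // t _; rewrite mul1r.
pose g (t : R) := ((fun t => t `^ (- a)) \_ `]0, 1]) t + ((fun t => expR (- t)) \_ `]0, +oo[) t.
have gi : intble setT g.
  exact: (intbleD measurableT (intble_restrict (mitv _) i1) (intble_restrict (mitv _) i2)).
apply: (@le_intble _ _ _ g) => //.
- exact: measurable_funTS.
- move=> t /=; rewrite in_itv/= andbT => t0.
  rewrite ger0_norm ?mulr_ge0 ?powR_ge0 ?expR_ge0// /g !patchE !mem_itvE !in_itv/= t0/=.
  have e1 : expR (- t) <= 1 by rewrite -expR0 ler_expR oppr_le0 ltW.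
  have [t1|t1] := leP t 1.
    by apply: ler_wpDr; rewrite ?expR_ge0// -[leRHS]mulr1 ler_wpM2l// powR_ge0.
  rewrite [point]/(0 : R) add0r -[leRHS]mul1r ler_wpM2r ?expR_ge0//.
  by rewrite -[leRHS](powRr0 t) ler_powR ?(ltW t1)// oppr_le0.
- exact: (intbleS measurableT (mitv _) _ gi).
Qed.

Lemma GammaE (a : R) : Gamma (1 - a) = \int[mu]_(t in `]0, +oo[) (t `^ (- a) * expR (- t)).
Proof. by rewrite /Gamma; apply: eq_Rintegral => t _; congr (_ `^ _ * _); ring. Qed.

Lemma Gamma_gt0 (a : R) : 0 <= a < 1 -> 0 < Gamma (1 - a).
Proof.
move=> a01; have /andP[a0 a1] := a01; have gi := gamma_intble a01.
rewrite GammaE; apply: (@lt_le_trans _ _ (\int[mu]_(t in `]0, 1[) expR (- 1))).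
  by rewrite Rintegral_cst_itv// subr0 mulr1 expR_gt0.
rewrite Rintegral_mkcond [leRHS]Rintegral_mkcond; apply: le_Rintegral => //.
- by apply: intble_restrict => //; apply: intble_cst => //; exact: itv_oo_fin.
- exact: (intble_restrict (mitv _) gi).
- move=> t _; rewrite patch_itv_oo patchE mem_itvE in_itv/= andbT.
  case: ifPn => [/andP[t0 t1]|_].
    rewrite t0 -[leLHS]mul1r; apply: ler_pM; rewrite ?expR_ge0//.
      by rewrite -(powRr0 t) ger_powR ?t0 ?(ltW t1)// oppr_le0.
    by rewrite ler_expR lerN2 ltW.
  by case: ifP => // _; rewrite mulr_ge0 ?powR_ge0 ?expR_ge0.
Qed.

(** The convolution kernel of the Riemann-Liouville integral of order 1 - a. *)
Definition frac_kernel (a t : R) : R := (Gamma (1 - a))^-1 * t `^ (- a).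

Lemma frac_kernel_intble (a T : R) : 0 <= a < 1 -> intble `]0, T[ (frac_kernel a).
Proof.
move=> a01; apply: intbleZ => //.
have gi := gamma_intble a01.
apply: (@le_intble _ _ _ (fun t => expR T * (t `^ (- a) * expR (- t)))) => //.
- by apply: measurable_funTS; exact: measurable_powR.
- move=> t; rewrite /= in_itv/= => /andP[t0 tT].
  rewrite ger0_norm ?powR_ge0// mulrCA -expRD -[leLHS]mulr1 ler_wpM2l ?powR_ge0//.
  by rewrite -expR0 ler_expR subr_ge0 ltW.
- apply: (intbleZ _ (mitv _)); apply: (intbleS (mitv _) (mitv _) _ gi).
  by move=> t /=; rewrite !in_itv/= andbT => /andP[].
Qed.

(** Substituting p t for t in the Gamma integral. *)
Lemma laplace_frac_kernel (a p : R) : 0 <= a < 1 -> 0 < p ->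
  intble `]0, +oo[ (fun t => expR (- (p * t)) * frac_kernel a t) /\
  \int[mu]_(t in `]0, +oo[) (expR (- (p * t)) * frac_kernel a t) = p `^ (a - 1).
Proof.
move=> a01 p0; have gi := intble_restrict (mitv _) (gamma_intble a01).
have pn : p != 0 by rewrite gt_eqF.
have G0 := Gamma_gt0 a01; have Gn : Gamma (1 - a) != 0 by rewrite gt_eqF.
pose g := (fun t => t `^ (- a) * expR (- t)) \_ `]0, +oo[.
have E (t : R) : ((fun t => expR (- (p * t)) * frac_kernel a t) \_ `]0, +oo[) t =
    (Gamma (1 - a))^-1 * p `^ a * g (p * t + 0).
  rewrite addr0 /g !patchE !mem_itvE !in_itv/= !andbT pmulr_rgt0//.
  case: ifP => [t0|_]; last by rewrite [point]/(0 : R) mulr0.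
  rewrite /frac_kernel powRM ?(ltW p0) ?(ltW t0)// !powRN; field.
  by rewrite Gn !gt_eqF ?powR_gt0.
have gi' := intble_affine 0 pn gi.
have i1 : intble setT ((fun t => expR (- (p * t)) * frac_kernel a t) \_ `]0, +oo[).
  by apply: eq_intble (intbleZ ((Gamma (1 - a))^-1 * p `^ a) measurableT gi') => // t _; rewrite E.
split; first exact: (intble_unrestrict (mitv _) i1).
rewrite Rintegral_mkcond; under eq_Rintegral do rewrite E.
rewrite (RintegralZl _ measurableT gi').
have := Rintegral_affine 0 pn gi; rewrite -Rintegral_mkcond -GammaE gtr0_norm// -/g.
set I := \int[mu]_x _ => GE.
have -> : I = Gamma (1 - a) / p by rewrite GE; field.
rewrite powRB ?powRr1 ?(ltW p0)//; last by rewrite pn implybT.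
by field; rewrite pn Gn.
Qed.

(** The weight exp (- p t) splits into exp (- p (t - s)) and exp (- p s), so this is
    the integral of a convolution of weighted functions. *)
Lemma laplace_convolution (k f : R -> R) (p : R) :
  intble `]0, +oo[ (fun t => expR (- (p * t)) * k t) ->
  intble `]0, +oo[ (fun t => expR (- (p * t)) * f t) ->
  (forall t : R, 0 < t -> intble `]0, t[ (fun r => k (t - r) * f r)) ->
  intble `]0, +oo[ (fun t => expR (- (p * t)) * \int[mu]_(r in `]0, t[) (k (t - r) * f r)) /\
  \int[mu]_(t in `]0, +oo[) (expR (- (p * t)) * \int[mu]_(r in `]0, t[) (k (t - r) * f r)) =
  (\int[mu]_(t in `]0, +oo[) (expR (- (p * t)) * k t)) *
  \int[mu]_(t in `]0, +oo[) (expR (- (p * t)) * f t).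
Proof.
move=> /(intble_restrict (mitv _)) ki /(intble_restrict (mitv _)) fi kfi.
set kz := _ \_ _ in ki; set fz := _ \_ _ in fi.
have [i1 E] := Rintegral_convolution ki fi.
pose c t := expR (- (p * t)) * \int[mu]_(r in `]0, t[) (k (t - r) * f r).
have W (t : R) : \int[mu]_s (kz (t - s) * fz s) = (c \_ `]0, +oo[) t.
  rewrite patchE mem_itvE in_itv/= andbT; case: ifPn => [t0|tN].
    rewrite /c [in RHS]Rintegral_mkcond -(RintegralZl _ measurableT (intble_restrict (mitv _) (kfi _ t0))).
    apply: eq_Rintegral => s _.
    rewrite patch_itv_oo /kz /fz !patchE !mem_itvE !in_itv/= !andbT subr_gt0.
    case: (ltP 0 s) => s0 /=; last by rewrite [point]/(0 : R) !mulr0.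
    case: (ltP s t) => st /=; last by rewrite [point]/(0 : R) mul0r mulr0.
    transitivity (expR (- (p * (t - s))) * expR (- (p * s)) * (k (t - s) * f s)); first by ring.
    by rewrite -expRD; congr (expR _ * _); ring.
  rewrite -[RHS](Rintegral_zero [set: TR]); congr Rintegral.
  apply/funext => s; rewrite /kz /fz !patchE !mem_itvE !in_itv/= !andbT subr_gt0 [point]/(0 : R).
  case: (ltP 0 s) => s0 /=; last by rewrite mulr0.
  by rewrite ltNge (le_trans _ (ltW s0)) ?mul0r// leNgt.
have i1' : intble setT (c \_ `]0, +oo[).
  by apply: (eq_intble measurableT _ i1) => t _; rewrite W.
split; first exact: (intble_unrestrict (mitv _) i1').
rewrite [LHS]Rintegral_mkcond [in RHS]Rintegral_mkcond [X in _ = _ * X]Rintegral_mkcond -E.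
by apply: eq_Rintegral => t _; rewrite W.
Qed.

End laplace_transform.

(** * Time regularity of the solution *)

Section evolution.
Context {R : realType}.
Local Notation mu := (@lebesgue_measure R).
Local Notation TR := (measurableTypeR R).
Local Notation intble D f := (mu.-integrable D (EFin \o f)).
Variable L : R.
Hypothesis L0 : 0 < L.

(** The pairing with a fixed L^2 function turns the L^2-valued C^1 curve into a
    scalar C^1 function. *)
Lemma L2dot_continuous (F : R -> R -> R) (psi : R -> R) :
  (forall t, 0 <= t -> L2 L (F t)) -> continuous_in_time (L2norm L) F -> L2 L psi ->
  {within `[0, +oo[, continuous (fun t => L2dot L (F t) psi)}.
Proof.
move=> LF cF Lpsi; apply/within_continuousP => t /=; rewrite in_itv/= andbT => t0 e e0.
have k0 : 0 < L2norm L psi + 1 by rewrite ltr_wpDl// L2norm_ge0.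
have := cF t t0 => /cvgrPdist_le /(_ (e / (L2norm L psi + 1)) (divr_gt0 e0 k0)).
rewrite near_withinE => /nbhs_ballP[d/= d0 H]; exists d => // s; rewrite in_itv/= andbT => s0 std.
have := H s; rewrite /ball/= distrC => /(_ std); rewrite in_itv/= andbT => /(_ s0).
rewrite sub0r normrN ger0_norm ?L2norm_ge0// ler_pdivlMr// => H'.
rewrite -L2dotBl; [|exact: LF|exact: LF|exact: Lpsi].
apply: (le_trans (cauchy_schwarz_L2 (L2B (LF _ s0) (LF _ t0)) Lpsi)).
by apply: le_trans H'; rewrite ler_wpM2l ?L2norm_ge0// lerDl.
Qed.

Lemma L2dot_primitive (U dU : R -> R -> R) (psi : R -> R) (T : R) :
  (forall t, 0 <= t -> L2 L (U t)) -> is_time_deriv L U dU ->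
  continuous_in_time (L2norm L) dU -> L2 L psi -> 0 < T ->
  is_primitive T (fun t => L2dot L (U t) psi) (fun t => L2dot L (dU t) psi).
Proof.
move=> LU dUU cdU Lpsi T0.
have LdU t : 0 <= t -> L2 L (dU t) by move=> /dUU[].
apply: deriv_on_primitive => //; last first.
  apply: continuous_subspaceW (L2dot_continuous LdU cdU Lpsi).
  by move=> t /=; rewrite !in_itv/= andbT => /andP[].
move=> t; rewrite in_itv/= => /andP[t0 tT]; apply/is_deriv_onP => e e0.
have k0 : 0 < L2norm L psi + 1 by rewrite ltr_wpDl// L2norm_ge0.
have [_ /cvgrPdist_le /(_ (e / (L2norm L psi + 1)) (divr_gt0 e0 k0))] := dUU t t0.
rewrite near_withinE /dnbhs near_withinE => /nbhs_ballP[d/= d0 H]; exists d => // s.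
rewrite in_itv/= => /andP[s0 sT] std; have [->|st] := eqVneq s t.
  by rewrite !subrr mulr0 subr0 normr0 mulr0.
have := H s; rewrite /ball/= distrC => /(_ std st); rewrite in_itv/= andbT => /(_ s0).
rewrite sub0r normrN ger0_norm ?L2norm_ge0// ler_pdivlMr// => H'.
have st0 : s - t != 0 by rewrite subr_eq0.
have Lst := L2B (LU _ s0) (LU _ t0).
have Lq : L2 L (fun x => (U s x - U t x) / (s - t)).
  by have := L2Z (s - t)^-1 Lst; under eq_fun do rewrite mulrC.
have E : L2dot L (fun x => (U s x - U t x) / (s - t) - dU t x) psi =
         (L2dot L (U s) psi - L2dot L (U t) psi) / (s - t) - L2dot L (dU t) psi.
  rewrite L2dotBl//; last exact: LdU.
  rewrite -(L2dotBl (LU _ s0) (LU _ t0) Lpsi) mulrC -(L2dotZl (s - t)^-1 Lst Lpsi).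
  by congr (L2dot _ _ _ - _); apply/funext => x; rewrite mulrC.
rewrite (_ : L2dot L (U s) psi - L2dot L (U t) psi - L2dot L (dU t) psi * (s - t) =
   (s - t) * L2dot L (fun x => (U s x - U t x) / (s - t) - dU t x) psi); last first.
  by rewrite E; field.
rewrite normrM mulrC ler_wpM2r//.
apply: (le_trans (cauchy_schwarz_L2 (L2B Lq (LdU _ t0)) Lpsi)).
by apply: le_trans H'; rewrite ler_wpM2l ?L2norm_ge0// lerDl.
Qed.

Lemma L2norm_le_H2norm v : L2norm L v <= H2norm L v.
Proof.
rewrite -[leLHS](ger0_norm (L2norm_ge0 _ _)) -sqrtr_sqr ler_wsqrtr//.
by rewrite -addrA lerDl addr_ge0// sqr_ge0.
Qed.

Lemma L2norm_weak_deriv_le_H2norm v : L2norm L (weak_deriv L v) <= H2norm L v.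
Proof.
rewrite -[leLHS](ger0_norm (L2norm_ge0 _ _)) -sqrtr_sqr ler_wsqrtr//.
by rewrite addrAC lerDr addr_ge0// sqr_ge0.
Qed.

Lemma sup_le_H2norm : exists2 C : R, 0 <= C & forall v, H1 L v -> {within `[0, L], continuous v} ->
  forall x, x \in `[0, L] -> `|v x| <= C * H2norm L v.
Proof.
exists (L2norm L (fun=> 1) * (1 + L) / L).
  by rewrite divr_ge0 ?mulr_ge0 ?L2norm_ge0 ?addr_ge0 ?(ltW L0).
move=> v H1v cv x xL; rewrite mulrAC ler_pdivlMr// mulrC.
apply: (le_trans (sobolev L0 H1v cv xL)); rewrite -mulrA ler_wpM2l ?L2norm_ge0//.
rewrite mulrDl mul1r lerD ?L2norm_le_H2norm// ler_wpM2l ?(ltW L0)//.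
exact: L2norm_weak_deriv_le_H2norm.
Qed.

Section sup_norm.
Variable U : R -> R -> R.
Hypotheses (H2U : forall t, 0 <= t -> H2 L (U t) /\ {within `[0, L], continuous (U t)})
  (cU : continuous_in_time (H2norm L) U) (subexpU : subexponential L U).

Lemma solution_continuous x : x \in `[0, L] -> {within `[0, +oo[, continuous (U ^~ x)}.
Proof.
move=> xL; have [C C0 HC] := sup_le_H2norm.
apply/within_continuousP => t /=; rewrite in_itv/= andbT => t0 e e0.
have k0 : 0 < C + 1 by rewrite ltr_wpDl.
have := cU t0 => /cvgrPdist_le /(_ (e / (C + 1)) (divr_gt0 e0 k0)).
rewrite near_withinE => /nbhs_ballP[d/= d0 H]; exists d => // s; rewrite in_itv/= andbT => s0 std.
have := H s; rewrite /ball/= distrC => /(_ std); rewrite in_itv/= andbT => /(_ s0).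
have N0 : 0 <= H2norm L (U s \- U t) by exact: sqrtr_ge0.
rewrite sub0r normrN ger0_norm// ler_pdivlMr// => H'.
have [[H1s _] cs] := H2U s0; have [[H1t _] ct] := H2U t0.
have c : {within `[0, L], continuous (U s \- U t)}.
  by rewrite continuous_subspace_in => y _; apply: cvgB; [exact: cs|exact: ct].
apply: (le_trans (HC _ (H1B L0 H1s H1t) c x xL)).
by apply: le_trans H'; rewrite mulrC ler_wpM2l// lerDl.
Qed.

Lemma solution_bound (e : R) : 0 < e -> exists2 C : R, 0 <= C &
  forall t x, 0 <= t -> x \in `[0, L] -> `|U t x| <= C * expR (e * t).
Proof.
move=> e0; have [C C0 HC] := sup_le_H2norm; have [D HD] := subexpU e0.
exists (C * `|D|); first by rewrite mulr_ge0.
move=> t x t0 xL; have [[H1t _] ct] := H2U t0.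
apply: (le_trans (HC _ H1t ct x xL)); rewrite -mulrA ler_wpM2l//.
by apply: (le_trans (HD t t0)); rewrite ler_wpM2r ?expR_ge0// ler_norm.
Qed.

(** Joint measurability of a function continuous in x and measurable in t: it
    is the limit of its interpolations by steps in x. *)
Lemma solution_measurable : measurable_fun setT
  (fun z : TR * TR => if (0 < z.1) && (0 < z.2 < L) then U z.1 z.2 else 0).
Proof.
pose h (n : nat) : R := L / n.+1%:R.
have h0 n : 0 < h n by rewrite divr_gt0.
(* The indicator of [k h, (k + 1) h), as a difference so that the sum over k
   telescopes. *)
pose c (n k : nat) (x : R) : R := (x < k.+1%:R * h n)%R%:R - (x < k%:R * h n)%R%:R.
have cP n k x : c n k x = if k%:R * h n <= x < k.+1%:R * h n then 1 else 0.
  rewrite /c leNgt; have lek : k%:R * h n <= k.+1%:R * h n by rewrite ler_wpM2r ?ler_nat// ltW.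
  case: (ltP x (k%:R * h n)) => [xk|kx] /=; first by rewrite (lt_le_trans xk lek) subrr.
  by case: ltP => _; rewrite subr0.
have csum n x : 0 < x < L -> \sum_(0 <= k < n.+1) c n k x = 1.
  move=> /andP[x0 xL]; rewrite telescope_sumr// mul0r (ltNge x 0) (ltW x0) subr0.
  by rewrite (_ : n.+1%:R * h n = L) ?xL// /h mulrC divfK// pnatr_eq0.
have kin n k : (k < n.+1)%N -> k%:R * h n \in `[0, L].
  move=> kn; rewrite in_itv/= mulr_ge0 ?(ltW (h0 n))//= /h mulrA ler_pdivrMr//.
  by rewrite mulrC ler_wpM2l ?(ltW L0)// ler_nat ltnW.
pose b (z : TR * TR) := (0 < z.1) && (0 < z.2 < L).
have m1 : measurable_fun setT (fun z : TR * TR => z.1 : R) by exact: measurable_fst.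
have m2 : measurable_fun setT (fun z : TR * TR => z.2 : R) by exact: measurable_snd.
have mb : measurable_fun setT b.
  apply: measurable_and; first by apply: measurable_fun_ltr => //; exact: measurable_cst.
  by apply: measurable_and; apply: measurable_fun_ltr => //; exact: measurable_cst.
pose fn (n : nat) (z : TR * TR) : R :=
  if b z then \sum_(k <- index_iota 0 n.+1) ((U ^~ (k%:R * h n)) \_ `]0, +oo[) z.1 * c n k z.2 else 0.
have mc n k : measurable_fun setT (fun z : TR * TR => c n k z.2).
  under eq_fun do rewrite cP.
  apply: measurable_fun_ifT; [|exact: measurable_cst|exact: measurable_cst].
  by apply: measurable_and; [apply: measurable_fun_ler|apply: measurable_fun_ltr] => //; exact: measurable_cst.
apply: (@measurable_fun_cvg _ _ _ _ fn).
- move=> n; apply: measurable_fun_ifT => //.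
  apply: (eq_measurable_fun (fun z : TR * TR => \sum_(k <- index_iota 0 n.+1)
    (if (k < n.+1)%N then ((U ^~ (k%:R * h n)) \_ `]0, +oo[) z.1 else 0) * c n k z.2)).
    by move=> z _; apply: eq_big_nat => k /andP[_ ->].
  apply: measurable_sum => k; apply: measurable_funM => //.
  case: ltnP => [kn|_]; last exact: measurable_cst.
  suff : measurable_fun setT ((U ^~ (k%:R * h n)) \_ `]0, +oo[ : TR -> R).
    by move=> mU; exact: (measurableT_comp mU measurable_fst).
  apply/(measurable_restrict _ (mitv _) measurableT); rewrite setTI.
  have cc := solution_continuous (kin n k kn).
  have m : measurable_fun (`[0, +oo[ : set TR) (U ^~ (k%:R * h n)).
    by apply: subspace_continuous_measurable_fun => //; exact: measurable_itv.
  by apply: measurable_funS m => //; apply: subset_itvr; rewrite bnd_simp.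
- move=> z _ /=; rewrite /fn -/(b z); case: ifP => [/andP[t0 /andP[x0 xL]]|_]; last exact: cvg_cst.
  have [_ /within_continuousP ct] := H2U (ltW t0).
  have xin : z.2 \in `[0, L] by rewrite in_itv/= !ltW.
  apply/cvgrPdist_le => e e0; have [d d0 H] := ct _ xin _ e0.
  have : h n @[n --> \oo] --> 0.
    rewrite -[X in _ --> X](mulr0 L); apply: cvgM; [exact: cvg_cst|exact: cvg_harmonic].
  move=> /cvgrPdist_lt /(_ _ d0); apply: filterS => n; rewrite sub0r normrN gtr0_norm// => hd.
  have s1 : \sum_(0 <= k < n.+1) c n k z.2 = 1 by apply: csum; rewrite x0.
  rewrite -[U z.1 z.2]mulr1 -{1}s1 mulr_sumr -sumrB.
  apply: (le_trans (ler_norm_sum _ _ _)).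
  apply: (@le_trans _ _ (\sum_(0 <= k < n.+1) e * c n k z.2)); last by rewrite -mulr_sumr s1 mulr1.
  rewrite big_nat_cond [leRHS]big_nat_cond; apply: ler_sum => k; rewrite andbT => /andP[_ kn].
  rewrite patchE mem_itvE in_itv/= t0/= -mulrBl cP.
  case: ifP => [/andP[kx xk]|_]; last by rewrite !mulr0 normr0.
  rewrite !mulr1 distrC; apply: H; first exact: kin.
  rewrite distrC ger0_norm ?subr_ge0//; apply: lt_trans hd.
  by rewrite ltrBlDr; move: xk; rewrite -natr1 mulrDl mul1r addrC.
Qed.

Variables (p e C : R).
Hypotheses (ep : e < p)
  (UC : forall t x, 0 <= t -> x \in `[0, L] -> `|U t x| <= C * expR (e * t)).

Let V x : R := \int[mu]_(t in `]0, +oo[) (expR (- (p * t)) * U t x).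

Let decay_intble : intble `]0, +oo[ (fun t => C * expR (- ((p - e) * t))).
Proof.
have pe : 0 < p - e by rewrite subr_gt0.
by apply: (intbleZ _ (mitv _)); exact: (laplace_one pe).1.
Qed.

Let U_decay t x : 0 <= t -> x \in `[0, L] ->
  `|expR (- (p * t)) * U t x| <= C * expR (- ((p - e) * t)).
Proof.
move=> t0 xL; rewrite normrM (ger0_norm (expR_ge0 _)).
apply: (le_trans (ler_wpM2l (expR_ge0 _) (UC t0 xL))).
by rewrite mulrCA -expRD (_ : - (p * t) + e * t = - ((p - e) * t))//; ring.
Qed.

Lemma measurable_exp (D : set TR) : measurable_fun D (fun t : TR => expR (- (p * t))).
Proof.
by apply: measurable_funTS; apply: measurableT_comp => //; apply: measurableT_comp => //; exact: measurable_funM.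
Qed.

Lemma laplace_intble (f : R -> R) (D : R) : {within `[0, +oo[, continuous f} ->
  (forall t, 0 <= t -> `|f t| <= D * expR (e * t)) ->
  intble `]0, +oo[ (fun t => expR (- (p * t)) * f t).
Proof.
move=> cf fD; have pe : 0 < p - e by rewrite subr_gt0.
apply: (@le_intble _ _ _ (fun t => D * expR (- ((p - e) * t)))) => //.
- apply: measurable_funM; first exact: measurable_exp.
  have m : measurable_fun (`[0, +oo[ : set TR) f.
    by apply: subspace_continuous_measurable_fun => //; exact: measurable_itv.
  by apply: measurable_funS m => //; apply: subset_itvr; rewrite bnd_simp.
- move=> t /=; rewrite in_itv/= andbT => t0; rewrite normrM (ger0_norm (expR_ge0 _)).
  apply: (le_trans (ler_wpM2l (expR_ge0 _) (fD _ (ltW t0)))).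
  by rewrite mulrCA -expRD (_ : - (p * t) + e * t = - ((p - e) * t))//; ring.
- by apply: (intbleZ _ (mitv _)); exact: (laplace_one pe).1.
Qed.

Lemma laplace_bounded : exists M : R, forall x, x \in `[0, L] -> `|V x| <= M.
Proof.
exists (\int[mu]_(t in `]0, +oo[) (C * expR (- ((p - e) * t)))) => x xL.
apply: Rintegral_le_norm => //.
- have := laplace_intble (solution_continuous xL) (fun t t0 => UC t0 xL).
  exact: intble_measurable.
- by move=> t; rewrite /= in_itv/= andbT => /ltW t0; exact: U_decay.
Qed.

(** Fubini's theorem; the growth bound on U dominates the double integrand by a
    product of a decaying exponential and |psi|. *)
Lemma laplace_L2dot (psi : R -> R) : L2 L psi ->
  intble `]0, L[ (fun x => V x * psi x) /\
  \int[mu]_(t in `]0, +oo[) (expR (- (p * t)) * L2dot L (U t) psi) = L2dot L V psi.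
Proof.
move=> Lpsi; have psii := L2_intble Lpsi.
pose Uz (z : TR * TR) : R := if (0 < z.1) && (0 < z.2 < L) then U z.1 z.2 else 0.
pose psiz := psi \_ `]0, L[.
pose dz := (fun t => C * expR (- ((p - e) * t))) \_ `]0, +oo[.
pose J (z : TR * TR) := expR (- (p * z.1)) * Uz z * psiz z.2.
have psizi := intble_restrict (mitv _) psii.
have dzi := intble_restrict (mitv _) decay_intble.
have mJ : measurable_fun setT J.
  apply: measurable_funM; last exact: (measurableT_comp (intble_measurable psizi) measurable_snd).
  apply: measurable_funM; last exact: solution_measurable.
  have me : measurable_fun (setT : set TR) (fun t : TR => expR (- (p * t)) : TR) by exact: measurable_exp.
  exact: (measurableT_comp (f := fun t : TR => expR (- (p * t)) : TR) me measurable_fst).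
have Ji : (mu \x mu)%E.-integrable setT (EFin \o J).
  apply: le_integrable (integrable_prodM dzi psizi) => //; first exact/measurable_EFinP.
  move=> [t x] _ /=; rewrite lee_fin /J /Uz/= !normrM ler_wpM2r// -normrM.
  case: ifPn => [/andP[t0 /andP[x0 xL]]|_]; last by rewrite mulr0 normr0.
  rewrite /dz patchE mem_itvE in_itv/= t0/=; apply: (le_trans _ (ler_norm _)).
  by apply: U_decay; [exact: ltW|rewrite in_itv/= !ltW].
have [i1 i2 E] := Rfubini Ji; rewrite /= in i1 i2 E.
have E1 (t : R) : \int[mu]_x J (t, x) = ((fun t => expR (- (p * t)) * L2dot L (U t) psi) \_ `]0, +oo[) t.
  rewrite patchE mem_itvE in_itv/= andbT; case: ifPn => [t0|tN]; last first.
    rewrite [point]/(0 : R) -[RHS](Rintegral_zero [set: TR]); congr Rintegral.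
    by apply/funext => x; rewrite /J /Uz/= (negbTE tN)/= mulr0 mul0r.
  have LU : L2 L (U t) by have [[[]]] := H2U (ltW t0).
  have ti := L2dot_intble LU Lpsi.
  rewrite /L2dot -(RintegralZl _ (mitv _) ti) [RHS]Rintegral_mkcond.
  apply: eq_Rintegral => x _; rewrite /J /Uz /psiz/= t0/= !patch_itv_oo.
  by case: ifP => _; [rewrite mulrA|rewrite mulr0].
have E2 (x : R) : \int[mu]_t J (t, x) = ((fun x => V x * psi x) \_ `]0, L[) x.
  rewrite patch_itv_oo; case: ifPn => [xL|xN]; last first.
    rewrite -[RHS](Rintegral_zero [set: TR]); congr Rintegral.
    by apply/funext => t; rewrite /J /Uz/= (negbTE xN) andbF mulr0 mul0r.
  have xL' : x \in `[0, L] by rewrite in_itv/=; move/andP: xL => [? ?]; rewrite !ltW.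
  have ti := laplace_intble (solution_continuous xL') (fun t t0 => UC t0 xL').
  rewrite /V -(RintegralZr _ (mitv _) ti) [RHS]Rintegral_mkcond.
  apply: eq_Rintegral => t _; rewrite /J /Uz /psiz/= xL patch_itv_oo xL patchE mem_itvE in_itv/= !andbT.
  by case: ifP => _ //; rewrite mulr0 mul0r.
split.
  apply: (intble_unrestrict (mitv _)).
  by apply: (eq_intble measurableT _ i2) => x _; exact: E2.
rewrite /L2dot Rintegral_mkcond [RHS]Rintegral_mkcond.
under eq_Rintegral do rewrite -E1.
by under [RHS]eq_Rintegral do rewrite -E2.
Qed.

Lemma laplace_measurable : measurable_fun (`]0, L[ : set TR) V.
Proof.
have [i _] := laplace_L2dot (L2_cst L 1).
by apply: eq_measurable_fun (intble_measurable i) => x _; rewrite mulr1.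
Qed.

End sup_norm.
End evolution.

(** * Piecewise constant orders and Caputo derivatives *)

Section partition.
Context {R : realType}.
Local Notation mu := (@lebesgue_measure R).
Local Notation TR := (measurableTypeR R).
Local Notation intble D f := (mu.-integrable D (EFin \o f)).
Variables (L : R) (n : nat) (xs a : nat -> R).
Hypotheses (xs0 : xs 0%N = 0) (xsL : xs n.+1 = L)
  (xs_incr : forall i : nat, (i <= n)%N -> xs i < xs i.+1).

Local Notation alpha := (piecewise_constant n xs a).

Lemma partition_le i j : (i <= j)%N -> (j <= n.+1)%N -> xs i <= xs j.
Proof.
elim: j => [|j IH]; first by rewrite leqn0 => /eqP->.
rewrite leq_eqVlt => /orP[/eqP->//|]; rewrite ltnS => ij jn.
by apply: (le_trans (IH ij (ltnW jn))); exact/ltW/xs_incr.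
Qed.

Lemma piece_bounds i : (i <= n)%N -> 0 <= xs i /\ xs i.+1 <= L.
Proof. by move=> iln; split; [rewrite -xs0; apply: partition_le => //; exact: leqW|rewrite -xsL partition_le]. Qed.

Lemma piece_unique i j x : (i <= n)%N -> (j <= n)%N ->
  x \in `]xs i, xs i.+1[ -> x \in `]xs j, xs j.+1[ -> i = j.
Proof.
rewrite !in_itv/= => iln jn /andP[ix xi] /andP[jx xj].
case: (ltngtP i j) => // ij.
- by have := lt_trans jx (lt_le_trans xi (partition_le ij (leqW jn))); rewrite ltxx.
- by have := lt_trans ix (lt_le_trans xj (partition_le ij (leqW iln))); rewrite ltxx.
Qed.

Lemma piecewise_constantE i x : (i <= n)%N -> x \in `]xs i, xs i.+1[ -> alpha x = a i.
Proof.
move=> iln xi; rewrite /piecewise_constant.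
have other j : (j <= n)%N -> j != i -> (a j - a 0%N) * \1_`]xs j, xs j.+1[ x = 0.
  move=> jn /eqP ji; rewrite indicE mem_itvE; case: (boolP (_ \in _)) => xj; last by rewrite mulr0.
  by case: ji; exact: (piece_unique jn iln xj xi).
have [i0|i0] := posnP i.
  rewrite big_nat_cond big1 ?addr0 ?i0// => j; rewrite andbT ltnS => /andP[j1 jn].
  by apply: other => //; rewrite i0 -lt0n.
rewrite (bigD1_seq i) ?mem_index_iota ?iota_uniq ?i0 ?ltnS//= indicE mem_itvE xi mulr1.
rewrite big_nat_cond big1 ?addr0; first by rewrite addrC subrK.
by move=> j /andP[/andP[_ jn] ji]; exact: other.
Qed.

Lemma piecewise_constant_value x : exists2 i : nat, (i <= n)%N & alpha x = a i.
Proof.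
have [[i [iln xi]]|H] := pselect (exists i : nat, (i <= n)%N /\ x \in `]xs i, xs i.+1[).
  by exists i => //; exact: piecewise_constantE.
(* The nodes lie in no piece; there the order is a 0. *)
exists 0%N => //; rewrite /piecewise_constant big_nat_cond big1 ?addr0// => j.
rewrite andbT ltnS => /andP[_ jn]; rewrite indicE mem_itvE; case: (boolP (_ \in _)) => xj; last by rewrite mulr0.
by case: H; exists j.
Qed.

Lemma measurable_piecewise_constant : measurable_fun (setT : set TR) (alpha : TR -> R).
Proof.
apply: measurable_funD; first exact: measurable_cst.
apply: measurable_sum => j; apply: measurable_funM; first exact: measurable_cst.
exact: (measurable_indic (mitv _)).
Qed.

Lemma measurable_powR_order p : 0 < p ->
  measurable_fun (setT : set TR) (fun y : TR => p `^ alpha y).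
Proof.
move=> p0; rewrite (_ : (fun y => _) = (fun y : TR => expR (alpha y * ln p))); last first.
  by apply/funext => y; rewrite /powR (gt_eqF p0).
have m1 : measurable_fun (setT : set TR) (fun y : TR => alpha y * ln p).
  by apply: measurable_funM; [exact: measurable_piecewise_constant|exact: measurable_cst].
exact: (measurableT_comp (@measurable_expR R) m1).
Qed.

Lemma min_order_le i : (i <= n)%N -> min_order n a <= a i.
Proof. by move=> iln; exact: (bigmin_le (a 0%N) (Ordinal (iln : (i < n.+1)%N)) (fun j => a j)). Qed.

Lemma min_order_gt0 : (forall i : nat, (i <= n)%N -> 0 < a i) -> 0 < min_order n a.
Proof. by move=> a0; apply: lt_bigmin => [|i _]; apply: a0; rewrite // -ltnS. Qed.

Lemma powR_order_le p y : 0 < p <= 1 -> p `^ alpha y <= p `^ min_order n a.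
Proof.
by move=> p01; have [i iln ->] := piecewise_constant_value y; exact/ger_powR/min_order_le.
Qed.

Lemma Rintegral_partition f : intble `]0, L[ f ->
  \int[mu]_(x in `]0, L[) f x = \sum_(0 <= i < n.+1) \int[mu]_(x in `]xs i, xs i.+1[) f x.
Proof.
move=> fi.
suff H k : (k <= n.+1)%N ->
    \int[mu]_(x in `]0, xs k[) f x = \sum_(0 <= i < k) \int[mu]_(x in `]xs i, xs i.+1[) f x.
  by rewrite -xsL; exact: H.
elim: k => [_|k IH kn].
  by rewrite xs0 big_geq// set_itvoo0 Rintegral_set0.
have [k0 k1] := piece_bounds kn.
by rewrite (Rintegral_itv_split k0 (ltW (xs_incr kn)) k1 fi) IH ?(ltnW kn)// big_nat_recr.
Qed.

Lemma piece_subset i : (i <= n)%N -> `]xs i, xs i.+1[ `<=` `]0, L[.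
Proof.
move=> /piece_bounds[k0 k1] x /=; rewrite !in_itv/= => /andP[ix xi].
by rewrite (le_lt_trans k0 ix) (lt_le_trans xi k1).
Qed.

Lemma L2dot_piece i f g : (i <= n)%N ->
  L2dot L f (fun x => g x * \1_`]xs i, xs i.+1[ x) =
  \int[mu]_(x in `]xs i, xs i.+1[) (f x * g x).
Proof.
move=> iln; rewrite /L2dot Rintegral_mkcond [RHS]Rintegral_mkcond.
apply: eq_Rintegral => x _; rewrite !patchE !mem_itvE indicE mem_itvE.
case: ifPn => [xL|xN]; first by case: ifP; rewrite ?mulr1 ?mulr0.
case: ifPn => // xi; case/negP: xN; exact: (piece_subset iln).
Qed.

Lemma L2dot_partition f g : intble `]0, L[ (fun x => f x * g x) ->
  L2dot L f g = \sum_(0 <= i < n.+1) L2dot L f (fun x => g x * \1_`]xs i, xs i.+1[ x).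
Proof.
move=> fg; rewrite {1}/L2dot (Rintegral_partition fg).
by apply: eq_big_nat => i /andP[_ iln]; rewrite L2dot_piece.
Qed.

Lemma L2_piece i g : L2 L g -> L2 L (fun x => g x * \1_`]xs i, xs i.+1[ x).
Proof.
move=> Lg; apply: (@L2M_bounded _ _ _ _ 1) => //.
by move=> x _; rewrite indicE; case: (_ \in _); rewrite ?normr1 ?normr0.
Qed.

(** On a single piece the order is constant, so that the duality which defines
    the Caputo derivative factors out a scalar kernel. *)
Lemma caputo_piece (dU : R -> R -> R) (t : R) (W g : R -> R) i : (i <= n)%N ->
  (forall s, 0 <= s -> L2 L (dU s)) -> is_caputo L alpha dU t W -> L2 L g ->
  let psi := fun x => g x * \1_`]xs i, xs i.+1[ x in
  L2dot L W psi =
  \int[mu]_(s in `]0, t[) (frac_kernel (a i) (t - s) * L2dot L (dU s) psi).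
Proof.
move=> iln LdU [LW HW] Lg psi; have Lpsi : L2 L psi by exact: L2_piece.
have [_ ->] := HW _ Lpsi; apply: eq_Rintegral => s.
rewrite mem_itvE in_itv/= => /andP[s0 _].
have := RintegralZl (frac_kernel (a i) (t - s)) (mitv _) (L2dot_intble (LdU s (ltW s0)) Lpsi).
rewrite /L2dot => <-; apply: eq_Rintegral => x _; rewrite /psi indicE mem_itvE.
case: (boolP (_ \in _)) => xi; last by rewrite !mulr0.
by rewrite (piecewise_constantE iln xi) /frac_kernel !mulr1 mulrA.
Qed.

End partition.

Section fractional_laplace.
Context {R : realType}.
Local Notation mu := (@lebesgue_measure R).
Local Notation TR := (measurableTypeR R).
Local Notation intble D f := (mu.-integrable D (EFin \o f)).

Lemma intble_reflect (k : R -> R) (t : R) : intble `]0, t[ k ->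
  intble `]0, t[ (fun r => k (t - r)).
Proof.
move=> ki; have := intble_restrict (mitv _) ki => /(@intble_affine _ (-1) t); rewrite oppr_eq0 oner_eq0.
move=> /(_ isT) H; apply: (intble_unrestrict (mitv _)).
apply: (eq_intble measurableT _ H) => r _.
rewrite mulN1r !patch_itv_oo addrC (_ : (0 < t - r < t) = (0 < r < t)) 1?andbC//.
by rewrite subr_gt0 gtrBl andbC.
Qed.

(** The Laplace transform of the Caputo derivative of h, h(0) = 0: integrating
    in time replaces the derivative h' under the convolution by h itself, and
    this costs only a factor 1 / p on both sides. *)
Lemma caputo_laplace (a p : R) (f h : R -> R) : 0 <= a < 1 -> 0 < p ->
  (forall T, 0 < T -> is_primitive T h f) -> h 0 = 0 ->
  intble `]0, +oo[ (fun t => expR (- (p * t)) * h t) ->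
  [/\ forall t, 0 < t ->
        intble `]0, t[ (fun s => \int[mu]_(r in `]0, s[) (frac_kernel a (s - r) * f r)),
      intble `]0, +oo[ (fun t => expR (- (p * t)) *
        \int[mu]_(s in `]0, t[) \int[mu]_(r in `]0, s[) (frac_kernel a (s - r) * f r)) &
      \int[mu]_(t in `]0, +oo[) (expR (- (p * t)) *
        \int[mu]_(s in `]0, t[) \int[mu]_(r in `]0, s[) (frac_kernel a (s - r) * f r)) =
      p `^ (a - 1) * \int[mu]_(t in `]0, +oo[) (expR (- (p * t)) * h t)].
Proof.
move=> a01 p0 ph h0 hi.
have fi t (t0 : 0 < t) : intble `]0, t[ f := (ph t t0).1.
have ki t : intble `]0, t[ (frac_kernel a) by exact: frac_kernel_intble.
have hE t : 0 < t -> h t = \int[mu]_(s in `]0, t[) f s.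
  move=> t0; have [_ ->] := ph _ t0; first by rewrite h0 add0r.
  by rewrite in_itv/= lexx ltW.
have E t : 0 < t -> \int[mu]_(s in `]0, t[) \int[mu]_(r in `]0, s[) (frac_kernel a (s - r) * f r) =
    \int[mu]_(r in `]0, t[) (frac_kernel a (t - r) * h r).
  move=> t0; have [_ ->] := volterra_commute t0 (ki t) (fi t t0).
  by apply: eq_Rintegral => r; rewrite mem_itvE in_itv/= => /andP[r0 _]; rewrite hE.
have [lki lkE] := laplace_frac_kernel a01 p0.
have conv t : 0 < t -> intble `]0, t[ (fun r => frac_kernel a (t - r) * h r).
  move=> t0; apply: intbleM_continuous; first exact: intble_reflect.
  exact: primitive_continuous (ph t t0).
have [ci cE] := laplace_convolution lki hi conv.
split.
- by move=> t t0; have [] := volterra_commute t0 (ki t) (fi t t0).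
- apply: (eq_intble (mitv _) _ ci) => t; rewrite /= in_itv/= andbT => t0.
  by rewrite E.
- rewrite -lkE -cE; apply: eq_Rintegral => t; rewrite mem_itvE in_itv/= andbT => t0.
  by rewrite E.
Qed.

(** Nothing is known about the growth of f, so the single Caputo derivatives need not
    have a Laplace transform; only their sum D does.  Hence both sides are compared
    after one integration in time. *)
Lemma caputo_sum_laplace (n : nat) (a : nat -> R) (p : R) (D : R -> R) (f h : nat -> R -> R) :
  0 < p -> (forall i, (i <= n)%N -> 0 <= a i < 1) ->
  (forall i T, 0 < T -> is_primitive T (h i) (f i)) -> (forall i, h i 0 = 0) ->
  (forall i, intble `]0, +oo[ (fun t => expR (- (p * t)) * h i t)) ->
  intble `]0, +oo[ (fun t => expR (- (p * t)) * D t) ->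
  (forall t, 0 < t -> intble `]0, t[ D) ->
  (forall t, 0 < t -> D t = \sum_(0 <= i < n.+1)
     \int[mu]_(r in `]0, t[) (frac_kernel (a i) (t - r) * f i r)) ->
  \int[mu]_(t in `]0, +oo[) (expR (- (p * t)) * D t) =
  \sum_(0 <= i < n.+1) p `^ a i * \int[mu]_(t in `]0, +oo[) (expR (- (p * t)) * h i t).
Proof.
move=> p0 a01 ph h0 hi Di DT DE.
have sumI (T : set TR) (k : nat) (F : nat -> R -> R) : measurable T ->
    (forall i, (i < k)%N -> intble T (F i)) ->
    intble T (fun t => \sum_(0 <= i < k) F i t) /\
    \int[mu]_(t in T) (\sum_(0 <= i < k) F i t) = \sum_(0 <= i < k) \int[mu]_(t in T) F i t.
  move=> mT; elim: k => [|k IH] Fi.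
    split; last first.
      rewrite big_geq// -[RHS](Rintegral_zero T); apply: eq_Rintegral => t _.
      by rewrite big_geq.
    apply: (eq_intble mT (f := fun=> 0)) => [t _|]; first by rewrite big_geq.
    exact: integrable0.
  have [I1 E1] := IH (fun i ik => Fi i (ltnW ik)).
  have I2 := Fi k (ltnSn k).
  split.
    by apply: (eq_intble mT _ (intbleD mT I1 I2)) => t _; rewrite big_nat_recr.
  rewrite big_nat_recr//= -E1 -(RintegralD mT I1 I2); apply: eq_Rintegral => t _.
  by rewrite big_nat_recr.
have [oi oE] := laplace_one p0.
have o1 : intble `]0, +oo[ (fun t => expR (- (p * t)) * 1).
  by apply: (eq_intble (mitv _) _ oi) => t _; rewrite mulr1.
have c1 t : 0 < t -> intble `]0, t[ (fun r => 1 * D r).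
  by move=> t0; apply: (eq_intble (mitv _) _ (DT t t0)) => r _; rewrite mul1r.
have [_ cE] := laplace_convolution o1 Di c1.
have cL : \int[mu]_(t in `]0, +oo[) (expR (- (p * t)) * 1) = p^-1.
  by rewrite -oE; apply: eq_Rintegral => t _; rewrite mulr1.
rewrite cL in cE.
pose c i t := \int[mu]_(s in `]0, t[) \int[mu]_(r in `]0, s[) (frac_kernel (a i) (s - r) * f i r).
have [_ sE] := sumI `]0, +oo[%classic n.+1 (fun i t => expR (- (p * t)) * c i t) (mitv _)
  (fun i iln => let: And3 _ H _ := caputo_laplace (a01 i iln) p0 (ph i) (h0 i) (hi i) in H).
have -> : \int[mu]_(t in `]0, +oo[) (expR (- (p * t)) * D t) =
    p * \sum_(0 <= i < n.+1) \int[mu]_(t in `]0, +oo[) (expR (- (p * t)) * c i t).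
  rewrite -sE; apply: (mulfI (x := p^-1)); first by rewrite invr_eq0 gt_eqF.
  rewrite mulKf ?gt_eqF// -cE; apply: eq_Rintegral => t; rewrite mem_itvE in_itv/= andbT => t0.
  rewrite -mulr_sumr; congr (_ * _).
  have [_ <-] := sumI `]0, t[%classic n.+1
    (fun i s => \int[mu]_(r in `]0, s[) (frac_kernel (a i) (s - r) * f i r)) (mitv _)
    (fun i iln => let: And3 H _ _ := caputo_laplace (a01 i iln) p0 (ph i) (h0 i) (hi i) in H t t0).
  by apply: eq_Rintegral => s; rewrite mem_itvE in_itv/= mul1r => /andP[s0 _]; exact: DE.
rewrite mulr_sumr; apply: eq_big_nat => i /andP[_ iln].
have [_ _ ->] := caputo_laplace (a01 i iln) p0 (ph i) (h0 i) (hi i).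
rewrite mulrA; congr (_ * _); rewrite -{1}(powRr1 (ltW p0)) -powRD.
  by congr (_ `^ _); ring.
by rewrite (gt_eqF p0) implybT.
Qed.

End fractional_laplace.

(** * The resolvent equation *)

Section resolvent.
Context {R : realType}.
Local Notation mu := (@lebesgue_measure R).
Local Notation TR := (measurableTypeR R).
Local Notation intble D f := (mu.-integrable D (EFin \o f)).

Lemma continuous_in_time_L2norm (L : R) (U : R -> R -> R) :
  continuous_in_time (H2norm L) U -> continuous_in_time (L2norm L) U.
Proof.
move=> cU t t0; apply: squeeze_cvgr (cU t t0); last exact: cvg_cst.
by apply: nearW => s; rewrite L2norm_ge0 L2norm_le_H2norm.
Qed.

Variables (L : R) (u ub : R -> R).
Hypotheses (L0 : 0 < L) (cu : {within `[0, L], continuous u})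
  (cub : {within `[0, L], continuous ub}).

(** Up to the factor 1 / omega, the Green function u (max x y) ub (min x y) of the
    Dirichlet problem, off the diagonal. *)
Definition green x y : R :=
  u x * ub y * \1_`]0, x[ y + ub x * u y * \1_`]x, L[ y.

Lemma green_measurable x : measurable_fun (`]0, L[ : set TR) (green x : TR -> R).
Proof.
apply: measurable_funD; apply: measurable_funM.
- by apply: measurable_funM; [exact: measurable_cst|exact: continuous_itv_oo_measurable].
- exact: (measurable_indic (mitv _)).
- by apply: measurable_funM; [exact: measurable_cst|exact: continuous_itv_oo_measurable].
- exact: (measurable_indic (mitv _)).
Qed.

Lemma L2dot_green f x : intble `]0, L[ f -> x \in `[0, L] ->
  L2dot L f (green x) = u x * \int[mu]_(y in `]0, x[) (f y * ub y)
                        + ub x * \int[mu]_(y in `]x, L[) (f y * u y).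
Proof.
move=> fi; rewrite in_itv/= => /andP[x0 xL].
have fu := intbleM_continuous fi cu; have fub := intbleM_continuous fi cub.
have indE (v : R -> R) a b : 0 <= a -> b <= L -> intble `]0, L[ v ->
    intble `]0, L[ (fun y => v y * \1_`]a, b[ y) /\
    \int[mu]_(y in `]0, L[) (v y * \1_`]a, b[ y) = \int[mu]_(y in `]a, b[) v y.
  move=> a0 bL vi; split.
    apply: (@intbleM_bounded _ _ _ _ 1 (mitv _) vi); first exact: (measurable_indic (mitv _)).
    by move=> y _; rewrite indicE; case: (_ \in _); rewrite ?normr1 ?normr0.
  rewrite Rintegral_mkcond [RHS]Rintegral_mkcond; apply: eq_Rintegral => y _.
  rewrite !patch_itv_oo indicE mem_itvE in_itv/=.
  case: ifPn => [_|yN]; first by case: ifP; rewrite ?mulr1 ?mulr0.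
  case: ifPn => // /andP[ay yb]; case/negP: yN.
  by rewrite (le_lt_trans a0 ay) (lt_le_trans yb bL).
have [i1 E1] := indE _ 0 x (lexx 0) xL fub.
have [i2 E2] := indE _ x L x0 (lexx L) fu.
rewrite -E1 -E2 -(RintegralZl _ (mitv _) i1) -(RintegralZl _ (mitv _) i2).
rewrite -(RintegralD (mitv _) (intbleZ _ (mitv _) i1) (intbleZ _ (mitv _) i2)).
by apply: eq_Rintegral => y _; rewrite /green; ring.
Qed.

Lemma green_bounded : exists2 M : R, 0 <= M &
  forall x y, x \in `[0, L] -> y \in `]0, L[ -> `|green x y| <= M.
Proof.
have [B B0 uB] := continuous_itv_bounded cu.
have [B' B'0 ubB] := continuous_itv_bounded cub.
exists (B * B' + B' * B); first by rewrite addr_ge0// mulr_ge0.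
move=> x y xL /subset_itv_oo_cc yL; apply: (le_trans (ler_normD _ _)).
have ind1 (A : set R) : `|\1_A y : R| <= 1.
  by rewrite indicE; case: (_ \in _); rewrite ?normr1 ?normr0.
by apply: lerD; rewrite normrM -[leRHS]mulr1 ler_pM// normrM ler_pM// ?ubB ?uB.
Qed.

Variables (sigma dsigma q rho Su Sb : R -> R) (Q : R).
Hypotheses (psigma : is_primitive L sigma dsigma) (cdsigma : {within `[0, L], continuous dsigma})
  (sigma_gt0 : forall x, x \in `[0, L] -> 0 < sigma x)
  (mq : measurable_fun (`]0, L[ : set TR) q) (qQ : forall x, x \in `]0, L[ -> `|q x| <= Q)
  (mrho : measurable_fun (`]0, L[ : set TR) rho)
  (rhoQ : forall x, x \in `]0, L[ -> `|rho x| <= Q).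
Hypotheses (su : sl_solution L sigma q (fun=> 0) u Su)
  (sub : sl_solution L sigma q (fun=> 0) ub Sb)
  (u0 : u 0 = 1) (uL : u L = 0) (ub0 : ub 0 = 0) (ubL : ub L = 1).
Variables (n : nat) (xs a : nat -> R).
Hypotheses (xs0 : xs 0%N = 0) (xsL : xs n.+1 = L)
  (xs_incr : forall i : nat, (i <= n)%N -> xs i < xs i.+1)
  (a01 : forall i : nat, (i <= n)%N -> 0 < a i < 1).
Local Notation alpha := (piecewise_constant n xs a).
Variables (U dU : R -> R -> R).
Hypotheses (dUU : is_time_deriv L U dU) (cdU : continuous_in_time (L2norm L) dU)
  (H2U : forall t, 0 <= t -> H2 L (U t) /\ {within `[0, L], continuous (U t)})
  (cU : continuous_in_time (H2norm L) U) (subexpU : subexponential L U)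
  (UL : forall t, 0 < t -> U t L = 0) (U0 : forall x, x \in `]0, L[ -> U 0 x = 0)
  (eqU : forall t, 0 < t -> exists2 W, is_caputo L alpha dU t W &
     forall psi, L2 L psi ->
       L2dot L (fun x => rho x * W x - weak_deriv L (sigma \* weak_deriv L (U t)) x
                         + q x * U t x) psi = 0).

Let kernel x i y : R := rho y * green x y * \1_`]xs i, xs i.+1[ y.

Let L2_rho_green x : x \in `[0, L] -> L2 L (fun y => rho y * green x y).
Proof.
move=> xL; have [M M0 gM] := green_bounded.
exact: (L2M_bounded (L2_bounded mrho rhoQ) (green_measurable x) (fun y => gM x y xL)).
Qed.

Let L2_kernel x i : x \in `[0, L] -> L2 L (kernel x i).
Proof. by move=> xL; exact: L2_piece (L2_rho_green xL). Qed.

Let L2_U t : 0 <= t -> L2 L (U t).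
Proof. by move=> /H2U[[[]]]. Qed.

Let L2_dU t : 0 <= t -> L2 L (dU t).
Proof. by move=> /dUU[]. Qed.

Lemma solution_representation t x : 0 < t -> x \in `[0, L] ->
  Sb 0 * (u x * U t 0 - U t x) = \sum_(0 <= i < n.+1)
    \int[mu]_(r in `]0, t[) (frac_kernel (a i) (t - r) * L2dot L (dU r) (kernel x i)).
Proof.
move=> t0 xL; have [W cW eqW] := eqU t0.
have [H2t ct] := H2U (ltW t0); have [LW _] := cW.
have [S sS] := H2_sl_solution L0 psigma cdsigma sigma_gt0 mq qQ mrho rhoQ H2t ct LW eqW.
have LrW : L2 L (fun x => rho x * W x).
  by have := L2M_bounded LW mrho rhoQ; under eq_fun do rewrite mulrC.
rewrite mulrBr (sl_green su sub u0 uL ub0 ubL sS xL) (UL t0).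
have /= -> := eq_big_nat _ _ (fun i (H : (0 <= i < n.+1)%N) =>
  esym (caputo_piece xs_incr (H : (i <= n)%N) L2_dU cW (L2_rho_green xL))).
rewrite -(L2dot_partition xs0 xsL xs_incr (L2dot_intble LW (L2_rho_green xL))).
rewrite (_ : L2dot L W _ = L2dot L (fun x => rho x * W x) (green x)); last first.
  by apply: eq_Rintegral => y _; ring.
by rewrite (L2dot_green (L2_intble LrW) xL); ring.
Qed.

(** The resolvent equation: Laplace transform and Green's formula turn the
    fractional evolution into an integral equation in x alone, in which p enters
    through the weight p^alpha(y). *)
Lemma resolvent_equation p x : 0 < p -> x \in `[0, L] ->
  let V y := \int[mu]_(t in `]0, +oo[) (expR (- (p * t)) * U t y) in
  Sb 0 * (u x * V 0 - V x) = L2dot L (fun y => p `^ alpha y * rho y * V y) (green x).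
Proof.
move=> p0 xL V; have e0 : 0 < p / 2 by rewrite divr_gt0.
have ep : p / 2 < p by rewrite ltr_pdivrMr// ltr_pMr// ltr1n.
have [C C0 UC] := solution_bound L0 H2U subexpU e0.
have [C' HC'] := subexpU e0.
have z_in : 0 \in `[0, L] by rewrite in_itv/= lexx ltW.
have Uc y : y \in `[0, L] -> {within `[0, +oo[, continuous (U ^~ y)}.
  by move=> yL; exact: (solution_continuous L0 H2U cU yL).
have Ui y : y \in `[0, L] -> intble `]0, +oo[ (fun t => expR (- (p * t)) * U t y).
  by move=> yL; exact: (laplace_intble ep (Uc y yL) (fun t t0 => UC t y t0 yL)).
pose h i t := L2dot L (U t) (kernel x i).
pose f i t := L2dot L (dU t) (kernel x i).
pose D t := Sb 0 * (u x * U t 0 - U t x).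
have ph i T : 0 < T -> is_primitive T (h i) (f i).
  by move=> T0; exact: (L2dot_primitive L2_U dUU cdU (L2_kernel i xL) T0).
have h0 i : h i 0 = 0.
  rewrite -[RHS](Rintegral_zero (`]0, L[ : set TR)); apply: eq_Rintegral => y.
  by rewrite mem_itvE => yL; rewrite U0// mul0r.
have hi i : intble `]0, +oo[ (fun t => expR (- (p * t)) * h i t).
  apply: (laplace_intble (D := C' * L2norm L (kernel x i)) ep).
    exact: (L2dot_continuous L2_U (continuous_in_time_L2norm cU) (L2_kernel i xL)).
  move=> t t0; apply: (le_trans (cauchy_schwarz_L2 (L2_U t0) (L2_kernel i xL))).
  rewrite mulrAC ler_wpM2r ?L2norm_ge0//.
  exact: (le_trans (L2norm_le_H2norm _ _) (HC' t t0)).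
have Di : intble `]0, +oo[ (fun t => expR (- (p * t)) * D t).
  have := intbleZ (Sb 0) (mitv _) (intbleB (mitv _) (intbleZ (u x) (mitv _) (Ui 0 z_in)) (Ui x xL)).
  by apply: (eq_intble (mitv _)) => t _; rewrite /D; ring.
have DE : \int[mu]_(t in `]0, +oo[) (expR (- (p * t)) * D t) = Sb 0 * (u x * V 0 - V x).
  rewrite /V -(RintegralZl _ (mitv _) (Ui 0 z_in)).
  rewrite -(RintegralB (mitv _) (intbleZ (u x) (mitv _) (Ui 0 z_in)) (Ui x xL)).
  rewrite -(RintegralZl _ (mitv _) (intbleB (mitv _) (intbleZ (u x) (mitv _) (Ui 0 z_in)) (Ui x xL))).
  by apply: eq_Rintegral => t _; rewrite /D; ring.
have DT t : 0 < t -> intble `]0, t[ D.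
  move=> t0; have Ut y : y \in `[0, L] -> intble `]0, t[ (U ^~ y).
    move=> yL; apply: continuous_intble; apply: continuous_subspaceW (Uc y yL).
    by move=> s /=; rewrite !in_itv/= andbT => /andP[].
  have := intbleZ (Sb 0) (mitv _) (intbleB (mitv _) (intbleZ (u x) (mitv _) (Ut 0 z_in)) (Ut x xL)).
  exact: (eq_intble (mitv _)).
have DS t : 0 < t -> D t = \sum_(0 <= i < n.+1)
    \int[mu]_(r in `]0, t[) (frac_kernel (a i) (t - r) * f i r).
  by move=> t0; exact: solution_representation.
have a01' i : (i <= n)%N -> 0 <= a i < 1 by move=> /a01 /andP[/ltW -> ->].
rewrite -DE (caputo_sum_laplace p0 a01' ph h0 hi Di DT DS).
have [Vi _] := laplace_L2dot L0 H2U cU ep UC (L2_rho_green xL).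
have mP : measurable_fun (`]0, L[ : set TR) (fun y : TR => p `^ alpha y).
  exact: measurable_funTS (measurable_powR_order _ _ _ p0).
have Pb y : y \in `]0, L[ -> `|p `^ alpha y| <= \sum_(0 <= i < n.+1) p `^ a i.
  move=> _; rewrite ger0_norm ?powR_ge0//.
  have [i iln ->] := piecewise_constant_value a xs_incr y.
  rewrite (bigD1_seq i) ?iota_uniq ?mem_index_iota//= lerDl sumr_ge0// => j _.
  exact: powR_ge0.
have PVi := intbleM_bounded (mitv _) Vi mP Pb.
rewrite /L2dot; transitivity (\int[mu]_(y in `]0, L[) (V y * (rho y * green x y) * p `^ alpha y)); last first.
  by apply: eq_Rintegral => y _; ring.
rewrite (Rintegral_partition xs0 xsL xs_incr PVi); apply: eq_big_nat => i /andP[_ iln].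
have [_ ->] := laplace_L2dot L0 H2U cU ep UC (L2_kernel i xL).
have Vpi := intbleS (mitv _) (mitv _) (piece_subset xs0 xsL xs_incr iln) Vi.
rewrite (L2dot_piece xs0 xsL xs_incr _ _ iln) -(RintegralZl _ (mitv _) Vpi).
apply: eq_Rintegral => y; rewrite mem_itvE => yi.
by rewrite (piecewise_constantE a xs_incr iln yi) mulrC.
Qed.

End resolvent.

(** * Asymptotics as p tends to 0 *)

Section asymptotics.
Context {R : realType}.
Local Notation mu := (@lebesgue_measure R).
Local Notation TR := (measurableTypeR R).
Local Notation intble D f := (mu.-integrable D (EFin \o f)).
Variables (L : R) (sigma q u Su ub Sb : R -> R) (s0 : R).
Hypotheses (L0 : 0 < L) (csigma : {within `[0, L], continuous sigma})
  (s0_gt0 : 0 < s0) (sigma_ge : forall x, x \in `[0, L] -> s0 <= sigma x).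
Hypotheses (su : sl_solution L sigma q (fun=> 0) u Su)
  (sub : sl_solution L sigma q (fun=> 0) ub Sb)
  (u0 : u 0 = 1) (uL : u L = 0) (ub0 : ub 0 = 0) (ubL : ub L = 1) (omega_gt0 : 0 < Sb 0).

Let cu := primitive_continuous su.1.
Let cub := primitive_continuous sub.1.
Let z_in : 0 \in `[0, L]. Proof. by rewrite in_itv/= lexx ltW. Qed.
Let L_in : L \in `[0, L]. Proof. by rewrite in_itv/= lexx ltW. Qed.

Let sigma_gt0 x : x \in `[0, L] -> 0 < sigma x.
Proof. by move=> /sigma_ge; exact: lt_le_trans. Qed.

Lemma sl_flux_end : Su L = - Sb 0.
Proof.
by have := sl_wronskian_const su sub L_in; rewrite uL ubL u0 ub0 mulr1 mulr0 !mul0r mul1r subr0 sub0r.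
Qed.

(** Differentiating the Green potential of F moves the derivative onto u and ub
    only: the boundary terms of the two integrals cancel.  At the end points one
    of the integrals vanishes. *)
Lemma green_potential_deriv (F v : R -> R) (c : R) : intble `]0, L[ F ->
  (forall x, x \in `[0, L] -> Sb 0 * (u x * c - v x) = L2dot L F (green L u ub x)) ->
  [/\ {within `[0, L], continuous v},
      is_deriv_on L v 0 (c * (Su 0 / sigma 0) - (sigma 0)^-1 * L2dot L F u) &
      is_deriv_on L v L (c * (Su L / sigma L) + (sigma L)^-1 * L2dot L F ub)].
Proof.
move=> Fi vE.
have Fu := intbleM_continuous Fi cu; have Fub := intbleM_continuous Fi cub.
pose A x := 0 + \int[mu]_(y in `]0, x[) (F y * ub y).
pose B x := L2dot L F u - (0 + \int[mu]_(y in `]0, x[) (F y * u y)).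
have pA : is_primitive L A (fun y => F y * ub y) by exact: primitive_integral.
have pB : is_primitive L B (fun y => 0 - F y * u y).
  by apply: primitiveB; [exact: primitive_cst|exact: primitive_integral].
have [pu pSu] := su; have [pub pSb] := sub.
have w0 : Sb 0 != 0 by rewrite gt_eqF.
pose dw x := Su x / sigma x * A x + Sb x / sigma x * B x.
pose dv x := c * (Su x / sigma x) - (Sb 0)^-1 * dw x.
have pw : is_primitive L (fun x => u x * A x + ub x * B x) dw.
  apply: eq_primitive (primitiveD (primitiveM pu pA) (primitiveM pub pB)) => x _ //.
  by rewrite /dw; ring.
have pv : is_primitive L v dv.
  apply: eq_primitive (primitiveB (primitiveZ c pu) (primitiveZ (Sb 0)^-1 pw)) => // x xL.
  have /andP[x0 x1] : 0 <= x <= L by move: xL; rewrite in_itv.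
  have -> : u x * A x + ub x * B x = L2dot L F (green L u ub x).
    rewrite (L2dot_green cu cub Fi xL) /A /B !add0r; congr (_ + _ * _).
    by rewrite /L2dot (Rintegral_itv_split x0 x1 (lexx L) Fu) addrAC subrr add0r.
  by rewrite -vE//; field.
have cdv : {within `[0, L], continuous dv}.
  have c1 := continuous_within_div_sigma csigma s0_gt0 sigma_ge (primitive_continuous pSu).
  have c2 := continuous_within_div_sigma csigma s0_gt0 sigma_ge (primitive_continuous pSb).
  have cA := primitive_continuous pA; have cB := primitive_continuous pB.
  rewrite continuous_subspace_in => x /set_mem xL.
  apply: cvgB; first by apply: cvgM; [exact: cvg_cst|exact: c1].
  apply: cvgM; first exact: cvg_cst.
  by apply: cvgD; apply: cvgM; [exact: c1|exact: cA|exact: c2|exact: cB].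
split; first exact: primitive_continuous pv.
- have := primitive_deriv_on pv z_in cdv; congr is_deriv_on.
  rewrite /dv /dw /A /B set_itvoo0 !Rintegral_set0; field.
  by rewrite w0 gt_eqF ?sigma_gt0.
- have := primitive_deriv_on pv L_in cdv; congr is_deriv_on.
  rewrite /dv /dw /A /B -/(L2dot L F u) -/(L2dot L F ub) sl_flux_end; field.
  by rewrite w0 gt_eqF ?sigma_gt0.
Qed.

Variables (rho : R -> R) (Q : R).
Hypotheses (mrho : measurable_fun (`]0, L[ : set TR) rho)
  (rhoQ : forall x, x \in `]0, L[ -> `|rho x| <= Q).
Variables (n : nat) (xs a : nat -> R).
Hypotheses (xs0 : xs 0%N = 0) (xsL : xs n.+1 = L)
  (xs_incr : forall i : nat, (i <= n)%N -> xs i < xs i.+1)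
  (a01 : forall i : nat, (i <= n)%N -> 0 < a i < 1).
Local Notation alpha := (piecewise_constant n xs a).
Local Notation m := (min_order n a).
Variable V : R -> R -> R.
Hypotheses (mV : forall p, 0 < p -> measurable_fun (`]0, L[ : set TR) (V p))
  (bV : forall p, 0 < p -> exists M : R, forall x, x \in `[0, L] -> `|V p x| <= M)
  (eqV : forall p x, 0 < p -> x \in `[0, L] -> Sb 0 * (u x * V p 0 - V p x) =
     L2dot L (fun y => p `^ alpha y * rho y * V p y) (green L u ub x)).

Let m_gt0 : 0 < m.
Proof. by apply: min_order_gt0 => i /a01 /andP[]. Qed.

Let Q_ge0 : 0 <= Q.
Proof.
have x_in : L / 2 \in `]0, L[ by rewrite in_itv/= divr_gt0//= ltr_pdivrMr// ltr_pMr// ltr1n.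
exact: le_trans (normr_ge0 _) (rhoQ x_in).
Qed.

(** For p <= 1 the weight p^alpha is at most p^m. *)
Let weight_bound p (f : R -> R) (S : R) : 0 < p <= 1 ->
  (forall y, y \in `]0, L[ -> `|f y| <= S) ->
  forall y, y \in `]0, L[ -> `|p `^ alpha y * rho y * f y| <= p `^ m * Q * S.
Proof.
move=> p01 fS y yL; rewrite !normrM ler_pM ?mulr_ge0 ?fS// ler_pM ?rhoQ//.
by rewrite ger0_norm ?powR_ge0// powR_order_le.
Qed.

Let weight_measurable p (f : R -> R) : 0 < p -> measurable_fun (`]0, L[ : set TR) f ->
  measurable_fun (`]0, L[ : set TR) (fun y : TR => p `^ alpha y * rho y * f y).
Proof.
move=> p0 mf; apply: measurable_funM => //; apply: measurable_funM => //.
exact: measurable_funTS (measurable_powR_order _ _ _ p0).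
Qed.

Let weight_intble p (f : R -> R) (S : R) : 0 < p <= 1 ->
  measurable_fun (`]0, L[ : set TR) f -> (forall y, y \in `]0, L[ -> `|f y| <= S) ->
  intble `]0, L[ (fun y => p `^ alpha y * rho y * f y).
Proof.
move=> p01 mf fS; have /andP[p0 _] := p01.
apply: (@intble_bounded _ _ _ (p `^ m * Q * S) (mitv _) (itv_oo_fin _ _)).
  exact: weight_measurable.
exact: weight_bound.
Qed.

Lemma resolvent_deriv p : 0 < p <= 1 ->
  let F y := p `^ alpha y * rho y * V p y in
  [/\ {within `[0, L], continuous (V p)},
      is_deriv_on L (V p) 0 (V p 0 * (Su 0 / sigma 0) - (sigma 0)^-1 * L2dot L F u) &
      is_deriv_on L (V p) L (V p 0 * (Su L / sigma L) + (sigma L)^-1 * L2dot L F ub)].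
Proof.
move=> p01 F; have /andP[p0 _] := p01; have [M VM] := bV p0.
have Fi := weight_intble p01 (mV p0) (fun y yL => VM y (subset_itv_oo_cc yL)).
by apply: green_potential_deriv => // x; exact: eqV.
Qed.

(** The Green term is a contraction for small p.  A maximum point of |V p| thus
    gives |V p| <= 2 B |V p 0|, and reinserting this bound shows that V p is
    V p 0 times u up to a relative error of order p^m. *)
Lemma resolvent_first_order : exists2 K : R, 0 <= K &
  \forall p \near 0^'+, 0 < p <= 1 /\
    forall x, x \in `[0, L] -> `|V p x - V p 0 * u x| <= K * p `^ m * `|V p 0|.
Proof.
have [M M0 gM] := green_bounded cu cub.
have [B B0 uB] := continuous_itv_bounded cu.
pose k := Q * M * L / Sb 0.
have k0 : 0 <= k by rewrite divr_ge0 ?mulr_ge0// ltW.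
exists (k * (2 * B)); first by apply: mulr_ge0 => //; apply: mulr_ge0.
have small : \forall p \near 0^'+, 0 < p <= 1 /\ k * p `^ m <= 2^-1.
  (* Chosen so that d^m = 1 / (2 k + 1). *)
  pose d := (2 * k + 1)^-1 `^ m^-1.
  have d0 : 0 < d by rewrite powR_gt0// invr_gt0 ltr_wpDl// mulr_ge0.
  near=> p.
  have p0 : 0 < p by near: p; exact: nbhs_right_gt.
  have p1 : p <= 1 by near: p; apply: nbhs_right_le.
  have pd : p <= d by near: p; exact: nbhs_right_le.
  split; first by rewrite p0.
  have : p `^ m <= (2 * k + 1)^-1.
    apply: le_trans (ge0_ler_powR (ltW m_gt0) (ltW p0) (ltW d0) pd) _.
    by rewrite /d -powRrM mulVf ?gt_eqF// powRr1// invr_ge0 addr_ge0// mulr_ge0.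
  move=> /(ler_wpM2l k0) H; apply: (le_trans H).
  rewrite ler_pdivrMr; last by rewrite ltr_wpDl// mulr_ge0.
  by rewrite mulrDr mulr1 mulrA mulVf ?mul1r// lerDl invr_ge0.
apply: filterS small => p [p01 kp]; split=> // x xL.
have /andP[p0 _] := p01.
have [cV _ _] := resolvent_deriv p01.
have diff S : (forall y, y \in `[0, L] -> `|V p y| <= S) ->
    forall y, y \in `[0, L] -> `|V p y - V p 0 * u y| <= k * p `^ m * S.
  move=> VS y yL; have VS' z : z \in `]0, L[ -> `|V p z| <= S by move=> /subset_itv_oo_cc; exact: VS.
  rewrite -(ler_pM2l omega_gt0) -{1}(gtr0_norm omega_gt0) -normrM -normrN -mulrN opprB.
  rewrite [V p 0 * _]mulrC eqV// /L2dot.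
  have -> : Sb 0 * (k * p `^ m * S) = p `^ m * Q * S * M * (L - 0).
    by rewrite /k; field; rewrite gt_eqF.
  apply: Rintegral_norm_bound => [||z zL]; first exact: ltW.
    apply: measurable_funM; first exact: weight_measurable p0 (mV p0).
    exact: (green_measurable cu cub y).
  by rewrite normrM ler_pM// ?gM//; exact: (weight_bound p01 VS' zL).
have cnV : {within `[0, L], continuous (fun y => `|V p y|)}.
  by rewrite continuous_subspace_in => y _; apply: cvg_norm; exact: cV.
have [c cL maxc] := EVT_max (ltW L0) cnV.
have : `|V p c| <= 2 * B * `|V p 0|.
  (* With S := |V p c|: S <= k p^m S + B |V p 0| <= S / 2 + B |V p 0|. *)
  have := diff _ maxc c cL => H1.
  have H2 : `|V p c| <= `|V p c - V p 0 * u c| + `|V p 0 * u c|.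
    by rewrite -{1}(subrK (V p 0 * u c) (V p c)) ler_normD.
  have H3 : `|V p 0 * u c| <= B * `|V p 0| by rewrite normrM mulrC ler_wpM2r// uB.
  have H4 : k * p `^ m * `|V p c| <= 2^-1 * `|V p c| by rewrite ler_wpM2r.
  by lra.
move=> Vc; apply: le_trans (diff _ maxc x xL) _.
have kp0 : 0 <= k * p `^ m by rewrite mulr_ge0// powR_ge0.
by apply: le_trans (ler_wpM2l kp0 Vc) _; rewrite le_eqVlt; apply/orP; left; apply/eqP; ring.
Unshelve. all: by end_near. Qed.

(** Replacing V p by V p 0 times u in the flux correction produces the terms
    p^a_i, and costs p^m twice: once from the weight and once from the
    approximation. *)
Lemma resolvent_second_order (b : R -> R) (c : R) : {within `[0, L], continuous b} ->
  exists r : R -> R, r =O_ (0^'+) (fun p => p `^ (2 * m)) /\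
    \forall p \near 0^'+, 0 < p <= 1 /\
      c * L2dot L (fun y => p `^ alpha y * rho y * V p y) b =
      V p 0 * (\sum_(0 <= i < n.+1)
        c * \int[mu]_(y in `]xs i, xs i.+1[) (u y * b y * rho y) * p `^ a i + r p).
Proof.
move=> cb; have [K K0 first] := resolvent_first_order.
have [B B0 bB] := continuous_itv_bounded cb; have [M M0 uM] := continuous_itv_bounded cu.
have mb := continuous_itv_oo_measurable cb; have m_u := continuous_itv_oo_measurable cu.
pose N p := c * \int[mu]_(y in `]0, L[) (p `^ alpha y * rho y * ((V p y - V p 0 * u y) * b y)).
(* If V p 0 = 0, then the first-order bound forces N p = 0, and r p = 0 fits. *)
exists (fun p => N p / V p 0).
have rest_measurable p : 0 < p -> measurable_fun (`]0, L[ : set TR) (fun y : TR => (V p y - V p 0 * u y) * b y).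
  move=> p0; apply: measurable_funM => //; apply: measurable_funB; first exact: mV.
  by apply: measurable_funM.
have restb p : (forall x, x \in `[0, L] -> `|V p x - V p 0 * u x| <= K * p `^ m * `|V p 0|) ->
    forall y, y \in `]0, L[ -> `|(V p y - V p 0 * u y) * b y| <= K * p `^ m * `|V p 0| * B.
  by move=> H y /subset_itv_oo_cc yL; rewrite normrM ler_pM ?H ?bB.
have NB p : 0 < p <= 1 ->
    (forall x, x \in `[0, L] -> `|V p x - V p 0 * u x| <= K * p `^ m * `|V p 0|) ->
    `|N p| <= `|c| * (Q * K * B * L) * p `^ (2 * m) * `|V p 0|.
  move=> p01 H; have /andP[p0 _] := p01; rewrite normrM -!mulrA ler_wpM2l//.
  have -> : p `^ (2 * m) = p `^ m * p `^ m.
    by rewrite -powRD ?(gt_eqF p0) ?implybT//; congr (_ `^ _); ring.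
  have -> : Q * (K * (B * (L * (p `^ m * p `^ m * `|V p 0|)))) =
            p `^ m * Q * (K * p `^ m * `|V p 0| * B) * (L - 0) by ring.
  apply: Rintegral_norm_bound (ltW L0) _ _; first exact: weight_measurable p0 (rest_measurable p p0).
  exact: (weight_bound p01 (restb p H)).
split.
  apply/eqO_exP; exists (`|c| * (Q * K * B * L) + 1); first by rewrite ltr_wpDl// !mulr_ge0// ltW.
  apply: filterS first => p [p01 H]; rewrite /= (ger0_norm (powR_ge0 _ _)).
  have pos : 0 <= (`|c| * (Q * K * B * L) + 1) * p `^ (2 * m).
    by rewrite mulr_ge0 ?powR_ge0// addr_ge0// !mulr_ge0// ltW.
  have [->|V0] := eqVneq (V p 0) 0; first by rewrite invr0 mulr0 normr0.
  rewrite normrM normfV ler_pdivrMr ?normr_gt0//; apply: (le_trans (NB p p01 H)).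
  by rewrite ler_wpM2r// ler_wpM2r ?powR_ge0// lerDl.
apply: filterS first => p [p01 H]; split=> //; have /andP[p0 _] := p01.
have [S VS] := bV p0.
have ub_bound y : y \in `]0, L[ -> `|u y * b y| <= M * B.
  by move=> /subset_itv_oo_cc yL; rewrite normrM ler_pM ?uM ?bB.
have mub : measurable_fun (`]0, L[ : set TR) (fun y : TR => u y * b y) by exact: measurable_funM.
have iub := weight_intble p01 mub ub_bound.
have irest := weight_intble p01 (rest_measurable p p0) (restb p H).
have -> : V p 0 * (\sum_(0 <= i < n.+1)
    c * \int[mu]_(y in `]xs i, xs i.+1[) (u y * b y * rho y) * p `^ a i + N p / V p 0) =
    c * (V p 0 * \int[mu]_(y in `]0, L[) (p `^ alpha y * rho y * (u y * b y))) + N p.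
  rewrite mulrDr; congr (_ + _); last first.
    have [V0|V0] := eqVneq (V p 0) 0; last by rewrite mulrC divfK.
    rewrite V0 mul0r; apply/esym/eqP; rewrite -normr_le0.
    by apply: (le_trans (NB p p01 H)); rewrite V0 normr0 mulr0.
  rewrite mulrCA; congr (_ * _); rewrite (Rintegral_partition xs0 xsL xs_incr iub) mulr_sumr.
  apply: eq_big_nat => i /andP[_ iln]; rewrite -mulrA; congr (_ * _).
  have iub1 : intble `]xs i, xs i.+1[ (fun y => u y * b y * rho y).
    apply: (intbleS (mitv _) (mitv _) (piece_subset xs0 xsL xs_incr iln)).
    apply: (@intble_bounded _ _ _ (M * B * Q) (mitv _) (itv_oo_fin _ _)).
      exact: measurable_funM.
    by move=> y yL; rewrite normrM ler_pM ?rhoQ// ub_bound.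
  rewrite -(RintegralZr _ (mitv _) iub1); apply: eq_Rintegral => y; rewrite mem_itvE => yi.
  by rewrite (piecewise_constantE a xs_incr iln yi); ring.
rewrite /N -mulrDr; congr (_ * _).
rewrite -(RintegralZl _ (mitv _) iub) -(RintegralD (mitv _) (intbleZ _ (mitv _) iub) irest).
by apply: eq_Rintegral => y _; ring.
Qed.

End asymptotics.

(** * Classical solutions and truncated coefficients *)

Section classical_solutions.
Context {R : realType}.
Local Notation mu := (@lebesgue_measure R).
Local Notation TR := (measurableTypeR R).
Local Notation intble D f := (mu.-integrable D (EFin \o f)).

Definition lipschitz_itv (L : R) (f : R -> R) (k : R) : Prop :=
  forall x y, x \in `[0, L] -> y \in `[0, L] -> `|f x - f y| <= k * `|x - y|.

Lemma primitive_lipschitz L F f M : is_primitive L F f ->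
  (forall x, x \in `]0, L[ -> `|f x| <= M) -> lipschitz_itv L F M.
Proof.
move=> pF fM x y; wlog xy : x y / x <= y.
  move=> H xL yL; case: (leP x y) => [|/ltW] xy; first exact: H.
  by rewrite distrC [`|x - y|]distrC; exact: H.
rewrite !in_itv/= => /andP[x0 _] /andP[_ yL]; rewrite distrC [`|x - y|]distrC.
rewrite [in leRHS]ger0_norm ?subr_ge0//.
have := primitive_incr_bound (c := 0) (e := M) pF x0 xy yL; rewrite mul0r subr0; apply.
move=> z /andP[xz zy]; rewrite subr0 fM// in_itv/=.
by rewrite (le_lt_trans x0 xz) (lt_le_trans zy yL).
Qed.

Lemma lipschitz_itvM L f g k1 k2 A B : lipschitz_itv L f k1 -> lipschitz_itv L g k2 ->
  (forall x, x \in `[0, L] -> `|f x| <= A) -> (forall x, x \in `[0, L] -> `|g x| <= B) ->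
  lipschitz_itv L (fun x => f x * g x) (k1 * B + A * k2).
Proof.
move=> fk gk fA gB x y xL yL.
rewrite (_ : _ - _ = (f x - f y) * g x + f y * (g x - g y)); last by ring.
apply: (le_trans (ler_normD _ _)); rewrite !normrM mulrDl; apply: lerD.
  by rewrite mulrAC ler_pM// ?gB ?fk.
by rewrite -mulrA ler_pM// ?fA ?gk.
Qed.

Lemma lipschitz_itvV L f k (s0 : R) : 0 < s0 -> (forall x, x \in `[0, L] -> s0 <= f x) ->
  lipschitz_itv L f k -> lipschitz_itv L (fun x => (f x)^-1) (k / s0 ^+ 2).
Proof.
move=> s0_gt0 fs fk x y xL yL; have fx := lt_le_trans s0_gt0 (fs x xL).
have fy := lt_le_trans s0_gt0 (fs y yL).
rewrite (_ : _ - _ = (f y - f x) / (f x * f y)); last by field; rewrite !gt_eqF.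
rewrite normrM normfV (gtr0_norm (mulr_gt0 fx fy)) distrC [leRHS]mulrAC.
rewrite ler_pM ?invr_ge0 ?mulr_ge0 ?(ltW fx) ?(ltW fy) ?fk//.
by rewrite lef_pV2 ?posrE ?mulr_gt0 ?exprn_gt0// expr2 ler_pM ?fs// ltW.
Qed.

Lemma lipschitz_itv_continuous L f k : lipschitz_itv L f k -> {within `[0, L], continuous f}.
Proof.
move=> fk; apply/within_continuousP => x xL e e0.
have k0 : 0 < `|k| + 1 by rewrite ltr_wpDl.
exists (e / (`|k| + 1)); first by rewrite divr_gt0.
move=> y yL; rewrite ltr_pdivlMr// => yx; apply: (le_trans (fk y x yL xL)).
apply: le_trans (ltW yx); rewrite mulrC ler_wpM2l//.
by apply: (le_trans (ler_norm _)); rewrite lerDl.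
Qed.

Variables (L : R) (sigma dsigma q q' : R -> R) (s0 Q : R).
Hypotheses (L0 : 0 < L) (psigma : is_primitive L sigma dsigma)
  (cdsigma : {within `[0, L], continuous dsigma}) (s0_gt0 : 0 < s0)
  (sigma_ge : forall x, x \in `[0, L] -> s0 <= sigma x)
  (mq : measurable_fun (`]0, L[ : set TR) q)
  (q_bounds : forall x, x \in `]0, L[ -> 0 <= q x <= Q)
  (qq' : {ae mu, forall x, x \in `]0, L[ -> q x = q' x}).

Let csigma := primitive_continuous psigma.

Let sigma_neq0 x : x \in `[0, L] -> sigma x != 0.
Proof. by move=> /sigma_ge xs; rewrite gt_eqF// (lt_le_trans s0_gt0 xs). Qed.

Let sigma_lipschitz : exists k, lipschitz_itv L sigma k.
Proof.
have [M _ HM] := continuous_itv_bounded cdsigma; exists M.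
by apply: primitive_lipschitz psigma _ => x /subset_itv_oo_cc; exact: HM.
Qed.

Lemma sl_solution_C11 v S : sl_solution L sigma q (fun=> 0) v S ->
  C11_solution L sigma q' (v 0) (v L) v.
Proof.
move=> [pv pS]; have cv := primitive_continuous pv; have cS := primitive_continuous pS.
exists (fun x => S x / sigma x); split=> //.
- move=> x xL; apply: (primitive_deriv_on pv xL).
  exact: (continuous_within_div_sigma csigma s0_gt0 sigma_ge cS).
- have [k1 sk] := sigma_lipschitz.
  have [Mv Mv0 HMv] := continuous_itv_bounded cv; have [MS MS0 HMS] := continuous_itv_bounded cS.
  have Sk : lipschitz_itv L S (Q * Mv).
    apply: primitive_lipschitz pS _ => x xL; rewrite addr0 normrM.
    have /andP[q0 qQ] := q_bounds xL.
    by rewrite ler_pM// ?HMv ?(subset_itv_oo_cc xL)// ger0_norm.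
  have iB x : x \in `[0, L] -> `|(sigma x)^-1| <= s0^-1.
    move=> xL; have sx := sigma_ge xL; have sx0 := lt_le_trans s0_gt0 sx.
    by rewrite normfV (gtr0_norm sx0) lef_pV2 ?posrE.
  have K := lipschitz_itvM Sk (lipschitz_itvV s0_gt0 sigma_ge sk) HMS iB.
  by eexists => -[x y]/= [xL yL]; exact: (K x y xL yL).
- apply: aeS2 (primitive_ae_derivable pS) qq' => x H qx xL; have [dS eS] := H xL.
  have [|d e] := @near_shift_derivable _ (sigma \* (fun x => S x / sigma x)) S 0 x dS.
    apply: filterS (near_in_itvoo xL) => y /subset_itv_oo_cc yL.
    by rewrite addr0 /= mulrC divfK// sigma_neq0.
  by split=> //; rewrite e eS addr0 (qx xL) addNr.
Qed.

(** The flux of a C^{1,1} solution is Lipschitz, hence the integral of its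
    almost everywhere derivative q v. *)
Lemma C11_sl_solution a b v : C11_solution L sigma q' a b v ->
  exists S, sl_solution L sigma q (fun=> 0) v S.
Proof.
move=> [dv [dvv [k dvk] eqn _ _]].
have dvk' : lipschitz_itv L dv k by move=> x y xL yL; exact: (dvk (x, y)).
have cdv := lipschitz_itv_continuous dvk'.
have pv := deriv_on_primitive L0 dvv cdv; have cv := primitive_continuous pv.
have [k1 sk] := sigma_lipschitz.
have [A _ HA] := continuous_itv_bounded csigma; have [B _ HB] := continuous_itv_bounded cdv.
have Sk := lipschitz_itvM sk dvk' HA HB.
exists (sigma \* dv); split.
  apply: eq_primitive pv => // x /subset_itv_oo_cc xL.
  by rewrite /= mulrAC mulfV ?mul1r// sigma_neq0.
apply: (@lipschitz_primitive _ L `|k1 * B + A * k|) => //.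
- by move=> x y xL yL; apply: (le_trans (Sk x y xL yL)); rewrite ler_wpM2r// ler_norm.
- apply: measurable_funD; last exact: measurable_cst.
  by apply: measurable_funM => //; exact: continuous_itv_oo_measurable.
- apply: aeS2 eqn qq' => x H qx xL; have [d e] := H xL; split=> //.
  by rewrite (qx xL) addr0; move/eqP: e; rewrite addrC subr_eq0 => /eqP.
Qed.

Lemma C11_solution_eq a b u Su ub Sb v :
  sl_solution L sigma q (fun=> 0) u Su -> sl_solution L sigma q (fun=> 0) ub Sb ->
  u 0 = 1 -> u L = 0 -> ub 0 = 0 -> ub L = 1 -> 0 < Sb 0 ->
  C11_solution L sigma q' a b v ->
  forall x, x \in `[0, L] -> v x = a * u x + b * ub x.
Proof.
move=> su sub u0 uL ub0 ubL w0 Cv x xL; have [S sS] := C11_sl_solution Cv.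
have [_ [_ _ _ va vb]] := Cv.
have zero (w : R -> R) c d : \int[mu]_(y in `]c, d[) (0 * w y) = 0.
  rewrite -[RHS](Rintegral_zero (`]c, d[ : set TR)).
  by apply: eq_Rintegral => y _; rewrite mul0r.
have := sl_green su sub u0 uL ub0 ubL sS xL; rewrite !zero !subr0 va vb => E.
have w0' : Sb 0 != 0 by rewrite gt_eqF.
by apply: (mulfI w0'); rewrite E; ring.
Qed.

End classical_solutions.

Section truncation.
Context {R : realType}.
Local Notation mu := (@lebesgue_measure R).
Local Notation TR := (measurableTypeR R).

(** Modifying an essentially bounded coefficient on a null set makes its bounds
    hold everywhere. *)
Lemma Linfty_truncate (L : R) (f : R -> R) : Linfty L f ->
  {ae mu, forall x, x \in `]0, L[ -> 0 <= f x} ->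
  exists (h : R -> R) (Q : R), [/\ measurable_fun (`]0, L[ : set TR) h,
    measurable_fun (`]0, L[ : set TR) f, forall x, 0 <= h x <= Q &
    {ae mu, forall x, x \in `]0, L[ -> h x = f x}].
Proof.
rewrite /Linfty/= => /[!inE] /andP[]; rewrite !inE/= => mf fn f0.
have mf' : measurable_fun (`]0, L[ : set TR) f.
  by have := (measurable_restrict f (mitv _) measurableT).2 mf; rewrite setTI.
have muT : (0 < mu [set: TR])%E.
  apply: (@lt_le_trans _ _ (mu `]0%R, 1%R[)).
    by rewrite lebesgue_measure_itv/= lte_fin ltr01 oppr0 adde0 lte_fin.
  by apply: le_measure => //; rewrite inE.
have [M HM] : exists M : R, {ae mu, forall x, x \in `]0, L[ -> `|f x| <= M}.
  move: fn; rewrite /finite_norm unlock muT.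
  have := ess_sup_ge mu (abse \o (EFin \o (f \_ `]0, L[))).
  case: ess_sup => [M| |] // H _; [exists M|exists 0]; apply: aeS H => x /= + xL.
  - by rewrite patchE mem_itvE xL lee_fin.
  - by rewrite leeNy_eq.
exists (fun x => Num.max 0 (Num.min `|M| (f x))), `|M|; split=> //.
- apply: measurable_maxr; first exact: measurable_cst.
  by apply: measurable_minr => //; exact: measurable_cst.
- by move=> x; rewrite le_max lexx/= ge_max normr_ge0 ge_min lexx.
- apply: aeS2 HM f0 => x fM fx xL; have fx0 := fx xL.
  have fxM : f x <= `|M| by rewrite (le_trans (ler_norm _) (le_trans (fM xL) (ler_norm _))).
  by rewrite (min_idPr fxM) (max_idPr fx0).
Qed.

Lemma weak_deriv_measurable (L : R) (f : R -> R) :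
  measurable_fun (`]0, L[ : set TR) (weak_deriv L f).
Proof.
rewrite /weak_deriv; case: xgetP => [g _ [Lg _]|_]; last exact: measurable_cst.
exact: L2_measurable.
Qed.

End truncation.

(** * The expansion of the boundary fluxes *)

Lemma eq_is_deriv_on {R : realType} (L : R) (f g : R -> R) (x l : R) :
  (forall y, y \in `[0, L] -> f y = g y) -> x \in `[0, L] ->
  is_deriv_on L f x l -> is_deriv_on L g x l.
Proof.
move=> fg xL /is_deriv_onP H; apply/is_deriv_onP => e e0; have [d d0 Hd] := H e e0.
by exists d => // y yL; rewrite -!fg//; exact: Hd.
Qed.

Theorem theorem2p1 (R : realType)
  (L : R) (hL : 0 < L)
  (rho : R -> R) (rho0 rhoM : R) (hrho : Linfty L rho) (hrho0 : 0 < rho0)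
  (hrhob : {ae @lebesgue_measure R, forall x, x \in `]0, L[ ->
     rho0 <= rho x <= rhoM})
  (sigma : R -> R) (sigma0 sigmaM : R) (hsigma : C1_on L sigma)
  (hsigma0 : 0 < sigma0)
  (hsigmab : forall x, x \in `[0, L] -> sigma0 <= sigma x <= sigmaM)
  (q : R -> R) (hq : Linfty L q)
  (hq0 : {ae @lebesgue_measure R, forall x, x \in `]0, L[ -> 0 <= q x})
  (n : nat) (xs : nat -> R) (hxs0 : xs 0%N = 0) (hxsL : xs n.+1 = L)
  (hxs : forall i : nat, (i <= n)%N -> xs i < xs i.+1)
  (a : nat -> R) (ha : forall i : nat, (i <= n)%N -> 0 < a i < 1)
  (haminmax : max_order n a < 2 * min_order n a)
  (N : nat) (hN : (2 <= N)%N) (gc : nat -> R) (hgc : gc N != 0)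
  (g : R -> R) (hg : forall t, g t = \sum_(2 <= k < N.+1) gc k * t ^+ k)
  (U : R -> R -> R)
  (hU : strong_solution L rho sigma q (piecewise_constant n xs a) g U)
  (hUexp : subexponential L U) :
  exists u ub : R -> R,
    [/\ C11_solution L sigma q 1 0 u &
        forall v, C11_solution L sigma q 1 0 v ->
          forall x, x \in `[0, L] -> v x = u x] /\
    [/\ C11_solution L sigma q 0 1 ub &
        forall v, C11_solution L sigma q 0 1 v ->
          forall x, x \in `[0, L] -> v x = ub x] /\
    (forall x, x \in `]0, L[ -> 0 < u x /\ 0 < ub x) /\
    exists C Ct : nat -> R,
      [/\ is_deriv_on L u 0 (C 0%N),
          is_deriv_on L u L (Ct 0%N) &
          is_deriv_on L ub 0 (- (sigma L / sigma 0) * Ct 0%N)] /\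
      (forall i : nat, (i <= n)%N ->
         C i.+1 = - (sigma 0)^-1 *
           \int[@lebesgue_measure R]_(x in `]xs i, xs i.+1[)
             (u x ^+ 2 * rho x) /\
         Ct i.+1 = (sigma L)^-1 *
           \int[@lebesgue_measure R]_(x in `]xs i, xs i.+1[)
             (u x * ub x * rho x)) /\
      exists r rt : R -> R,
        [/\ r =O_ (0^'+) (fun p => p `^ (2 * min_order n a)),
            rt =O_ (0^'+) (fun p => p `^ (2 * min_order n a)),
            \forall p \near 0^'+,
              is_deriv_on L (fun x => laplace (U ^~ x) p) 0
                (laplace g p * (C 0%N +
                   \sum_(0 <= i < n.+1) C i.+1 * p `^ a i + r p)) &
            \forall p \near 0^'+,
              is_deriv_on L (fun x => laplace (U ^~ x) p) L
                (laplace g p * (Ct 0%N +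
                   \sum_(0 <= i < n.+1) Ct i.+1 * p `^ a i + rt p))].
Proof.
pose TR := measurableTypeR R.
have [dsigma dsig cds] := hsigma.
have psig := deriv_on_primitive hL dsig cds.
have csig := primitive_continuous psig.
have sig_ge x : x \in `[0, L] -> sigma0 <= sigma x by move=> /hsigmab /andP[].
have sig_gt0 x : x \in `[0, L] -> 0 < sigma x by move=> /sig_ge; exact: lt_le_trans.
have z_in : 0 \in `[0, L] by rewrite in_itv/= lexx ltW.
have L_in : L \in `[0, L] by rewrite in_itv/= lexx ltW.
(* The equation, the solutions u and ub and the coefficients depend on q and rho
   only up to null sets. *)
have [q1 [Q1 [mq1 mq q1b q1q]]] := Linfty_truncate hq hq0.
have rho_ge0 : {ae @lebesgue_measure R, forall x, x \in `]0, L[ -> 0 <= rho x}.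
  by apply: aeS hrhob => x H xL; have /andP[+ _] := H xL; apply: le_trans; exact: ltW.
have [rho1 [Q2 [mrho1 mrho rho1b rho1E]]] := Linfty_truncate hrho rho_ge0.
have Q1_ge0 : 0 <= Q1 by have /andP[a1] := q1b 0; exact: le_trans.
have Q2_ge0 : 0 <= Q2 by have /andP[a1] := rho1b 0; exact: le_trans.
have q1Q x : x \in `]0, L[ -> `|q1 x| <= Q1 + Q2.
  by move=> _; have /andP[a1 a2] := q1b x; rewrite ger0_norm// (le_trans a2)// lerDl.
have rho1Q x : x \in `]0, L[ -> `|rho1 x| <= Q1 + Q2.
  by move=> _; have /andP[a1 a2] := rho1b x; rewrite ger0_norm// (le_trans a2)// lerDr.
have q1B x : x \in `]0, L[ -> 0 <= q1 x <= Q1 by [].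
have [u [Su [ub [Sb [su sub [u0 uL ub0 ubL] w0 upos]]]]] :=
  sl_dirichlet_pair hL csig hsigma0 sig_ge mq1 q1B.
have cu := primitive_continuous su.1; have cub := primitive_continuous sub.1.
have C11 := sl_solution_C11 psig cds hsigma0 sig_ge q1B q1q.
have uniq a1 b1 v := C11_solution_eq (a := a1) (b := b1) (v := v) hL psig cds hsigma0 sig_ge mq1 q1q
  su sub u0 uL ub0 ubL w0.
exists u, ub; split.
  split; first by have := C11 _ _ su; rewrite u0 uL.
  by move=> v Cv x xL; rewrite (uniq 1 0 v Cv x xL) mul1r mul0r addr0.
split.
  split; first by have := C11 _ _ sub; rewrite ub0 ubL.
  by move=> v Cv x xL; rewrite (uniq 0 1 v Cv x xL) mul1r mul0r add0r.
split=> //.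
have [dU [[dUU cdU] [H2U cU] eqU bdU U0]] := hU.
have UL t : 0 < t -> U t L = 0 by move=> /bdU[].
have eqU1 t : 0 < t -> exists2 W, is_caputo L (piecewise_constant n xs a) dU t W &
    forall psi, L2 L psi -> L2dot L (fun x => rho1 x * W x
      - weak_deriv L (sigma \* weak_deriv L (U t)) x + q1 x * U t x) psi = 0.
  move=> t0; have [W cW eqW] := eqU t t0; exists W => // psi Lpsi; rewrite -[RHS](eqW psi Lpsi).
  have mW := L2_measurable cW.1; have mpsi := L2_measurable Lpsi.
  have mU := continuous_itv_oo_measurable (H2U t (ltW t0)).2.
  have mz := weak_deriv_measurable (L := L) (sigma \* weak_deriv L (U t)).
  have meas (r s : R -> R) : measurable_fun (`]0, L[ : set TR) r ->
      measurable_fun (`]0, L[ : set TR) s -> measurable_fun (`]0, L[ : set TR)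
      (fun x : TR => (r x * W x - weak_deriv L (sigma \* weak_deriv L (U t)) x + s x * U t x) * psi x).
    move=> mr ms; apply: measurable_funM => //; apply: measurable_funD; last exact: measurable_funM.
    by apply: measurable_funB => //; exact: measurable_funM.
  apply: (ae_eq_Rintegral (mitv _) (meas _ _ mrho1 mq1) (meas _ _ mrho mq)).
  by apply: aeS2 rho1E q1q => x Er Eq xL; rewrite (Er xL) (Eq xL).
pose V p x := \int[@lebesgue_measure R]_(t in `]0, +oo[) (expR (- (p * t)) * U t x).
have half (p : R) : 0 < p -> 0 < p / 2 /\ p / 2 < p.
  by move=> p0; split; rewrite ?divr_gt0// ltr_pdivrMr// ltr_pMr// ltr1n.
have mV p : 0 < p -> measurable_fun (`]0, L[ : set TR) (V p).
  move=> p0; have [e0 ep] := half p p0; have [C C0 UC] := solution_bound hL H2U hUexp e0.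
  exact: (laplace_measurable hL H2U cU ep UC).
have bV p : 0 < p -> exists M : R, forall x, x \in `[0, L] -> `|V p x| <= M.
  move=> p0; have [e0 ep] := half p p0; have [C C0 UC] := solution_bound hL H2U hUexp e0.
  exact: (laplace_bounded hL H2U cU ep UC).
have eqV p x : 0 < p -> x \in `[0, L] -> Sb 0 * (u x * V p 0 - V p x) =
    L2dot L (fun y => p `^ piecewise_constant n xs a y * rho1 y * V p y) (green L u ub x).
  exact: (resolvent_equation hL cu cub psig cds sig_gt0 mq1 q1Q mrho1 rho1Q su sub u0 uL ub0 ubL
    hxs0 hxsL hxs ha dUU cdU H2U cU hUexp UL U0 eqU1).
have Ui p x : 0 < p -> x \in `[0, L] ->
    lebesgue_measure.-integrable `]0, +oo[ (EFin \o (fun t => expR (- (p * t)) * U t x)).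
  move=> p0 xL; have [e0 ep] := half p p0; have [C C0 UC] := solution_bound hL H2U hUexp e0.
  exact: (laplace_intble ep (solution_continuous hL H2U cU xL) (fun t t0 => UC t x t0 xL)).
have lapU p x : 0 < p -> x \in `[0, L] -> laplace (U ^~ x) p = V p x.
  by move=> p0 xL; rewrite /laplace -(Rintegral_itv_obnd_cbnd (Ui p x p0 xL)).
have lapg p : 0 < p -> laplace g p = V p 0.
  move=> p0; have gU t : 0 < t -> U t 0 = g t by move=> /bdU[].
  rewrite /laplace -Rintegral_itv_obnd_cbnd.
    by apply: eq_Rintegral => t; rewrite mem_itvE in_itv/= andbT => t0; rewrite gU.
  apply: (eq_intble (mitv _) _ (Ui p 0 p0 z_in)) => t /=; rewrite in_itv/= andbT => t0.
  by rewrite gU.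
have rhoE (i : nat) (b : R -> R) : (i <= n)%N -> {within `[0, L], continuous b} ->
    \int[@lebesgue_measure R]_(x in `]xs i, xs i.+1[) (u x * b x * rho1 x) =
    \int[@lebesgue_measure R]_(x in `]xs i, xs i.+1[) (u x * b x * rho x).
  move=> iln cb; have sub_i := piece_subset hxs0 hxsL hxs iln.
  have meas (r : R -> R) : measurable_fun (`]0, L[ : set TR) r ->
      measurable_fun (`]xs i, xs i.+1[ : set TR) (fun x : TR => u x * b x * r x).
    move=> mr; apply: (measurable_funS (mitv _) sub_i); apply: measurable_funM => //.
    by apply: measurable_funM; exact: continuous_itv_oo_measurable.
  apply: (ae_eq_Rintegral (mitv _) (meas _ mrho1) (meas _ mrho)).
  by apply: aeS rho1E => x Er xi; rewrite Er//; exact: sub_i.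
pose C i := if i is j.+1 then - (sigma 0)^-1 *
  \int[@lebesgue_measure R]_(x in `]xs j, xs j.+1[) (u x ^+ 2 * rho x) else Su 0 / sigma 0.
pose Ct i := if i is j.+1 then (sigma L)^-1 *
  \int[@lebesgue_measure R]_(x in `]xs j, xs j.+1[) (u x * ub x * rho x) else Su L / sigma L.
have cdiv := continuous_within_div_sigma csig hsigma0 sig_ge.
have du x (xL : x \in `[0, L]) :=
  primitive_deriv_on su.1 xL (cdiv _ (primitive_continuous su.2)).
exists C, Ct; split.
  split; [exact: du|exact: du|].
  have := primitive_deriv_on sub.1 z_in (cdiv _ (primitive_continuous sub.2)).
  congr is_deriv_on; rewrite /Ct (sl_flux_end hL su sub u0 uL ub0 ubL); field.
  by rewrite !gt_eqF ?sig_gt0.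
split=> //.
have deriv := resolvent_deriv hL csig hsigma0 sig_ge su sub u0 uL ub0 ubL w0 mrho1 rho1Q hxs mV bV eqV.
have flux b c cb := @resolvent_second_order _ L sigma q1 u Su ub Sb _ hL csig hsigma0 sig_ge su sub u0 uL
  ub0 ubL w0 rho1 _ mrho1 rho1Q n xs a hxs0 hxsL hxs ha V mV bV eqV b c cb.
have [r [rO rE]] := flux u (- (sigma 0)^-1) cu.
have [rt [rtO rtE]] := flux ub (sigma L)^-1 cub.
exists r, rt; split=> //.
- apply: filterS rE => p [p01 E]; have /andP[p0 _] := p01; have [_ D _] := deriv p p01.
  apply: (eq_is_deriv_on _ z_in) => [x xL|]; first exact/esym/lapU.
  move: D; congr is_deriv_on; rewrite lapg// -addrA mulrDr -mulNr E; congr (_ + _ * (_ + _)).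
  by apply: eq_big_nat => i /andP[_ iln]; rewrite (rhoE i u iln cu).
- apply: filterS rtE => p [p01 E]; have /andP[p0 _] := p01; have [_ _ D] := deriv p p01.
  apply: (eq_is_deriv_on _ L_in) => [x xL|]; first exact/esym/lapU.
  move: D; congr is_deriv_on; rewrite lapg// -addrA mulrDr E; congr (_ + _ * (_ + _)).
  by apply: eq_big_nat => i /andP[_ iln]; rewrite (rhoE i ub iln cub).
Qed.
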